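(* For each type $\widetilde{W}/W\in\{\widetilde{C}_n/C_n,\widetilde{B}_n/B_n,\widetilde{B}_n/D_n,\widetilde{D}_n/D_n\}$, the map $w\mapsto\mathcal{B}(w)$ is a bijection of $\widetilde{W}/W$ onto the following set of partitions: - $\widetilde{C}/C$: partitions with parts of size $\le 2n$, where parts of size $1,\dots,n$ may occur at most once. - $\widetilde{B}/B$: partitions with parts of size $\le 2n-1$, where parts of size $1,\dots,n-1$ may occur at most once. - $\widetilde{B}/D$: partitions with parts of size $\le 2n-1$, where parts of size $1,\dots,n-1$ may occur at most once, and one of the parts of size $n$ may be starred. - $\widetilde{D}/D$: partitions with parts of size $\le 2n-2$, where parts of size $1,\dots,n-2$ may occur at most once, and one of the parts of size $n-1$ may be starred.
   Context: Groups. Let $N=2n+1$. A mirrored $\mathbb{Z}$-permutation is a bijection $w:\mathbb{Z}\to\mathbb{Z}$ with $w(i+N)=w(i)+N$ and $w(-i)=-w(i)$ for all $i\in\mathbb{Z}$; it is determined by $(w(1),\dots,w(n))$. Under composition these form the affine Coxeter group $\widetilde{C}_n$. Define elements by their images $(w(1),\dots,w(n))$: $s_i=(1,\dots,i-1,i+1,i,i+2,\dots,n)$ for $1\le i\le n-1$; $s_0^C=(-1,2,3,\dots,n)$; $s_0^D=(-2,-1,3,\dots,n)$; $s_n^C=(1,\dots,n-1,n+1)$; $s_n^D=(1,\dots,n-2,n+1,n+2)$. The four types are: - $\widetilde{C}/C$: $\widetilde{W}$ is all mirrored $\mathbb{Z}$-permutations, generators $s_0=s_0^C,s_1,\dots,s_{n-1},s_n=s_n^C$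 ($n\ge2$). - $\widetilde{B}/B$: those with $|\{i\le0:w(i)\ge1\}|$ even, generators $s_0=s_0^D,s_1,\dots,s_{n-1},s_n=s_n^C$ ($n\ge3$). - $\widetilde{B}/D$: those with $|\{i\le n:w(i)\ge n+1\}|$ even, generators $s_0=s_0^C,s_1,\dots,s_{n-1},s_n=s_n^D$ ($n\ge3$). - $\widetilde{D}/D$: those satisfying both parity conditions, generators $s_0=s_0^D,s_1,\dots,s_{n-1},s_n=s_n^D$ ($n\ge4$). $W$ is generated by $s_1,\dots,s_n$, and $\widetilde{W}/W$ denotes the set of minimal length representatives of the cosets $wW$; $\widetilde{W}$ acts on it by left multiplication of cosets. Abaci and cores. An abacus has runners (columns) $1,\dots,2n$; runner $i$ has entries labeled $mN+i$ for each level $m\in\mathbb{Z}$; some entries are beads, the others gaps; reading order is the order of labels; ''lowest'' means largest label; the abacus is flush if no bead is preceded by a gap on its runner. $\mathcal{A}(w)$ is the flush abacus whose lowest bead in each runner is an element of $\{w(1),\dots,w(2n)\}$. $\mathcal{C}(w)$ is the partition whose southeast boundary is the lattice path obtained by reading the entries of $\mathcal{A}(w)$ in reading order, recording a north-step for each bead and an east-step for each gap (first row at the top). $w\mapsto\mathcal{C}(w)$ is injective on $\widetilde{W}/W$, and $\widetilde{W}$ acts on its image by transport of structure. Residues. Entries of $\mathbb{N}^2$ are $(i,j)$ = (row, column); the $k$-th diagonal is $\{j-i=k\}$ and the main diagonal is $k=0$. Write $p\,\|\,q$ for the element of $\{0,\dots,q-1\}$ congruent to $p$ mod $q$. The fixed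 residue of $(i,j)$ is $(j-i)\|(2n)$ if this is $\le n$, and $2n-((j-i)\|(2n))$ otherwise. An escalator is a connected component of the cells with $(j-i)\|(2n)\in\{n-1,n,n+1\}$; a descalator is a connected component of the cells with $(j-i)\|(2n)\in\{0,1,2n-1\}$; upper means above the main diagonal, lower means below; the descalator containing the main diagonal is the main descalator. Given $\lambda$, let a row meet an upper escalator in cells $c_1,c_2,c_3$ (left to right): if the row of $\lambda$ ends immediately left of $c_1$, then $c_1$ has both residues $n-1,n$, $c_2$ has residue $n$, $c_3$ undefined; if it ends at $c_1$: residues $n-1,n,n$; if it ends at $c_2$: $n,n,n-1$; if it ends at $c_3$: $c_1$ undefined, $c_2$ has residue $n$, $c_3$ has both residues $n-1,n$; otherwise undefined. Upper descalators: the same rule with $n-1$ replaced by $1$ and $n$ by $0$. Lower escalators/descalators: transposed rule, column by column. Main descalator: residue $0$ if $i=j$; if $|i-j|=1$, residue $1$ when $i+j\equiv1$ mod $4$ and $0$ when $i+j\equiv3$ mod $4$. Type $\widetilde{C}/C$ uses fixed residues only; $\widetilde{B}/B$ uses the descalator rules on descalators; $\widetilde{B}/D$ uses the escalator rules on escalators; $\widetilde{D}/D$ uses both; all remaining cells have their fixed residue. Central peeling procedure. The reference diagonal is the main diagonal in types $\widetilde{C}/C,\widetilde{B}/D$ and the first diagonal in types $\widetilde{B}/B,\widetilde{D}/D$. Start with $\lambda^{(1)}=\lambda=\mathcal{C}(w)$. At step $i$ (while $\lambda^{(i)}$ is nonempty) let $d^{(i)}$ be the number of boxes of $\lambda^{(i)}$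 on the reference diagonal, $B_i$ the box at the end of the $d^{(i)}$-th row of $\lambda^{(i)}$, and $r_i$ its residue; if $B_i$ is both $n$-removable and $(n-1)$-removable (has both residues), set $r_i=n$. Let $\lambda^{(i+1)}$ be the result of $s_{r_i}$ acting on $\lambda^{(i)}$. The upper diagram $U_\lambda$ is the set of boxes $B_i$ encountered, with the following conditions: in types $\widetilde{B}/D,\widetilde{D}/D$, an application of $s_n^D$ removes two boxes from row $d^{(i)}$ and the box not on the $n$-th diagonal is recorded; in types $\widetilde{B}/B,\widetilde{D}/D$, an application of $s_0^D$ removes two boxes from row $d^{(i)}$ and the box not on the main or $2n$-th diagonal is recorded. Each recorded box carries the residue $r_i$. Bounded partition. $\mathcal{B}(w)=\mathcal{B}(\lambda)$ is the partition $\beta$ whose $i$-th part is the number of boxes in row $i$ of $U_\lambda$ (zero parts are disregarded). In type $\widetilde{B}/D$ (respectively $\widetilde{D}/D$), if there is a part of size $n$ (respectively $n-1$) and the last (lowest) part of this size has rightmost box in $U_\lambda$ with residue $n-1$, then that part is adorned with a star. Thus at most one star occurs, always on the last part of the relevant size. *)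

(* Defs.v *)
From mathcomp Require Import all_boot all_order all_algebra.
From mathcomp Require Import all_classical.

Set Implicit Arguments.
Unset Strict Implicit.
Unset Printing Implicit Defensive.

Import Order.TTheory GRing.Theory Num.Theory.

Local Open Scope classical_set_scope.
Local Open Scope ring_scope.

Inductive quotient_type := C_over_C | B_over_B | B_over_D | D_over_D.

Definition min_rank (T : quotient_type) : nat :=
  match T with C_over_C => 2 | B_over_B => 3 | B_over_D => 3 | D_over_D => 4 end.

(* Is s_0 equal to s_0^D (otherwise it is s_0^C)? *)
Definition s0_is_D (T : quotient_type) : bool :=
  match T with B_over_B | D_over_D => true | _ => false end.

(* Is s_n equal to s_n^D (otherwise it is s_n^C)? *)
Definition sn_is_D (T : quotient_type) : bool :=
  match T with B_over_D | D_over_D => true | _ => false end.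

Definition period (n : nat) : nat := (2 * n).+1.

Definition mirrored_perm (n : nat) : set (int -> int) :=
  [set w | [/\ bijective w,
               forall i, w (i + (period n)%:Z) = w i + (period n)%:Z
             & forall i, w (- i) = - w i]].

Definition evenly_many (A : set int) : Prop :=
  exists2 k, (A #= `I_k)%card & ~~ odd k.

Definition affine_group (T : quotient_type) (n : nat) : set (int -> int) :=
  [set w | [/\ mirrored_perm n w,
               s0_is_D T -> evenly_many [set i | i <= 0 /\ 1 <= w i]
             & sn_is_D T -> evenly_many [set i | i <= n%:Z /\ n.+1%:Z <= w i]]].

(* The mirrored Z-permutation w such that w(k) = g k for 1 <= k <= n. *)
Definition mirror_ext (n : nat) (g : nat -> int) (i : int) : int :=
  let N := period n in
  let r := `|(i %% N%:Z)%Z|%N in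
  (i %/ N%:Z)%Z * N%:Z +
    (if r == 0%N then 0
     else if (r <= n)%N then g r
     else N%:Z - g (N - r)%N).

Definition window_s0C (k : nat) : int := if k == 1%N then -1 else k%:Z.

Definition window_s0D (k : nat) : int :=
  if k == 1%N then -2 else if k == 2%N then -1 else k%:Z.

Definition window_s (i k : nat) : int :=
  if k == i then i.+1%:Z else if k == i.+1 then i%:Z else k%:Z.

Definition window_snC (n k : nat) : int := if k == n then n.+1%:Z else k%:Z.

Definition window_snD (n k : nat) : int :=
  if k == n.-1 then n.+1%:Z else if k == n then n.+2%:Z else k%:Z.

Definition gen (T : quotient_type) (n i : nat) : int -> int :=
  mirror_ext n
    (if i == 0%N then (if s0_is_D T then window_s0D else window_s0C)
     else if i == n then (if sn_is_D T then window_snD n else window_snC n)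
     else window_s i).

Definition word_prod (T : quotient_type) (n : nat) (s : seq nat) : int -> int :=
  foldr (fun i f => gen T n i \o f) id s.

Definition is_word (T : quotient_type) (n : nat) (s : seq nat) (w : int -> int) :=
  all (fun i => i <= n)%N s /\ word_prod T n s = w.

Definition has_length (T : quotient_type) (n : nat) (w : int -> int) (l : nat) :=
  (exists2 s, is_word T n s w & size s = l) /\
  (forall s, is_word T n s w -> (l <= size s)%N).

(* The generators are involutions, so products of s_1, ..., s_n exhaust the
   subgroup that they generate. *)
Definition finite_group (T : quotient_type) (n : nat) : set (int -> int) :=
  [set v | exists2 s, all (fun i => 1 <= i <= n)%N s & word_prod T n s = v].

Definition same_coset (T : quotient_type) (n : nat) (w w' : int -> int) : Prop :=
  exists2 v, finite_group T n v & w' = w \o v.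

Definition min_length_reps (T : quotient_type) (n : nat) : set (int -> int) :=
  [set w | affine_group T n w /\
     exists2 l, has_length T n w l &
       forall w', same_coset T n w w' ->
       forall l', has_length T n w' l' -> (l <= l')%N].

(* A partition is the sequence of its nonzero parts, first row first. Rows,
   columns and boxes (row, column) are numbered from 1. *)
Definition cell : Type := (nat * nat)%type.

Definition row_len (la : seq nat) (i : nat) : nat := nth 0%N (0%N :: la) i.
Definition col_len (la : seq nat) (j : nat) : nat :=
  count (fun x => j <= x)%N la.

(* Only labels not divisible by N = 2n+1 are entries, and they lie on the same
   runner exactly when they are congruent mod N. *)
Definition bead (n : nat) (w : int -> int) (x : int) : bool :=
  has (fun k : nat => (x <= w k%:Z) && (w k%:Z == x %[mod (period n)%:Z])%Z)
      (iota 1 (2 * n)).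

(* All entries below the range [-M, M] used here are beads, and all entries
   above it are gaps, so they only contribute the vertical and horizontal
   half-lines of the boundary path. *)
Definition abacus_entries (n : nat) (w : int -> int) : seq int :=
  let M := (\max_(1 <= k < (2 * n).+1) `|w k%:Z|)%N in
  [seq x <- [seq m%:Z - M%:Z | m <- iota 0 (2 * M).+1]
     | ~~ ((period n)%:Z %| x)%Z].

(* The boundary path is followed from the bottom left to the top right: the
   row lying to the left of a north-step has as many boxes as there are
   earlier east-steps. *)
Definition core (n : nat) (w : int -> int) : seq nat :=
  let step (st : nat * seq nat) (x : int) :=
    if bead n w x then (st.1, st.1 :: st.2) else (st.1.+1, st.2) in
  [seq x <- (foldl step (0%N, [::]) (abacus_entries n w)).2 | (0 < x)%N].

(* s_r . la = mu for the action transported along the map core. *)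
Definition acts_to (T : quotient_type) (n r : nat) (la mu : seq nat) : Prop :=
  exists w w',
    [/\ min_length_reps T n w, core n w = la,
        min_length_reps T n w', core n w' = mu
      & same_coset T n (gen T n r \o w) w'].

(* A cell has a sequence of residues: empty when undefined, of size 2 when the
   cell has two residues. *)

Definition fixed_residue (n : nat) (c : cell) : nat :=
  let k := `|((c.2%:Z - c.1%:Z) %% (2 * n)%:Z)%Z|%N in
  if (k <= n)%N then k else (2 * n - k)%N.

(* Residues of the cell c_(p+1) among the three cells c_1, c_2, c_3 (in columns
   j1, j1+1, j1+2) in which a row of length len meets an upper escalator
   (a, b) = (n-1, n), or an upper descalator, (a, b) = (1, 0). *)
Definition strip_rule (a b len j1 p : nat) : seq nat :=
  nth [::]
    (if len.+1 == j1 then [:: [:: a; b]; [:: b]; [::]]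
     else if len == j1 then [:: [:: a]; [:: b]; [:: b]]
     else if len == j1.+1 then [:: [:: b]; [:: b]; [:: a]]
     else if len == j1.+2 then [:: [::]; [:: b]; [:: a; b]]
     else [::]) p.

(* For a cell on the k-th diagonal, k > 0, the value p < 3 such that the cell
   is the c_(p+1) of its row in an upper escalator (resp. descalator); the cell
   is in no escalator (resp. descalator) when the value is at least 3. By
   transposition, these also serve on the (-k)-th diagonal. The connected
   components in question are the strips made of three adjacent diagonals,
   because these strips are pairwise non-adjacent for n >= 3. *)
Definition escalator_pos (n k : nat) : nat := ((k + n + 1) %% (2 * n))%N.
Definition descalator_pos (n k : nat) : nat := ((k + 1) %% (2 * n))%N.

Definition strip_residues (a b p : nat) (la : seq nat) (c : cell) : seq nat :=
  let: (i, j) := c in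
  if (i < j)%N then strip_rule a b (row_len la i) (j - p) p
  else strip_rule a b (col_len la j) (i - p) p.

Definition main_descalator_residue (c : cell) : nat :=
  if c.1 == c.2 then 0%N else if ((c.1 + c.2) %% 4 == 1)%N then 1%N else 0%N.

Definition residues (T : quotient_type) (n : nat) (la : seq nat) (c : cell) :
    seq nat :=
  let k := `|c.2%:Z - c.1%:Z|%N in
  let p := descalator_pos n k in
  let q := escalator_pos n k in
  if s0_is_D T && (k <= 1)%N then [:: main_descalator_residue c]
  else if s0_is_D T && (p < 3)%N then strip_residues 1 0 p la c
  else if sn_is_D T && (q < 3)%N then strip_residues n.-1 n q la c
  else [:: fixed_residue n c].

Definition ref_diagonal (T : quotient_type) : nat := s0_is_D T.

Definition central_row (T : quotient_type) (la : seq nat) : nat :=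
  count (fun i => i + ref_diagonal T <= row_len la i)%N (iota 1 (size la)).

Definition central_box (T : quotient_type) (la : seq nat) : cell :=
  (central_row T la, row_len la (central_row T la)).

Definition peeling_residue (T : quotient_type) (n : nat) (la : seq nat)
    (r : nat) : Prop :=
  let R := residues T n la (central_box T la) in
  r \in R /\ (n \in R -> n.-1 \in R -> r = n).

(* Two boxes are removed from row d when passing from la to mu, and c is one of
   these and is not on the k-th diagonal for any k in ks. *)
Definition removed_off_diagonals (d : nat) (la mu : seq nat) (ks : seq nat)
    (c : cell) : Prop :=
  [/\ row_len la d = (row_len mu d).+2, c.1 = d,
      (row_len mu d < c.2 <= row_len la d)%N
    & forall k, k \in ks -> c.2 <> (c.1 + k)%N].

Definition recorded_box (T : quotient_type) (n r : nat) (la mu : seq nat)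
    (c : cell) : Prop :=
  if sn_is_D T && (r == n) then
    removed_off_diagonals (central_row T la) la mu [:: n] c
  else if s0_is_D T && (r == 0%N) then
    removed_off_diagonals (central_row T la) la mu [:: 0; 2 * n]%N c
  else c = central_box T la.

(* central_peeling T n la U: the procedure started at la terminates and records
   the boxes of U, each of them paired with its residue. *)
Inductive central_peeling (T : quotient_type) (n : nat) :
    seq nat -> seq (cell * nat) -> Prop :=
| peel_nil : central_peeling T n [::] [::]
| peel_step la mu r c U :
    la <> [::] -> (0 < central_row T la)%N ->
    peeling_residue T n la r ->
    acts_to T n r la mu ->
    recorded_box T n r la mu c ->
    central_peeling T n mu U ->
    central_peeling T n la ((c, r) :: U).

(* A partition, and whether the last part of the distinguished size (star_size
   below) is starred. *)
Definition starred_partition : Type := (seq nat * bool)%type.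

Definition star_size (T : quotient_type) (n : nat) : nat :=
  match T with D_over_D => n.-1 | _ => n end.

(* The upper diagram is a set of boxes, whence undup. *)
Definition diagram_row (U : seq (cell * nat)) (i : nat) : nat :=
  size (undup [seq b.1 | b <- U & b.1.1 == i]).

Definition diagram_height (U : seq (cell * nat)) : nat :=
  (\max_(b <- U) b.1.1)%N.

Definition diagram_shape (U : seq (cell * nat)) : seq nat :=
  [seq x <- [seq diagram_row U i | i <- iota 1 (diagram_height U)] | (0 < x)%N].

Definition rightmost_residue (U : seq (cell * nat)) (i r : nat) : bool :=
  has (fun b => [&& b.1.1 == i, b.2 == r &
         all (fun b' => (b'.1.1 == i) ==> (b'.1.2 <= b.1.2)%N) U]) U.

Definition diagram_star (T : quotient_type) (n : nat) (U : seq (cell * nat)) :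
    bool :=
  let rows := [seq i <- iota 1 (diagram_height U)
                 | diagram_row U i == star_size T n] in
  [&& sn_is_D T, rows != [::] & rightmost_residue U (last 0%N rows) n.-1].

Definition bounded_partition (T : quotient_type) (n : nat) (w : int -> int)
    (b : starred_partition) : Prop :=
  exists2 U, central_peeling T n (core n w) U &
    b = (diagram_shape U, diagram_star T n U).

Definition max_part (T : quotient_type) (n : nat) : nat :=
  match T with
  | C_over_C => 2 * n
  | B_over_B | B_over_D => 2 * n - 1
  | D_over_D => 2 * n - 2
  end.

Definition max_distinct_part (T : quotient_type) (n : nat) : nat :=
  match T with
  | C_over_C => n
  | B_over_B | B_over_D => n - 1
  | D_over_D => n - 2
  end.

Definition target_partitions (T : quotient_type) (n : nat) :
    set starred_partition :=
  [set b : starred_partition | [/\ sorted geq b.1,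
               all (fun x => 0 < x <= max_part T n)%N b.1,
               forall x, (0 < x <= max_distinct_part T n)%N ->
                 (count_mem x b.1 <= 1)%N
             & b.2 -> sn_is_D T /\ star_size T n \in b.1]].

(* Main.v *)
(* A minimal length representative w is determined by the vector c of its
   levels: the lowest bead of A(w) on runner j <= n is c_j N + j. The abacus is
   symmetric about the label N, and one step of the central peeling moves the
   first bead p after N (after N + 1 in the types with s_0^D), which makes the
   procedure an explicit rewriting relation [move] on levels. In type C/C,
   carrying this bead all the way to N removes the last row of the upper
   diagram, of length p; the successive values of p determine c, and they are
   subject only to the stated restrictions on the parts. The types with s_0^D or
   s_n^D reduce to this case by the substitutions c_1 -> 1 - c_1 (if c_1 > 0)
   and c_n -> -|c_n|, after which lengths decrease by at most two: the parity
   of |c_1| + ... + |c_n|, which is even when s_0 = s_0^D, recovers c_1, and the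
   star recovers the sign of c_n. *)

Require Import Defs.
From mathcomp Require Import all_boot all_order all_algebra.
From mathcomp Require Import finmap.
From mathcomp Require Import all_classical.
From mathcomp Require Import zify.

Set Implicit Arguments.
Unset Strict Implicit.
Unset Printing Implicit Defensive.

Import Order.TTheory GRing.Theory Num.Theory.

Local Open Scope classical_set_scope.
Local Open Scope ring_scope.

(** * Levels and their parts *)

(** The facts needed about the groups come out of the peeling itself. Running [move] backwards from
    the zero vector produces a sorted representative for every admissible level vector, and running
    it forwards writes each sorted representative as a word in the generators, so no formula for [w]
    in terms of the levels is required. Termination rests on the folded vector [hat]: every [move],
    even one in which a type D generator carries the bead past two labels, lowers the size of the
    last part of the folded vector by exactly one. To this end [part_size] closes up the values that
    no part of a folded vector takes, 1 with $s_0^D$ and $n$ with $s_n^D$. The obstacle is that the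
    procedure is a relation, with an action transported from cosets and residues read off from row
    ends; each step must be shown to be forced. Cutting the boundary path at two labels symmetric
    about $N$ ([shape_of]) locates the end of the central row, and the diagonal of this end singles
    out the residue. The main descalator is the exception: there the residue depends on the parity
    of the row index, and the evenness of [norm1 c] settles it. *)

Definition norm1 (c : seq int) : nat := sumn [seq `|x|%N | x <- c].
(* The first bead after the label N is N + top_part c, and peel c gives the
   levels after the simple reflections of type C that carry it down to N. *)
Definition top_part (c : seq int) : nat :=
  if has (fun x => 0 < x) c then (find (fun x : int => 0 < x) c).+1
  else (size c + find (fun x : int => x != 0) (rev c)).+1.
Definition peel (c : seq int) : seq int :=
  if has (fun x => 0 < x) c then
    let k := find (fun x : int => 0 < x) c in
    (1 - c`_k) :: (take k c ++ drop k.+1 c)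
  else
    let k := (size c - (find (fun x : int => x != 0) (rev c)).+1)%N in
    (1 + c`_k) :: (take k c ++ drop k.+1 c).

Notation nonpos := (all (fun x : int => x <= 0)).
Notation allzero := (all (fun x : int => x == 0)).

Lemma has_pos (c : seq int) : has (fun x => 0 < x) c = ~~ nonpos c.
Proof. by rewrite -has_predC; apply: eq_has => x /=; rewrite -ltNge. Qed.

Lemma norm1_cat s1 s2 : norm1 (s1 ++ s2) = (norm1 s1 + norm1 s2)%N.
Proof. by rewrite /norm1 map_cat sumn_cat. Qed.

Lemma norm1_nil : norm1 [::] = 0%N.
Proof. by []. Qed.

Lemma norm1_cons x s : norm1 (x :: s) = (`|x| + norm1 s)%N.
Proof. by []. Qed.

Lemma norm1_eq0 c : (norm1 c == 0%N) = allzero c.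
Proof.
by elim: c => //= x s IH; rewrite norm1_cons addn_eq0 absz_eq0 IH.
Qed.

Lemma allzero_norm1 s : allzero s -> norm1 s = 0%N.
Proof. by rewrite -norm1_eq0 => /eqP. Qed.

Lemma allzero_nonpos s : allzero s -> nonpos s.
Proof. by apply: sub_all => x /eqP->. Qed.

Lemma find_pos_cat s1 v s2 : nonpos s1 -> 0 < v ->
  find (fun x : int => 0 < x) (s1 ++ v :: s2) = size s1.
Proof.
move=> h hv; rewrite find_cat has_pos h /= hv addn0 //.
Qed.

Lemma top_pos s1 v s2 : nonpos s1 -> 0 < v ->
  top_part (s1 ++ v :: s2) = (size s1).+1 /\
  peel (s1 ++ v :: s2) = (1 - v) :: (s1 ++ s2).
Proof.
move=> h hv; rewrite /top_part /peel has_cat /= hv orbT find_pos_cat //.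
by rewrite nth_cat ltnn subnn /= take_size_cat // -cat_rcons drop_size_cat ?size_rcons.
Qed.

Lemma top_neg s1 v s2 : nonpos s1 -> v < 0 -> allzero s2 ->
  top_part (s1 ++ v :: s2) = (size s1 + (size s2).*2).+2 /\
  peel (s1 ++ v :: s2) = (1 + v) :: (s1 ++ s2).
Proof.
move=> h hv h0; rewrite /top_part /peel has_pos all_cat /= h (ltW hv) allzero_nonpos //=.
have -> : find (fun x : int => x != 0) (rev (s1 ++ v :: s2)) = size s2.
  rewrite rev_cat rev_cons cat_rcons find_cat size_rev has_rev.
  rewrite ifF /= ?lt_eqF ?addn0 //.
  by apply/negbTE; rewrite -all_predC; apply: sub_all h0 => x /eqP->.
have -> : (size (s1 ++ v :: s2) - (size s2).+1)%N = size s1.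
  by rewrite size_cat addnK.
rewrite nth_cat ltnn subnn /= take_size_cat // -cat_rcons drop_size_cat ?size_rcons //.
by split=> //; rewrite cat_rcons size_cat /=; lia.
Qed.

(** A joint case view of [top_part] and [peel]. In the negative case [s2] must vanish because the
    mirrored runners are met in reverse order, so that the last nonzero entry gives the first
    bead. *)
Inductive top_spec (c : seq int) : nat -> seq int -> Prop :=
| TopPos s1 v s2 of c = s1 ++ v :: s2 & nonpos s1 & 0 < v :
    top_spec c (size s1).+1 ((1 - v) :: (s1 ++ s2))
| TopNeg s1 v s2 of c = s1 ++ v :: s2 & nonpos s1 & v < 0 & allzero s2 :
    top_spec c (size s1 + (size s2).*2).+2 ((1 + v) :: (s1 ++ s2)).

Lemma has_split_first (T : Type) (a : pred T) (s : seq T) : has a s ->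
  exists s1 x s2, [/\ s = s1 ++ x :: s2, ~~ has a s1 & a x].
Proof.
elim: s => //= x s IH; case: (boolP (a x)) => [ax _|nax /= /IH].
  by exists [::], x, s.
case=> s1 [y [s2 [-> h1 h2]]]; exists (x :: s1), y, s2; split=> //=.
by rewrite negb_or nax.
Qed.

Lemma has_split_last (T : Type) (a : pred T) (s : seq T) : has a s ->
  exists s1 x s2, [/\ s = s1 ++ x :: s2, ~~ has a s2 & a x].
Proof.
rewrite -has_rev => /has_split_first[s1 [x [s2 [e h ax]]]].
exists (rev s2), x, (rev s1); split; rewrite ?has_rev //.
by rewrite -[s]revK e rev_cat rev_cons cat_rcons.
Qed.

Lemma topP c : norm1 c != 0%N -> top_spec c (top_part c) (peel c).
Proof.
rewrite norm1_eq0 => hc; case: (boolP (nonpos c)) => [hn|].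
  have : has (fun x => x != 0) c by rewrite -has_predC in hc.
  case/has_split_last=> s1 [v [s2 [e h hv]]].
  have h0 : allzero s2 by rewrite -[allzero s2]negbK -has_predC.
  move: hn; rewrite e all_cat /= => /and3P[h1 hv' _].
  have hv2 : v < 0 by rewrite lt_neqAle hv.
  by have [-> ->] := top_neg h1 hv2 h0; exact: TopNeg.
rewrite -has_pos => /has_split_first[s1 [v [s2 [e h hv]]]].
have h1 : nonpos s1 by rewrite has_pos negbK in h.
by rewrite e; have [-> ->] := top_pos s2 h1 hv; exact: TopPos.
Qed.

Lemma norm1_peel c : norm1 c != 0%N -> norm1 c = (norm1 (peel c)).+1.
Proof.
move=> /topP[] s1 v s2 -> h hv => [|hz];
  by rewrite norm1_cons !norm1_cat norm1_cons; lia.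
Qed.

Lemma size_peel c : norm1 c != 0%N -> size (peel c) = size c.
Proof. by move=> /topP[] s1 v s2 -> *; rewrite /= !size_cat /= addnS. Qed.

(** Each peel lowers [norm1] by one, so [norm1 c] is exactly the fuel required. The parts come out
    smallest first, that is, from the last row of the diagram upwards. *)
Fixpoint parts_rec m c :=
  if m is m'.+1 then top_part c :: parts_rec m' (peel c) else [::].
Definition parts c := parts_rec (norm1 c) c.

Lemma parts_cons c : norm1 c != 0%N -> parts c = top_part c :: parts (peel c).
Proof. by move=> h; rewrite /parts norm1_peel. Qed.

Lemma parts_nil c : norm1 c = 0%N -> parts c = [::].
Proof. by rewrite /parts => ->. Qed.

Lemma size_parts c : size (parts c) = norm1 c.
Proof.
rewrite /parts; move: (norm1 c) => m; elim: m c => //= m IH c.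
by rewrite IH.
Qed.

Lemma parts_ind (P : seq int -> Prop) :
  (forall c, norm1 c = 0%N -> P c) ->
  (forall c, norm1 c != 0%N -> P (peel c) -> P c) -> forall c, P c.
Proof.
move=> h0 hS c; move: {2}(norm1 c) (erefl (norm1 c)) => m.
elim: m c => [|m IH] c hm; first exact: h0.
have hc : norm1 c != 0%N by rewrite hm.
by apply: hS => //; apply: IH; apply: succn_inj; rewrite -hm; symmetry; exact: norm1_peel.
Qed.

(** The value [p] tells which branch of [peel] was taken ([p <= n] for a positive entry) and where
    the entry stood, so the head can be put back in place. *)
Definition unpeel (n p : nat) (c : seq int) : seq int :=
  if (p <= n)%N then
    take p.-1 (behead c) ++ (1 - head 0 c) :: drop p.-1 (behead c)
  else
    let k := (2 * n - p)%N in
    take k (behead c) ++ (head 0 c - 1) :: drop k (behead c).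

Lemma peelK c : norm1 c != 0%N -> unpeel (size c) (top_part c) (peel c) = c.
Proof.
move=> /topP[] s1 v s2 -> h hv => [|hz]; rewrite /unpeel size_cat /=.
  rewrite ifT; last by lia.
  by rewrite take_size_cat // drop_size_cat // subKr.
rewrite ifF; last by lia.
have -> : (2 * (size s1 + (size s2).+1) - (size s1 + (size s2).*2).+2)%N = size s1.
  by lia.
by rewrite take_size_cat // drop_size_cat // addrAC subrr add0r.
Qed.

Lemma parts_inj c1 c2 : size c1 = size c2 -> parts c1 = parts c2 -> c1 = c2.
Proof.
elim/parts_ind: c1 c2 => [c1 h1|c1 h1 IH] c2 hs hp.
  have : norm1 c2 = 0%N by rewrite -size_parts -hp size_parts.
  move=> /eqP; rewrite norm1_eq0 => h2; move/eqP: h1; rewrite norm1_eq0 => h1.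
  by move: h1 h2 => /all_pred1P-> /all_pred1P->; rewrite hs.
have h2 : norm1 c2 != 0%N by rewrite -size_parts -hp size_parts.
move: hp; rewrite (parts_cons h1) (parts_cons h2) => -[ht hp].
have hl : peel c1 = peel c2 by apply: IH; rewrite ?size_peel.
have := peelK h2; rewrite -hs -ht -hl => <-.
by rewrite peelK.
Qed.

(** Smaller part first; equality is tolerated only beyond [n], which is the restriction that small
    parts are distinct. *)
Definition part_rel (n p q : nat) : bool := ((p < q) || (p == q) && (n < p))%N.

Lemma part_rel_trans n : transitive (part_rel n).
Proof. by move=> y x z; rewrite /part_rel; lia. Qed.

Lemma top_bound c : norm1 c != 0%N -> (0 < top_part c <= 2 * size c)%N.
Proof. by move=> /topP[] s1 v s2 -> *; rewrite size_cat /=; lia. Qed.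

Lemma parts_bound c : all (fun p => 0 < p <= 2 * size c)%N (parts c).
Proof.
elim/parts_ind: c => [c h|c h IH]; first by rewrite parts_nil.
by rewrite parts_cons //= top_bound // -{1}(size_peel h).
Qed.

(** The disjunction lists the ways in which a part [p] can precede [parts c]: there is no further
    part, or the next one is larger. The sign conditions obtained here and in [top_gt] are those
    under which a reinserted entry is the one that [peel] selects. *)
Lemma top_le c p : (p <= size c)%N -> norm1 c = 0%N \/ (p < top_part c)%N ->
  nonpos (take p c).
Proof.
move=> hp [/eqP|].
  rewrite norm1_eq0 => /allzero_nonpos; rewrite -{1}(cat_take_drop p c) all_cat.
  by case/andP.
have [/eqP|/topP] := eqVneq (norm1 c) 0%N.
  rewrite norm1_eq0 => /allzero_nonpos; rewrite -{1}(cat_take_drop p c) all_cat.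
  by case/andP.
case=> s1 v s2 e h hv => [hlt|hz _].
  rewrite e takel_cat //; move: h; rewrite -{1}(cat_take_drop p s1) all_cat.
  by case/andP.
have : nonpos c by rewrite e all_cat /= h (ltW hv) allzero_nonpos.
by rewrite -{1}(cat_take_drop p c) all_cat => /andP[].
Qed.

Lemma top_gt c p : norm1 c = 0%N \/ (p <= top_part c)%N -> (size c < p)%N ->
  nonpos c /\ allzero (drop (2 * size c - p).+1 c).
Proof.
have hz s m : allzero s -> allzero (drop m s).
  by rewrite -{1}(cat_take_drop m s) all_cat => /andP[].
move=> hp hs; have [/eqP h0|h0] := eqVneq (norm1 c) 0%N.
  by rewrite norm1_eq0 in h0; split; [exact: allzero_nonpos|exact: hz].
case: hp => [/eqP|]; first by rewrite (negbTE h0).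
case: (topP h0) => s1 v s2 e h hv => [|h2] hp.
  by move: hp hs; rewrite e size_cat /=; lia.
split; first by rewrite e all_cat /= h (ltW hv) allzero_nonpos.
rewrite -cat_rcons in e; rewrite {2}e drop_cat size_rcons ifF; first exact: hz.
by move: hp hs; rewrite e size_cat size_rcons /=; lia.
Qed.

(** Peeling a positive entry leaves a nonpositive head followed by the nonpositive [s1] shifted by
    one place, so the next positive entry stands strictly further right. Peeling a negative entry
    keeps all entries nonpositive and cannot move the last nonzero one to the right, so the part
    does not decrease but may repeat. *)
Lemma parts_sorted c : sorted (part_rel (size c)) (parts c).
Proof.
elim/parts_ind: c => [c h|c h IH]; first by rewrite parts_nil.
rewrite parts_cons //; have [h'|h'] := eqVneq (norm1 (peel c)) 0%N.
  by rewrite (parts_nil h').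
rewrite size_peel // in IH; rewrite (parts_cons h') /= in IH *; rewrite IH andbT {IH}.
have hs := size_peel h.
case: (topP h) hs h' => s1 v s2 e hn hv => [|hz] hs h'.
  case: (topP h') => t1 u t2 e' hn' hu => [|hz'].
    rewrite /part_rel; apply/orP; left.
    rewrite ltnS ltnNge; apply/negP => hle.
    have := congr1 (fun s => nth 0 s (size t1)) e'.
    rewrite nth_cat ltnn subnn /=.
    case: (size t1) hle => [|m] hm /= eu; first by move: hu hv; rewrite -eu; lia.
    move: eu; rewrite nth_cat hm => eu.
    by move: (all_nthP 0 hn m hm); rewrite eu leNgt hu.
  have := congr1 size e'; rewrite /part_rel e /= !size_cat /=; lia.
case: (topP h') => t1 u t2 e' hn' hu => [|hz'].
  have : nonpos ((1 + v) :: s1 ++ s2).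
    by rewrite /= all_cat hn allzero_nonpos // !andbT; lia.
  by rewrite e' all_cat /= leNgt hu /= andbF.
have /= := congr1 size e'; rewrite e /part_rel !size_cat /= => hs'.
suff : (size t1 <= size s1)%N by lia.
rewrite leqNgt; apply/negP => hlt.
have := congr1 (fun s => nth 0 s (size t1)) e'.
rewrite nth_cat ltnn subnn /=.
case: (size t1) hlt => [|m] hm //=.
have hm' : (m < size s1)%N = false by lia.
rewrite nth_cat hm' => eu.
have [hlt|hge] := ltnP (m - size s1) (size s2).
  by move: (all_nthP 0 hz _ hlt) => /eqP; rewrite eu => e0; rewrite e0 in hu.
by move: eu hu; rewrite nth_default // => <-.
Qed.

(** The peels are undone one at a time with the formula of [unpeel]; the order on [b] supplies the
    hypotheses of [top_le] and [top_gt]. *)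
Lemma parts_surj n b : (0 < n)%N -> sorted (part_rel n) b ->
  all (fun p => 0 < p <= 2 * n)%N b -> exists2 c, size c = n & parts c = b.
Proof.
move=> hn; elim: b => [_ _|p b IH hs /= /andP[hp hb]].
  by exists (nseq n 0); rewrite ?size_nseq // parts_nil //; apply/eqP; rewrite norm1_eq0 all_nseq eqxx orbT.
have [c' hc' hpc] := IH (path_sorted hs) hb.
have hrel : norm1 c' = 0%N \/ part_rel n p (top_part c').
  have [|h] := eqVneq (norm1 c') 0%N; [by left|right].
  by move: hs; rewrite -hpc parts_cons //= => /andP[].
suff [c [h1 h2 h3 h4]] : exists c, [/\ size c = n, norm1 c != 0%N, top_part c = p & peel c = c'].
  by exists c => //; rewrite parts_cons // h3 h4 hpc.
case: c' hc' hpc hrel => [h|a s hc' _ hrel]; first by rewrite -h in hn.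
have [hpn|hpn] := leqP p n.
  have hor : norm1 (a :: s) = 0%N \/ (p < top_part (a :: s))%N.
    by case: hrel => [->|]; [left|rewrite /part_rel; right; lia].
  have := top_le _ hor; rewrite hc' => /(_ hpn) {hor}.
  case: p hp hpn {hs hrel} => // p _ hpn /= /andP[ha hsp].
  have hv : 0 < 1 - a by lia.
  have [ht hl] := top_pos (drop p s) hsp hv.
  have hsz : size (take p s) = p by rewrite size_takel //; move: hc' => /=; lia.
  exists (take p s ++ (1 - a) :: drop p s); split.
  - by rewrite size_cat /= addnS -size_cat cat_take_drop.
  - by rewrite norm1_cat norm1_cons; lia.
  - by rewrite ht hsz.
  - by rewrite hl subKr cat_take_drop.
have hor : norm1 (a :: s) = 0%N \/ (p <= top_part (a :: s))%N.
  by case: hrel => [->|]; [left|rewrite /part_rel; right; lia].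
have := top_gt hor; rewrite hc' => /(_ hpn) [].
move=> /= /andP[ha hsn] hz; set k := (2 * n - p)%N in hz.
have hk : (k <= size s)%N by move: hc' => /=; lia.
have hv : a - 1 < 0 by lia.
have hsp : nonpos (take k s) by move: hsn; rewrite -{1}(cat_take_drop k s) all_cat => /andP[].
have [ht hl] := top_neg hsp hv hz.
exists (take k s ++ (a - 1) :: drop k s); split.
- by rewrite size_cat /= addnS -size_cat cat_take_drop.
- by rewrite norm1_cat norm1_cons; lia.
- by rewrite ht size_takel // size_drop; move: hc' hp => /=; lia.
- by rewrite hl addrC subrK cat_take_drop.
Qed.

Lemma peel_nonpos c : norm1 c != 0%N -> nonpos c -> nonpos (peel c).
Proof.
move=> /topP[] s1 v s2 -> h hv => [|hz]; rewrite !all_cat /= => /and3P[_ h1 h2].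
  by move: h1; rewrite leNgt hv.
by rewrite all_cat h h2 andbT andbT; lia.
Qed.

Lemma parts_nonpos c : nonpos c -> all (fun p => size c < p)%N (parts c).
Proof.
elim/parts_ind: c => [c h|c h IH] hn; first by rewrite parts_nil.
have {}IH := IH (peel_nonpos h hn); rewrite size_peel // in IH.
rewrite (parts_cons h) /= IH andbT {IH}; case: (topP h) hn => s1 v s2 -> h1 hv; rewrite size_cat /=; last by lia.
by rewrite all_cat /= leNgt hv andbF.
Qed.

Lemma last_allzero c : allzero c -> last 0 c = 0.
Proof. by case/lastP: c => // s x; rewrite all_rcons last_rcons => /andP[/eqP]. Qed.

(** A part [n] or [n.+1] is peeled exactly when the last entry is the one that moves, from its
    positive or its negative side. For folded vectors this excludes the part [n], and it shows that
    a star forces a nonzero last level. *)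
Lemma parts_last c : (1 < size c)%N ->
  [/\ (size c \in parts c) = (0 < last 0 c),
      last 0 c < 0 -> (size c).+1 \in parts c
    & last 0 c = 0 -> (size c).+1 \notin parts c].
Proof.
elim/parts_ind: c => [c h|c h IH] hs.
  rewrite parts_nil //; move/eqP: h; rewrite norm1_eq0 => /last_allzero ->.
  by split.
move: IH (@parts_nonpos (peel c)); rewrite size_peel // => /(_ hs).
rewrite (parts_cons h) !inE.
case: (topP h) (peel_nonpos h) hs => s1 v s2 e hn hv => [pn hs|hz pn hs].
  case: (lastP s2) e => [|s2' x] e.
    move=> _ _; rewrite e size_cat addn1 eqxx last_cat /= hv; split=> //; lia.
  have -> : last 0 ((1 - v) :: s1 ++ rcons s2' x) = x by rewrite /= last_cat last_rcons.
  have -> : last 0 c = x by rewrite e last_cat /= last_rcons.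
  have hne m : (size c <= m)%N -> (m == (size s1).+1) = false.
    by rewrite e size_cat /= size_rcons; lia.
  by rewrite !hne.
have hc : nonpos c by rewrite e all_cat /= hn (ltW hv) allzero_nonpos.
move=> [h1 h2 h3] /(_ (pn hc)) h4.
have hne : (size c == (size s1 + (size s2).*2).+2) = false.
  by rewrite e size_cat /=; lia.
have hl : last 0 c <= 0.
  by rewrite e last_cat /=; case/lastP: s2 hz {e h1 h2 h3 h4 hne pn} => [|s x] /=;
    rewrite ?(ltW hv) // all_rcons last_rcons => /andP[/eqP->].
rewrite hne ltNge hl /=; split.
- by apply/negP => hin; have := allP h4 _ hin; rewrite ltnn.
- move=> hlt; suff s20 : s2 = [::] by apply/orP; left; apply/eqP; rewrite e s20 size_cat /=; lia.
  move: hlt; rewrite e last_cat /=; case: (lastP s2) hz => // t x.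
  by rewrite all_rcons last_rcons => /andP[/eqP-> _]; rewrite ltxx.
move=> h0; rewrite negb_or h3 ?andbT.
  rewrite e size_cat /=; case: s2 hz e {h1 h2 h3 h4 hne pn} => [|x t] hz e; last by rewrite /=; lia.
  by move: h0 hv; rewrite e last_cat /= => ->; rewrite ltxx.
move: h0; rewrite e !last_cat /=; case/lastP: s2 hz {e h1 h2 h3 h4 hne pn} => [_ /= v0|t x _].
  by rewrite v0 ltxx in hv.
by rewrite last_cat !last_rcons.
Qed.

(** * Central peeling on levels *)

(** For [a > 0] one has [|1 - a| = |a| - 1]: folding discards the bead at [N + 1], which lies before
    the reference label. Hence [norm1] of the folded vector counts the boxes on the reference
    diagonal ([above_hat]). *)
Definition hat0 (e0 : bool) (c : seq int) : seq int :=
  if c is a :: s then (if e0 && (0 < a) then 1 - a else a) :: s else [::].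
(** Identifies the two adjacent runners [n] and [n.+1], between which $s_n^D$ does not discriminate;
    the sign that is lost here is what the star records. *)
Definition hatn (en : bool) (c : seq int) : seq int :=
  if en then rev (if rev c is a :: s then (- `|a|) :: s else [::]) else c.
Definition hat (e0 en : bool) (c : seq int) : seq int := hat0 e0 (hatn en c).

Lemma hatn_rcons en s x : hatn en (rcons s x) = rcons s (if en then - `|x| else x).
Proof. by rewrite /hatn; case: en => //; rewrite rev_rcons rev_cons revK. Qed.

Lemma hatn_cat en s1 x s2 : hatn en (s1 ++ x :: s2) = s1 ++ hatn en (x :: s2).
Proof. by rewrite lastI -rcons_cat !hatn_rcons rcons_cat. Qed.

Lemma size_hatn en s : size (hatn en s) = size s.
Proof. by case/lastP: s => [|s x]; rewrite ?hatn_rcons ?size_rcons // /hatn; case: en. Qed.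

Lemma size_hat0 e0 s : size (hat0 e0 s) = size s.
Proof. by case: s. Qed.

Lemma size_hat e0 en s : size (hat e0 en s) = size s.
Proof. by rewrite size_hat0 size_hatn. Qed.

Lemma hatn_id en s : nonpos s -> hatn en s = s.
Proof.
case/lastP: s => [|s x]; first by rewrite /hatn; case: en.
rewrite all_rcons hatn_rcons => /andP[hx _]; congr rcons; case: en => //.
by rewrite ler0_norm // opprK.
Qed.

Lemma hat0_cat e0 x s1 s2 : hat0 e0 ((x :: s1) ++ s2) = hat0 e0 (x :: s1) ++ s2.
Proof. by []. Qed.

Lemma hat0_nonpos (e0 : bool) s : nonpos (drop e0 s) -> nonpos (hat0 e0 s).
Proof.
by case: s => //= x s; case: e0 => /=; rewrite ?drop0 => h; case: ltP => hx /=; rewrite ?h ?andbT; lia.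
Qed.

(* The bead that a step moves is N + p; the box at the end of the central row
   has residue r. *)
Inductive move (e0 en : bool) : seq int -> nat -> nat -> seq int -> Prop :=
| MPos s1 (a v : int) s2 of nonpos (drop e0 s1) & a <= 0 & 0 < v :
    move e0 en (s1 ++ a :: v :: s2) (size s1).+1 (size s1).+2 (s1 ++ v :: a :: s2)
| M0C (v : int) s of ~~ e0 & 0 < v : move e0 en (v :: s) 0 1 ((1 - v) :: s)
| M0D (a v : int) s of e0 & 0 < a & 0 < v :
    move e0 en (a :: v :: s) 0 2 ((1 - v) :: (1 - a) :: s)
| MnC s (v : int) of ~~ en & nonpos (drop e0 s) & v < 0 :
    move e0 en (s ++ [:: v]) (size s).+1 (size s).+2 (s ++ [:: - v])
| MnD1 s (a v : int) of en & nonpos (drop e0 s) & a <= 0 & v < 0 :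
    move e0 en (s ++ [:: a; v]) (size s).+2 (size s).+3 (s ++ [:: - v; - a])
| MnD2 s (v : int) of en & nonpos (drop e0 s) & v < 0 :
    move e0 en (s ++ [:: v; 0]) (size s).+2 (size s).+4 (s ++ [:: 0; - v])
| MNeg s1 (v : int) s2 of nonpos (drop e0 s1) & v < 0 & allzero s2 & en ==> (0 < size s2)%N :
    move e0 en (s1 ++ v :: 0 :: s2) (size s1).+1 (size s1 + (size s2).*2).+4
      (s1 ++ 0 :: v :: s2)
| M0D2 (a : int) s of e0 & 1 < a & allzero s :
    move e0 en (a :: 0 :: s) 0 ((size s).*2 + 6) (1 :: (1 - a) :: s).

Lemma odd_absz_sub (a : int) : odd `|1 - a|%N = ~~ odd `|a|%N.
Proof. lia. Qed.

(** Parity enters only when every entry but the first vanishes: a positive first entry is then even,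
    hence at least 2, as [M0D2] requires. *)
Lemma move_total (e0 en : bool) c : (2 + e0 + en <= size c)%N ->
  (e0 -> ~~ odd (norm1 c)) -> norm1 c != 0%N ->
  exists r p c', move e0 en c r p c'.
Proof.
move=> hs hpar; rewrite norm1_eq0 => hnz.
case: (boolP (nonpos (drop e0 c))) => [hneg|]; last first.
  rewrite -has_pos => /has_split_first[s1 [v [s2 [e h hv]]]].
  have {}h : nonpos s1 by rewrite has_pos negbK in h.
  case: (lastP s1) h e => [_|s1' a].
    case: e0 {hpar hnz} hs => [|] hs e.
      case: c hs e => //= a c hs; rewrite drop0 => ->.
      have [ha|ha] := leP a 0; last by do 3 eexists; exact: M0D.
      by do 3 eexists; apply: (@MPos true en [::] a v s2).
    by rewrite drop0 in e; rewrite e /=; do 3 eexists; exact: M0C.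
  rewrite all_rcons cat_rcons => /andP[ha h1] e.
  case: e0 {hpar hnz} hs e => hs e.
    case: c hs e => //= b c hs; rewrite drop0 => ->.
    by do 3 eexists; apply: (@MPos true en (b :: s1') a v s2) => //=; rewrite drop0.
  rewrite drop0 in e; rewrite e.
  by do 3 eexists; apply: (@MPos false en s1' a v s2) => //=; rewrite drop0.
case: (boolP (allzero (drop e0 c))) => [hz|].
  case: e0 hs hpar hz hneg hnz => hs hpar hz hneg hnz; last by rewrite drop0 (negbTE hnz) in hz.
  case: c hs hpar hz hneg hnz => [|a [|b s]] //=; try by case: (en).
  move=> hs /(_ isT); rewrite !norm1_cons => hodd /andP[/eqP hb hz] _.
  rewrite hb (allzero_norm1 hz) addn0 addn0 in hodd *.
  rewrite eqxx hz !andbT => ha.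
  have [h0|h0] := ltP 0 a.
    by do 3 eexists; apply: M0D2 => //; lia.
  do 3 eexists; apply: (@MNeg true en [::] a s) => //; first by rewrite lt_neqAle ha.
  by apply/implyP => hen; move: hs; rewrite hen; lia.
rewrite -has_predC => /has_split_last[s1 [v [s2 [e h hv]]]].
have {}h : allzero s2 by rewrite -[allzero s2]negbK -has_predC.
move: hneg; rewrite e all_cat /= => /and3P[h1 hv1 _].
have {hv1}hv : v < 0 by move: hv => /= hv; rewrite lt_neqAle hv.
(* The ignored first entry is put back, which makes the remaining cases uniform in [e0]. The size
   bound guarantees an entry before the last one outside the ignored prefix, as $s_n^D$ also moves
   it. *)
have {hs hnz hpar e} [t [ec h1' hs]] : exists t, [/\ c = t ++ v :: s2, nonpos (drop e0 t) & (2 + en <= size (drop e0 t) + (size s2).+1)%N].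
  case: e0 {hnz hpar} hs e => [|] hs; rewrite ?drop0 => e.
    case: c hs e => //= b c; rewrite drop0 => hs e; exists (b :: s1); rewrite e /= drop0; split=> //.
    by move: hs; rewrite e size_cat /=; lia.
  by exists s1; rewrite drop0; split => //; move: hs; rewrite e size_cat /=; lia.
case: s2 h ec hs => [_|b s2 /= /andP[/eqP-> hz]] ec hs.
  case: (boolP en) hs => hen hs; last first.
    by do 3 eexists; rewrite ec; apply: MnC.
  case: (lastP t) h1' ec hs => [_ _|t' a]; first by rewrite /=; lia.
  have [hle|hlt] := leqP e0 (size t').
    rewrite drop_rcons //.
    rewrite all_rcons => /andP[ha h2] ec _; rewrite cat_rcons in ec.
    by do 3 eexists; rewrite ec; apply: MnD1.
  rewrite drop_oversize ?size_rcons // /=; lia.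
case: (boolP (en && (size s2 == 0%N))) => [/andP[hen /eqP/size0nil e2]|hen].
  by do 3 eexists; rewrite ec e2; apply: MnD2.
do 3 eexists; rewrite ec; apply: MNeg => //.
by case: en hen {hs} => //=; rewrite lt0n.
Qed.

(** Renumbers the labels after omitting 1 (with [e0]) and [n] (with [en]), which are never parts of
    a folded vector. *)
Definition part_size (e0 en : bool) (n p : nat) : nat := (p - e0 - (en && (n < p)))%N.

Definition peels_to (c : seq int) (p : nat) (c' : seq int) : Prop :=
  [/\ norm1 c != 0%N, top_part c = p & peel c = c'].

Lemma peels_pos s1 (v : int) s2 p c' : nonpos s1 -> 0 < v -> p = (size s1).+1 ->
  c' = (1 - v) :: (s1 ++ s2) -> peels_to (s1 ++ v :: s2) p c'.
Proof.
move=> h hv -> ->; have [h1 h2] := top_pos s2 h hv; split=> //.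
by rewrite norm1_cat norm1_cons; lia.
Qed.

Lemma peels_neg s1 (v : int) s2 p c' : nonpos s1 -> v < 0 -> allzero s2 ->
  p = (size s1 + (size s2).*2).+2 ->
  c' = (1 + v) :: (s1 ++ s2) -> peels_to (s1 ++ v :: s2) p c'.
Proof.
move=> h hv h0 -> ->; have [h1 h2] := top_neg h hv h0; split=> //.
by rewrite norm1_cat norm1_cons; lia.
Qed.

Lemma hatn_cons en a x s : hatn en (a :: x :: s) = a :: hatn en (x :: s).
Proof. exact: (@hatn_cat en [:: a]). Qed.

Lemma hat_nonpos_tail e0 en s1 s2 : nonpos s2 -> (0 < size s2)%N ->
  hat e0 en (s1 ++ s2) = hat0 e0 (s1 ++ s2).
Proof.
case: s2 => // x s2 h _; rewrite /hat hatn_cat hatn_id //.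
Qed.

(** Both vectors peel to the same remainder: the last row loses one box while the rows above stay
    untouched, or it had a single box and disappears. *)
Definition hat_step (e0 en : bool) (n : nat) (h h' : seq int) : Prop :=
  exists q c', peels_to h q c' /\
   ((h' = c' /\ part_size e0 en n q = 1%N) \/
    exists q', peels_to h' q' c' /\
      part_size e0 en n q = (part_size e0 en n q').+1).

(** Where a type D generator jumps over a label, the folding absorbs the jump. In [MnD1] the part
    goes from [n.+1] to [n.-1], and [part_size] omits [n]; in [MnD2] the bead lands on runner [n],
    which is folded onto [n.+1]; in [M0D2] the folded first entry is [1 - a], whose bead has label
    [2 * n] instead of [2 * n + 2]. In [M0D] the part 2 has size 1, so the row is finished. *)
Lemma move_hat (e0 en : bool) c r p c' : move e0 en c r p c' ->
  (2 + e0 + en <= size c)%N ->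
  hat_step e0 en (size c) (hat e0 en c) (hat e0 en c').
Proof.
case=> {c r p c'}.
- move=> s1 a v s2 h1 ha hv hs.
  rewrite -[s1 ++ a :: _]cat_rcons -[s1 ++ v :: _]cat_rcons /hat.
  case: s2 hs => [|x t] hs.
    rewrite !cats1 !hatn_rcons (ler0_norm ha) opprK if_same (gtr0_norm hv).
    rewrite -!cats1 -!catA /=.
    case: s1 hs h1 => [|b s1] hs h1.
      case: e0 hs h1 => //= hs _; case: en hs => //= _.
      exists 2%N, [:: 1 - v; a]; split; first by apply: (@peels_pos [:: a]); rewrite /= ?ha.
      by right; exists 1%N; split=> //; exact: (@peels_pos [::]).
    rewrite !hat0_cat.
    have hb := hat0_nonpos h1; set s := hat0 e0 (b :: s1) in hb *.
    have -> : size ((b :: s1) ++ [:: a; v]) = (size s).+2.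
      by rewrite size_cat size_hat0 addn2.
    (* With [en], the last entry is folded to [- v] and gives the part [n.+1] instead of [n]; its
       size is [n - e0] in both cases. *)
    exists (size s + 2 + en)%N, ((1 - v) :: (s ++ [:: a])); split.
      rewrite -[s ++ _]cat_rcons -cats1; case: (en).
        by apply: peels_neg; rewrite ?all_cat ?hb /= ?ha ?cats0 // ?size_cat /=; lia.
      by apply: peels_pos; rewrite ?all_cat ?hb /= ?ha ?cats0 // ?size_cat /=; lia.
    right; exists (size s).+1; split; first exact: peels_pos.
    by rewrite /part_size /s size_hat0; move: hs; rewrite size_cat /=; case: (en) => /=; lia.
  rewrite !cat_rcons !hatn_cat !hatn_cons; set t' := hatn en _.
  have ht : size t' = (size t).+1 by rewrite /t' size_hatn.
  rewrite size_cat /=.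
  case: s1 hs h1 => [|b s1] hs h1; last first.
    rewrite !hat0_cat; have hb := hat0_nonpos h1; set s := hat0 e0 (b :: s1) in hb *.
    have hss : size s = (size s1).+1 by rewrite /s.
    exists (size s).+2, ((1 - v) :: (s ++ a :: t')); split.
      rewrite -[s ++ _]cat_rcons -cats1.
      by apply: peels_pos; rewrite ?all_cat ?hb /= ?ha // ?size_cat /= -?catA //=; lia.
    right; exists (size s).+1; split; first exact: peels_pos.
    by rewrite /part_size hss /=; case: (en) => /=; lia.
  rewrite /= (ltNge 0 a) ha hv andbF andbT.
  exists 2%N, ((1 - v) :: a :: t'); split.
    by apply: (@peels_pos [:: a]); rewrite /= ?ha.
  case: (e0) hs => hs; [left|right].
    by rewrite /part_size /=; split=> //; case: (en); lia.
  exists 1%N; split; first exact: (@peels_pos [::]).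
  by rewrite /part_size /=; case: (en); lia.
- move=> v s /negbTE he hv hs; rewrite he in hs *.
  case: s hs => [|x s] hs //; rewrite /hat !hatn_cons.
  exists 1%N, ((1 - v) :: hatn en (x :: s)); split; first exact: (@peels_pos [::]).
  by left; rewrite /part_size /=; split=> //; case: (en); lia.
- move=> a v s he ha hv hs; rewrite he in hs *.
  have h1 : 1 - a <= 0 by lia.
  have h2 : (0 < 1 - v) = false by lia.
  case: s hs => [|x s] hs //.
  rewrite /hat !hatn_cons /= ha h2.
  exists 2%N, [:: 1 - v, 1 - a & hatn en (x :: s)]; split.
    by apply: (@peels_pos [:: 1 - a]); rewrite /= ?h1.
  by left; rewrite /part_size /=; split=> //; case: (en); lia.
- move=> s v /negbTE he h1 hv hs; rewrite /hat !cats1 !hatn_rcons he -!cats1.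
  have hb : nonpos (hat0 e0 s) := hat0_nonpos h1.
  case: s hs h1 hb => [|x s] hs h1 hb; first by move: hs => /=; case: (e0); case: (en).
  rewrite !hat0_cat; set t := hat0 _ _ in hb *.
  have ht : size t = (size s).+1 by rewrite /t.
  exists (size t).+2, ((1 + v) :: t); split.
    by apply: peels_neg; rewrite ?cats0 ?addn0.
  right; exists (size t).+1; split; first by apply: peels_pos; rewrite ?opprK ?cats0 // oppr_gt0.
  by rewrite /part_size ht size_cat /=; case: (e0); lia.
- move=> s a v he h1 ha hv hs.
  have hb : nonpos (hat0 e0 s) := hat0_nonpos h1.
  case: s hs h1 hb => [|x s] hs h1 hb; first by move: hs; rewrite he /=; case: (e0).
  have hv' : 0 < - v by lia.
  have ha' : `|a| = - a by rewrite ler0_norm.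
  rewrite /hat !hatn_cat !hatn_cons he /hatn /rev /= -!cat_cons -/(hat0 e0 (x :: s)).
  rewrite normrN (ltr0_norm hv) ha' !opprK.
  set t := hat0 _ _ in hb *; have ht : size t = (size s).+1 by rewrite /t.
  exists (size t).+3, ((1 + v) :: (t ++ [:: a])); split.
    rewrite -[t ++ _]cat_rcons -cats1.
    by apply: peels_neg; rewrite ?all_cat ?hb /= ?ha ?cats0 // ?size_cat /=; lia.
  right; exists (size t).+1; split; first by apply: peels_pos; rewrite ?opprK.
  by rewrite /part_size ht size_cat /=; case: (e0); lia.
- move=> s v he h1 hv hs.
  have hb : nonpos (hat0 e0 s) := hat0_nonpos h1.
  case: s hs h1 hb => [|x s] hs h1 hb; first by move: hs; rewrite he /=; case: (e0).
  have hv' : 0 < - v by lia.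
  rewrite /hat !hatn_cat !hatn_cons he /hatn /rev /= -!cat_cons -/(hat0 e0 (x :: s)).
  rewrite normrN (ltr0_norm hv) normr0 !opprK oppr0.
  set t := hat0 _ _ in hb *; have ht : size t = (size s).+1 by rewrite /t.
  exists (size t).+4, ((1 + v) :: (t ++ [:: 0])); split.
    by apply: peels_neg; rewrite //= addn2.
  right; exists (size t).+3; split.
    rewrite -[t ++ _]cat_rcons -cats1.
    by apply: peels_neg; rewrite ?all_cat ?hb //= ?cats0 // ?size_cat /=; lia.
  by rewrite /part_size ht size_cat /=; case: (e0); lia.
- move=> s1 v s2 h1 hv hz hen hs.
  have hn : nonpos (v :: 0 :: s2) by rewrite /= (ltW hv) allzero_nonpos.
  have hn' : nonpos (0 :: v :: s2) by rewrite /= (ltW hv) allzero_nonpos.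
  have hv0 : (0 < v) = false by lia.
  rewrite !hat_nonpos_tail //; set n := size _; set q := (size s1 + (size s2).*2).+4.
  have hsz : part_size e0 en n q = (part_size e0 en n q.-1).+1.
    rewrite /n /q size_cat /= /part_size in hs *.
    by case: (en) hen hs => //=; case: (e0); lia.
  case: s1 @n @q h1 hs hsz => [|x s1] n q h1 hs hsz.
    rewrite /= hv0 ltxx !andbF.
    exists q, [:: 1 + v, 0 & s2]; split; first by apply: (@peels_neg [::]); rewrite //= ?eqxx.
    right; exists q.-1; split=> //; exact: (@peels_neg [:: 0]).
  have hb : nonpos (hat0 e0 (x :: s1)) := hat0_nonpos h1.
  rewrite !hat0_cat; set t := hat0 _ _ in hb *; have ht : size t = (size s1).+1 by rewrite /t.
  exists q, ((1 + v) :: (t ++ 0 :: s2)); split.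
    by apply: peels_neg => //; rewrite /q ht /=; lia.
  right; exists q.-1; split=> //; rewrite -[t ++ _]cat_rcons -[t ++ 0 :: s2]cat_rcons.
  apply: peels_neg; rewrite ?all_rcons ?hb //.
  by rewrite /q size_rcons ht /=; lia.
- move=> a s he ha hz hs; rewrite he in hs *.
  have ha' : 0 < a by lia.
  have h0 : (0 < 1 - a) = false by lia.
  have h1 : 1 - a <= 0 by lia.
  have h2 : 1 - a < 0 by lia.
  rewrite /hat !hatn_cons !hatn_id /= ?h1 ?lexx ?allzero_nonpos // ha' subrr.
  exists ((size s).*2 + 4)%N, [:: 1 + (1 - a), 0 & s]; split.
    by apply: (@peels_neg [::]) => //=; rewrite ?eqxx //; lia.
  right; exists ((size s).*2 + 3)%N; split.
    by apply: (@peels_neg [:: 0]); rewrite //=; lia.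
  by rewrite /part_size /=; case: (en) hs => /=; lia.

Qed.

(** * Partitions with given levels *)

(* There is a bead at N + t, equivalently a gap at N - t. *)
Definition pbead (c : seq int) (t : nat) : bool :=
  let n := size c in let i := (t %% period n)%N in let m := (t %/ period n)%N%:Z in
  (0 < i)%N && (if (i <= n)%N then m < c`_i.-1 else m < - c`_(2 * n - i)).

Lemma pbeadE c m i : (0 < i < period (size c))%N ->
  pbead c (m * period (size c) + i)%N =
  if (i <= size c)%N then m%:Z < c`_i.-1 else m%:Z < - c`_(2 * size c - i).
Proof.
by case/andP=> i0 ilt; rewrite /pbead modnMDl modn_small // divnMDl // divn_small // addn0 i0.
Qed.

Lemma pbead_low c i : (0 < i <= size c)%N -> pbead c i = (0 < c`_i.-1).
Proof.
move=> h; rewrite -[i]add0n -(mul0n (period (size c))) pbeadE /period; last by lia.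
by case/andP: h => _ ->.
Qed.

Lemma pbead_high c i : (size c < i <= 2 * size c)%N -> pbead c i = (c`_(2 * size c - i) < 0).
Proof.
move=> h; rewrite -[i]add0n -(mul0n (period (size c))) pbeadE /period; last by lia.
by rewrite add0n leqNgt; case/andP: h => -> _ /=; rewrite oppr_gt0.
Qed.

Lemma pbead_mult c m : pbead c (m * period (size c)) = false.
Proof. by rewrite /pbead modnMl. Qed.

Definition bead_bound (c : seq int) : nat := (norm1 c).+1 * period (size c).

Lemma nth_norm1 (c : seq int) i : (`|(c`_i)%R| <= norm1 c)%N.
Proof.
elim: c i => [|x c IH] [|i] //=; rewrite ?nth_nil // norm1_cons ?leq_addr //.
exact: leq_trans (IH i) (leq_addl _ _).
Qed.

Lemma pbead_bound c t : (bead_bound c <= t)%N -> pbead c t = false.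
Proof.
move=> ht; apply/negbTE; rewrite /pbead negb_and; apply/orP; right.
have : ((norm1 c).+1 <= t %/ period (size c))%N by rewrite leq_divRL.
move=> hk; case: leqP => _; rewrite -leNgt.
  by have := nth_norm1 c (t %% period (size c)).-1; lia.
by have := nth_norm1 c (2 * size c - t %% period (size c)); lia.
Qed.

(** By symmetry this also counts the gaps before [N - y]. It is the number of rows above the point
    where the boundary path passes the label [N + y]. *)
Definition above (c : seq int) (y : nat) : nat :=
  count (pbead c) (iota y.+1 (bead_bound c)).

Lemma above_ext c y k : (bead_bound c <= y + k)%N ->
  count (pbead c) (iota y.+1 k) = above c y.
Proof.
suff h k' : (bead_bound c <= y + k)%N -> count (pbead c) (iota y.+1 (k + k')) = count (pbead c) (iota y.+1 k).
  move=> hk; rewrite /above; have [hle|hlt] := leqP (bead_bound c) k.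
    rewrite -(subnKC hle) iotaD count_cat [X in (_ + X)%N](@eq_in_count _ _ pred0) ?count_pred0 ?addn0 //.
    by move=> t; rewrite mem_iota => ht; apply: pbead_bound; lia.
  by rewrite -(subnKC (ltnW hlt)) h.
move=> hk; rewrite iotaD count_cat [X in (_ + X)%N](@eq_in_count _ _ pred0) ?count_pred0 ?addn0 //.
by move=> t; rewrite mem_iota => ht; apply: pbead_bound; lia.
Qed.

Lemma above_step c y : above c y = (pbead c y.+1 + above c y.+1)%N.
Proof.
have h : (bead_bound c <= y + (bead_bound c).+1)%N by lia.
by rewrite -(above_ext h) /above; move: (bead_bound c).
Qed.

Lemma above_none c y z : (y <= z)%N -> (forall t, (y < t <= z)%N -> ~~ pbead c t) ->
  above c y = above c z.
Proof.
elim: z => [|z IH]; first by rewrite leqn0 => /eqP->.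
rewrite leq_eqVlt => /orP[/eqP-> //|hy h].
rewrite IH //; last by move=> t ht; apply: h; lia.
by rewrite above_step (negbTE (h z.+1 _)) // hy leqnn.
Qed.

Lemma above_gt0 c y z : (y < z)%N -> pbead c z -> (0 < above c y)%N.
Proof.
move=> hy hz; rewrite -has_count; apply/hasP; exists z => //; rewrite mem_iota hy /=.
by rewrite ltnNge; apply: contraL hz => hb; rewrite pbead_bound //; lia.
Qed.

Lemma count_nth (T : Type) (x0 : T) (a : pred T) (s : seq T) :
  count (fun i => a (nth x0 s i)) (iota 0 (size s)) = count a s.
Proof. by rewrite -{3}[s](mkseq_nth x0) /mkseq count_map. Qed.

(** In the block of level [m], the two mirror runners [i] and [N - i] together hold one bead if
    [m < |c_i|] and none otherwise. Summed over [m], this makes [norm1 c] the number of beads after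
    [N] ([above0]). *)
Lemma count_block c m :
  count (pbead c) (iota (m * period (size c)) (period (size c))) =
  count (fun x : int => m < `|x|)%N c.
Proof.
set N := period (size c); set n := size c in N *.
have e : iota (m * N) N = (m * N)%N :: map (addn (m * N + 1)) (iota 0 n) ++
    map (addn (m * N + 1 + n)) (iota 0 n).
  have -> : iota (m * N) N = iota (m * N) (1 + (n + n)) by congr iota; rewrite /N /period; lia.
  by rewrite !iotaD -!iotaDl !addn0.
rewrite e /= count_cat !count_map pbead_mult add0n.
have h1 : count (fun i => m%:Z < c`_i) (iota 0 n) = count (fun x => m%:Z < x) c.
  exact: (count_nth 0 (fun x => m%:Z < x)).
(* The runners beyond [n] carry the opposite levels in reverse order. *)
have h2 : count (fun i => m%:Z < - (rev c)`_i) (iota 0 n) = count (fun x => m%:Z < - x) c.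
  by rewrite /n -size_rev (count_nth 0 (fun x => m%:Z < - x)) count_rev.
transitivity (count (fun x : int => (m%:Z < x)%R) c + count (fun x : int => (m%:Z < - x)%R) c)%N.
  congr addn.
    rewrite -h1; apply: eq_in_count => i; rewrite mem_iota /= => hi.
    rewrite -addnA pbeadE -/n -/N /N /period; last by lia.
    by rewrite ifT ?add1n //; lia.
  rewrite -h2; apply: eq_in_count => i; rewrite mem_iota /= => hi.
  rewrite -!addnA pbeadE -/n -/N /N /period; last by lia.
  rewrite ifF; last by lia.
  by rewrite nth_rev // -/n; congr (_ < - c`_ _); lia.
rewrite -count_predUI (@eq_count _ (predI _ _) pred0) ?count_pred0 ?addn0; last first.
  by move=> x /=; lia.
by apply: eq_count => x /=; lia.
Qed.

Lemma count_beads c k :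
  count (pbead c) (iota 0 (k * period (size c))) = sumn [seq minn `|x|%N k | x <- c].
Proof.
elim: k => [|k IH].
  rewrite mul0n /=; elim: c => //= x c <-; by rewrite minn0.
rewrite mulSnr iotaD count_cat IH count_block.
elim: c {IH} => //= x c IH; rewrite [in LHS]addnACA IH; congr addn.
by lia.
Qed.

Lemma above0 c : above c 0 = norm1 c.
Proof.
set k := ((norm1 c).+2 * period (size c)).-1.
have hk : k.+1 = ((norm1 c).+2 * period (size c))%N by rewrite prednK // muln_gt0.
have h : (bead_bound c <= 0 + k)%N.
  by rewrite add0n -ltnS hk /bead_bound ltn_mul2r /=.
rewrite -(above_ext h).
have -> : count (pbead c) (iota 1 k) = count (pbead c) (iota 0 k.+1).
  change (count (pbead c) (iota 1 k) = pbead c 0 + count (pbead c) (iota 1 k))%N.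
  by rewrite -[X in pbead c X](mul0n (period (size c))) pbead_mult.
rewrite hk count_beads /norm1; congr sumn; apply/eq_in_map => x hx.
apply/minn_idPl; apply: leq_trans (leqW (leqnSn _)).
by have := nth_norm1 c (index x c); rewrite nth_index.
Qed.

(** * The first bead after the reference label, and the end of the central row *)

Definition first_bead (e0 : nat) (c : seq int) (p : nat) : Prop :=
  [/\ (e0 < p)%N, pbead c p & forall t, (e0 < t < p)%N -> ~~ pbead c t].

Lemma all_drop_nth (e : nat) (s : seq int) i : nonpos (drop e s) -> (e <= i)%N -> s`_i <= 0.
Proof.
move=> h hi; rewrite -(subnKC hi) -nth_drop.
have [hlt|hge] := ltnP (i - e) (size (drop e s)); first exact: (all_nthP 0 h).
by rewrite nth_default.
Qed.

Lemma first_pos (e0 : nat) s1 (v : int) s2 : nonpos (drop e0 s1) -> 0 < v -> (e0 <= size s1)%N ->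
  first_bead e0 (s1 ++ v :: s2) (size s1).+1.
Proof.
move=> h hv he; split=> // [|t ht].
  by rewrite pbead_low /= ?size_cat /= ?nth_cat ?ltnn ?subnn //; lia.
rewrite pbead_low ?size_cat /=; last by lia.
rewrite nth_cat ifT; last by lia.
by rewrite -leNgt; apply: (all_drop_nth h); lia.
Qed.

Lemma first_neg (e0 : nat) s1 (v : int) s2 p : nonpos (drop e0 s1) -> v < 0 -> allzero s2 ->
  (e0 < size (s1 ++ v :: s2))%N -> p = (size s1 + (size s2).*2).+2 ->
  first_bead e0 (s1 ++ v :: s2) p.
Proof.
move=> h hv h0 he ->; set c := s1 ++ _.
have hc : size c = (size s1 + size s2).+1 by rewrite /c size_cat /=; lia.
rewrite -/c hc in he; split=> [||t ht]; first by lia.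
  rewrite pbead_high hc; last by lia.
  have -> : (2 * (size s1 + size s2).+1 - (size s1 + (size s2).*2).+2 = size s1)%N by lia.
  by rewrite /c nth_cat ltnn subnn.
have h2 i : (size s1 < i)%N -> c`_i = 0.
  move=> hi; rewrite /c -cat_rcons nth_cat size_rcons ltnNge hi /=.
  have [hlt|hge] := ltnP (i - (size s1).+1) (size s2); last by rewrite nth_default.
  by apply/eqP; apply: (all_nthP 0 h0).
have [hle|hgt] := leqP t (size c).
  rewrite pbead_low; last by lia.
  rewrite -leNgt; have [h1|h1] := ltnP (size s1) t.-1; first by rewrite h2.
  move: h1; rewrite leq_eqVlt => /orP[/eqP->|h1].
    by rewrite /c nth_cat ltnn subnn /= ltW.
  by rewrite /c nth_cat h1; apply: (all_drop_nth h); lia.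
by rewrite pbead_high ?h2 ?ltxx //; lia.
Qed.

(** The bead at [N + 1] does not count, and the mirror of runner 1 has no bead after [N] because
    [a > 0]. The first bead is therefore on runner 1 again, one level further. *)
Lemma first_wrap (a : int) s : 1 < a -> allzero s -> first_bead 1 (a :: s) (period (size s).+1).+1.
Proof.
move=> ha h0; split=> [||t ht].
- by rewrite /period; lia.
- rewrite -[_.+1]addn1 -[X in (X + _)%N]mul1n.
  by rewrite -[(size s).+1]/(size (a :: s)) pbeadE /period /=; lia.
have h2 i : (0 < i)%N -> (a :: s)`_i = 0.
  case: i => // i _ /=.
  have [hlt|hge] := ltnP i (size s); last by rewrite nth_default.
  by apply/eqP; apply: (all_nthP 0 h0).
have [hle|hgt] := leqP t (size (a :: s)).
  by rewrite pbead_low ?h2 ?ltxx //; lia.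
have [hle'|hgt'] := leqP t (2 * size (a :: s)).
  rewrite pbead_high ?hgt //; case: (2 * _ - t)%N => [|k]; last by rewrite h2 ?ltxx.
  by rewrite /= -leNgt; lia.
have -> : t = (1 * period (size (a :: s)))%N by move: ht hgt'; rewrite /period /=; lia.
by rewrite pbead_mult.
Qed.

Arguments above : simpl never.
Arguments pbead : simpl never.
Arguments period : simpl never.
(* The multiples of N up to y are not abacus labels. *)
Definition labels_upto (n y : nat) : nat := (y - y %/ period n)%N.

Arguments labels_upto : simpl never.

Lemma labels_small n y : (y <= 2 * n)%N -> labels_upto n y = y.
Proof. by move=> h; rewrite /labels_upto divn_small ?subn0 // /period ltnS. Qed.

Lemma labels_wrap n : (0 < n)%N -> labels_upto n (period n).+1 = period n.
Proof.
move=> h; rewrite /labels_upto -addn1 divnDl ?dvdnn // divnn /= divn_small ?addn0 ?addnK //.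
by rewrite /period; lia.
Qed.

Lemma labelsS c y : pbead c y.+1 -> labels_upto (size c) y.+1 = (labels_upto (size c) y).+1.
Proof.
set n := size c => h.
have hN : ~~ (period n %| y.+1)%N.
  by apply: contraL h => /dvdnP[m ->]; rewrite pbead_mult.
rewrite /labels_upto divnS ?(negbTE hN) // add0n subSn //.
exact: leq_div.
Qed.

(* The two half-planes cut by the label y, and its mirror image, delimit the
   rows of the core. *)
Definition shape_of (la : seq nat) (c : seq int) : Prop :=
  (0%N \notin la) /\ forall y i, (0 < i)%N ->
  let u := above c y in let v := (u + labels_upto (size c) y)%N in
  [/\ (i <= u)%N -> (v <= row_len la i)%N,
      (u < i)%N -> (row_len la i <= v)%N
    & (i <= v)%N -> (u <= row_len la i)%N].

(** The bead is the north-step of row [above c y], whose length is squeezed between the cuts just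
    before and just after the bead. *)
Lemma bead_row la c y : shape_of la c -> pbead c y.+1 ->
  row_len la (above c y) = (above c y + labels_upto (size c) y)%N.
Proof.
move=> [_ h] hb; have hS := above_step c y; rewrite hb /= in hS.
have h0 : (0 < above c y)%N by rewrite hS.
have [h1 _ _] := h y _ h0; have [_ h2 _] := h y.+1 _ h0.
apply/eqP; rewrite eqn_leq h1 // andbT.
by move: h2; rewrite labelsS //; lia.
Qed.

Lemma first_above (e0 : nat) c p : first_bead e0 c p -> above c p.-1 = above c e0.
Proof.
move=> [h1 _ h3]; symmetry; apply: above_none; first by lia.
by move=> t ht; apply: h3; lia.
Qed.

Lemma first_row la (e0 : nat) c p : shape_of la c -> first_bead e0 c p ->
  (row_len la (above c e0)).+1 = (above c e0 + labels_upto (size c) p)%N.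
Proof.
move=> hs hf; have [h1 h2 _] := hf; rewrite -(first_above hf).
case: p h1 h2 {hf} => // p _ hb; rewrite (bead_row hs hb) labelsS //=; lia.
Qed.

(** The cut at the reference label separates the rows that reach the reference diagonal from those
    that do not. *)
Lemma central_rowE T la c : (s0_is_D T <= size c)%N -> shape_of la c ->
  central_row T la = above c (s0_is_D T).
Proof.
move=> hn [_ h]; set d := above _ _; rewrite /central_row /ref_diagonal.
have hl : labels_upto (size c) (s0_is_D T) = s0_is_D T by rewrite labels_small //; lia.
rewrite (@eq_in_count _ _ (fun i => i <= d)%N); last first.
  move=> i; rewrite mem_iota => /andP[i0 _].
  have [] := h (s0_is_D T) i i0; rewrite hl -/d => h1 h2 _.
  by case: (leqP i d) => hi; [have := h1 hi|have := h2 hi]; lia.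
have hd : (d <= size la)%N.
  have [->|d0] := posnP d; first by [].
  have [h1 _ _] := h (s0_is_D T) d d0; rewrite leqNgt; apply/negP => hlt.
  have hr : row_len la d = 0%N by rewrite /row_len nth_default.
  by have := h1 (leqnn _); rewrite hr -/d; lia.
rewrite -(subnKC hd) iotaD count_cat.
rewrite (@eq_in_count _ _ predT) ?count_predT ?size_iota; last by move=> i; rewrite mem_iota /=; lia.
by rewrite (@eq_in_count _ _ pred0) ?count_pred0 ?addn0 // => i; rewrite mem_iota /=; lia.
Qed.

Lemma shape_nil la c : shape_of la c -> (la == [::]) = (norm1 c == 0%N).
Proof.
move=> hs; have [h0 h] := hs; rewrite -above0; apply/idP/idP => [/eqP e|/eqP e].
  rewrite -leqn0 leqNgt; apply/negP => hlt.
  have [h1 _ _] := h 0%N 1%N isT; have := h1 hlt; rewrite e /row_len /=; lia.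
case: la h0 h {hs} => // x la; rewrite inE negb_or => /andP[hx _] h.
have [_ h2 _] := h 0%N 1%N isT.
by have := h2; rewrite e labels_small //= => /(_ isT); move: hx; case: x {h h2}.
Qed.

Lemma shape_bead la c y : shape_of la c -> ~~ (period (size c) %| y.+1)%N ->
  pbead c y.+1 <-> exists2 i, (0 < i)%N & (row_len la i = i + labels_upto (size c) y)%N.
Proof.
move=> hs hy; split=> [hb|[i i0 hi]].
  exists (above c y); last exact: bead_row.
  by apply: above_gt0 hb.
apply: contraPT hi => hb; have [_ h] := hs; have hS := above_step c y.
rewrite (negbTE hb) add0n in hS.
have hl : labels_upto (size c) y.+1 = (labels_upto (size c) y).+1.
  rewrite /labels_upto divnS ?(negbTE hy) // add0n subSn //; exact: leq_div.
have [h1 _ _] := h y.+1 i i0; have [_ h2 _] := h y i i0.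
rewrite hl -hS in h1; have [hle|hlt] := leqP i (above c y).
  by have := h1 hle; lia.
by have := h2 hlt; lia.
Qed.

(** The lengths of the rows recover the beads after [N] ([shape_bead]), and these recover the
    levels. *)
Lemma shape_inj la c1 c2 : size c1 = size c2 -> shape_of la c1 -> shape_of la c2 -> c1 = c2.
Proof.
move=> hsz h1 h2; set n := size c1.
have hp t : ~~ (period n %| t)%N -> pbead c1 t = pbead c2 t.
  case: t => [|y] hy; first by rewrite dvdn0 in hy.
  have e1 := shape_bead h1 hy; have := shape_bead h2; rewrite -hsz => /(_ _ hy) e2.
  by apply/idP/idP; [move/e1/e2|move/e2/e1].
have hm m i : (0 < i < period n)%N -> pbead c1 (m * period n + i) = pbead c2 (m * period n + i).
  by move=> hi; apply: hp; rewrite dvdn_addr ?dvdn_mull // gtnNdvd; case/andP: hi.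
apply: (@eq_from_nth _ 0) => // i hi; rewrite -/n in hi.
have E1 m j : (0 < j < period n)%N -> pbead c1 (m * period n + j)%N =
    if (j <= n)%N then m%:Z < c1`_j.-1 else m%:Z < - c1`_(2 * n - j) by exact: pbeadE.
have E2 m j : (0 < j < period n)%N -> pbead c2 (m * period n + j)%N =
    if (j <= n)%N then m%:Z < c2`_j.-1 else m%:Z < - c2`_(2 * n - j).
  by rewrite /n hsz; exact: pbeadE.
have hA m : (m%:Z < c1`_i) = (m%:Z < c2`_i).
  have hj : (0 < i.+1 < period n)%N by rewrite /period; lia.
  by have := hm m _ hj; rewrite E1 // E2 // hi.
have hB m : (m%:Z < - c1`_i) = (m%:Z < - c2`_i).
  have hj : (0 < 2 * n - i < period n)%N by rewrite /period; lia.
  have := hm m _ hj; rewrite E1 // E2 // ifF; last by lia.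
  rewrite ifF; last by lia.
  by have -> : (2 * n - (2 * n - i) = i)%N by lia.
(* Runner [i] only shows the positive part of the level and its mirror the negative part. Testing
   the thresholds just below both absolute values, on both runners, is enough. *)
move: (hA `|c1`_i|.-1) (hA `|c2`_i|.-1) (hB `|c1`_i|.-1) (hB `|c2`_i|.-1); lia.
Qed.

Lemma above_ref (e0 : bool) c : (0 < size c)%N ->
  (above c e0 + (e0 && (0 < c`_0)%R))%N = norm1 c.
Proof.
move=> hs; rewrite -above0; case: e0 => /=; last by rewrite addn0.
by rewrite (above_step c 0) pbead_low // addnC.
Qed.

Lemma size_move (e0 en : bool) c r p c' : move e0 en c r p c' -> size c' = size c.
Proof. by case=> *; rewrite ?size_cat. Qed.

Lemma move_first (e0 en : bool) c r p c' : move e0 en c r p c' ->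
  (2 + e0 + en <= size c)%N -> first_bead e0 c p.
Proof.
case=> {c r p c'}.
- move=> s1 a v s2 h1 ha hv hs; have hs1 := @first_pos e0 (rcons s1 a) v s2.
  rewrite cat_rcons size_rcons in hs1; apply: hs1 => //; last by case: (e0).
  have [hle|hlt] := leqP e0 (size s1); first by rewrite drop_rcons // all_rcons ha.
  by rewrite drop_oversize // size_rcons.
- by move=> v s /negbTE-> hv _; apply: (@first_pos 0%N [::]).
- move=> a v s -> ha hv _; exact: (@first_pos 1%N [:: a]).
- move=> s v he h1 hv hs; apply: first_neg => //=; last by rewrite addn0.
  by move: hs; case: (e0); case: (en) => /=; lia.
- move=> s a v he h1 ha hv hs; rewrite -cat_rcons -cats1.
  apply: first_neg => //=; last by rewrite size_cat /=; lia.
    have [hle|hlt] := leqP e0 (size s); first by rewrite cats1 drop_rcons // all_rcons ha.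
    by rewrite drop_oversize // size_cat addn1.
  by move: hs; rewrite !size_cat /=; case: (e0) => /=; lia.
- move=> s v he h1 hv hs; apply: first_neg => //=; last by lia.
  by move: hs; case: (e0) => /=; lia.
- move=> s1 v s2 h1 hv hz hen hs; apply: first_neg => //=; last by lia.
  by move: hs; case: (e0) => /=; lia.
- move=> a s -> ha hz hs; have := @first_wrap a (0 :: s) ha hz.
  by congr first_bead; rewrite /period /=; lia.
Qed.

Lemma nonpos_rcons_drop (e : nat) s a : nonpos (drop e s) -> a <= 0 -> nonpos (drop e (rcons s a)).
Proof.
move=> h ha; have [hle|hlt] := leqP e (size s); first by rewrite drop_rcons // all_rcons ha.
by rewrite drop_oversize // size_rcons.
Qed.

Definition two_boxes (e0 en : bool) (n r : nat) : bool :=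
  (en && (r == n)) || (e0 && (r == 0%N)).

(** Either the first bead stays beyond the reference label and the central row is shortened by one
    box, by two, or by an amount left open; or the bead passes this label and the number of boxes on
    the reference diagonal drops by one. Two boxes are removed in such a passage only when $s_0^D$
    moves the bead [N + 2]. *)
Lemma move_next (e0 en : bool) c r p c' : move e0 en c r p c' ->
  (2 + e0 + en <= size c)%N -> let n := size c in
  (exists p', [/\ first_bead e0 c' p', above c' e0 = above c e0 &
    if two_boxes e0 en n r then labels_upto n p = (labels_upto n p').+2
    else (labels_upto n p' < labels_upto n p)%N]) \/
  (above c e0 = (above c' e0).+1 /\
    (two_boxes e0 en n r -> [/\ e0 : Prop, p = 2%N & ~~ pbead c' 1])).
Proof.
move=> hm hs n; have hsz := size_move hm; rewrite -/n in hsz.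
have n0 : (0 < n)%N by move: hs; rewrite -/n; lia.
have ha := above_ref e0 n0; have := @above_ref e0 c'; rewrite hsz => /(_ n0) ha'.
have hab : norm1 c' = norm1 c -> (e0 -> (0 < c'`_0) = (0 < c`_0)) -> above c' e0 = above c e0.
  move=> hnm; move: ha ha'; rewrite hnm => <- h hh; apply: (@addIn (e0 && (0 < c`_0))).
  by rewrite -h; case: (e0) hh => // ->.
case: hm @n hs hsz n0 ha ha' hab => {c r p c'}.
- move=> s1 a v s2 h1 hna hv n hs hsz n0 ha ha' hab.
  have hn : n = (size s1 + (size s2).+2)%N by rewrite /n size_cat.
  have ht : two_boxes e0 en n (size s1).+1 = false by rewrite /two_boxes hn; case: (e0); case: (en) => /=; lia.
  rewrite ht; have heq : norm1 (s1 ++ v :: a :: s2) = norm1 (s1 ++ a :: v :: s2).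
    by rewrite !norm1_cat !norm1_cons; lia.
  have [he|he] := leqP e0 (size s1).
    left; exists (size s1).+1; split; first exact: first_pos.
      by apply: hab => // e1; move: he; rewrite e1; case: (s1).
    by rewrite !labels_small //; lia.
  right; split=> //; case: e0 he ha ha' {ht hs h1 hab} => // he; case: s1 he heq {hn hsz n0 n} => //= _ heq.
  by rewrite heq hv ltNge hna /=; lia.
- move=> v s /negbTE he hv n hs hsz n0 ha ha' hab; right; rewrite he in ha ha' *.
  move: ha ha'; rewrite /two_boxes !norm1_cons /= !addn0 => -> ->; split; first by lia.
  by rewrite orbF => /andP[_ /eqP e]; rewrite -e in n0.
- move=> a v s he ha hv n hs hsz n0 hA hA' hab; right; rewrite he in hA hA' *.
  have h1 : (0 < 1 - v) = false by lia.
  move: hA hA'; rewrite /= ha h1 !norm1_cons => hA hA'; split; first by lia.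
  by move=> _; split=> //; rewrite pbead_low //= h1.
- move=> s v he h1 hv n hs hsz n0 ha ha' hab; left; exists (size s).+1.
  have hn : n = (size s).+1 by rewrite /n size_cat addn1.
  have hes : (e0 <= size s)%N by move: hs; rewrite size_cat /=; case: (e0) => /=; lia.
  split; first by apply: first_pos => //; lia.
    apply: hab; first by rewrite !norm1_cat !norm1_cons ?norm1_nil; lia.
    by move=> e1; move: hes; rewrite e1; case: (s).
  have -> : two_boxes e0 en n (size s).+1 = false.
    by rewrite /two_boxes (negbTE he) andbF.
  by rewrite !labels_small ?hn //; lia.
- move=> s a v he h1 ha hv n hs hsz n0 hA hA' hab; left; exists (size s).+1.
  have hn : n = (size s).+2 by rewrite /n size_cat addn2.
  have hes : (e0 <= size s)%N by move: hs; rewrite he size_cat /=; case: (e0) => /=; lia.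
  have h0s : (0 < size s)%N by move: hs; rewrite he size_cat /=; lia.
  split; first by apply: first_pos => //; lia.
    apply: hab; first by rewrite !norm1_cat !norm1_cons ?norm1_nil; lia.
    by move=> _; case: (s) h0s.
  by rewrite /two_boxes he hn eqxx /= !labels_small //; lia.
- move=> s v he h1 hv n hs hsz n0 ha ha' hab; left; exists (size s).+2.
  have hn : n = (size s).+2 by rewrite /n size_cat addn2.
  have h0s : (0 < size s)%N by move: hs; rewrite he size_cat /=; lia.
  split.
  - rewrite -cat_rcons -(size_rcons s 0); apply: first_pos; first exact: nonpos_rcons_drop.
      by lia.
    by rewrite size_rcons; case: (e0).
  - apply: hab; first by rewrite !norm1_cat !norm1_cons ?norm1_nil; lia.
    by move=> _; case: (s) h0s.
  - by rewrite /two_boxes he hn eqxx /= !labels_small //; lia.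
- move=> s1 v s2 h1 hv hz hen n hs hsz n0 ha ha' hab; left; exists (size s1 + (size s2).*2).+3.
  have hn : n = (size s1 + (size s2).+2)%N by rewrite /n size_cat.
  split.
  - rewrite -cat_rcons; apply: first_neg => //; first exact: nonpos_rcons_drop.
      by rewrite cat_rcons hsz; move: hs; rewrite -/n; lia.
    by rewrite size_rcons.
  - apply: hab; first by rewrite !norm1_cat !norm1_cons ?norm1_nil; lia.
    by move=> _; case: (s1) => //=; lia.
  - have -> : two_boxes e0 en n (size s1).+1 = false by rewrite /two_boxes hn; case: (e0); case: (en) => /=; lia.
    by rewrite !labels_small //; lia.
- move=> a s he ha hz n hs hsz n0 hA hA' hab; left; exists ((size s).*2 + 3)%N.
  have hn : n = (size s).+2 by rewrite /n.
  split.
  - rewrite he; apply: (@first_neg 1%N [:: 1]) => //=; first by lia.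
    by rewrite addnC.
  - apply: hab; first by rewrite !norm1_cons ?norm1_nil; lia.
    by move=> _ /=; lia.
  - rewrite /two_boxes he orbT.
    have -> : ((size s).*2 + 6 = (period n).+1)%N by rewrite hn /period; lia.
    by rewrite labels_wrap // labels_small hn /period; lia.
Qed.

(** * Residues at the end of the central row *)

Lemma min_rankE T : min_rank T = (2 + s0_is_D T + sn_is_D T)%N.
Proof. by case: T. Qed.

(** Specialisation of [residues] to the last cell of a row of length [d + k]: a row ending inside a
    strip ends at $c_1$, $c_2$ or $c_3$, which leaves three lines of the rule. On the first
    diagonal, [2 * d + 1] modulo 4 is decided by the parity of [d]. *)
Definition end_residues (T : quotient_type) (n d k : nat) : seq nat :=
  if s0_is_D T && (k <= 1)%N then
    [:: if k == 0%N then 0%N else if odd d then 0%N else 1%N]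
  else if s0_is_D T && (descalator_pos n k < 3)%N then
    nth [::] [:: [:: 1]; [:: 0]; [:: 1; 0]]%N (descalator_pos n k)
  else if sn_is_D T && (escalator_pos n k < 3)%N then
    nth [::] [:: [:: n.-1]; [:: n]; [:: n.-1; n]] (escalator_pos n k)
  else let k' := (k %% (2 * n))%N in [:: if (k' <= n)%N then k' else (2 * n - k')%N].

Lemma strip_residues_end a b p la d k : row_len la d = (d + k)%N -> (0 < d)%N -> (0 < k)%N ->
  (p < 3)%N -> strip_residues a b p la (d, (d + k)%N) =
  nth [::] [:: [:: a]; [:: b]; [:: a; b]] p.
Proof.
move=> hr hd hk hp; rewrite /strip_residues -[X in (X < _)%N]addn0 ltn_add2l hk hr /strip_rule.
case: p hp => [|[|[|p]]] // _.
- by rewrite subn0 eqn_leq ltnn /= eqxx.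
- by do 2 (case: eqP => [|_]; first lia); case: eqP => [_|] //; lia.
- by do 3 (case: eqP => [|_]; first lia); case: eqP => [_|] //; lia.
Qed.

Lemma residues_end T n la d k : (min_rank T <= n)%N -> row_len la d = (d + k)%N -> (0 < d)%N ->
  residues T n la (d, (d + k)%N) = end_residues T n d k.
Proof.
rewrite min_rankE => hn hr hd; rewrite /residues /end_residues /=.
have -> : `|(d + k)%N%:Z - d%:Z|%N = k by lia.
have [/andP[_ k1]|hk] := ifP.
  rewrite /main_descalator_residue /=.
  case: (posnP k) k1 => [->|k0] k1; first by rewrite addn0 eqxx.
  have -> : (d == d + k)%N = false by lia.
  have -> : (d + (d + k) = d.*2 + 1)%N by lia.
  have -> : ((d.*2 + 1) %% 4 == 1)%N = ~~ odd d by lia.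
  by case: odd.
have [/andP[he hp]|hp] := ifP.
  have k0 : (0 < k)%N by move: hk; rewrite he /=; lia.
  exact: strip_residues_end.
have [/andP[he hq]|hq] := ifP.
  have k0 : (0 < k)%N.
    rewrite lt0n; apply/eqP => k0; move: hq; rewrite k0 /escalator_pos modn_small; move: hn; rewrite he; lia.
  exact: strip_residues_end.
rewrite /fixed_residue /=.
have -> : (d + k)%N%:Z - d%:Z = k%:Z by lia.
by rewrite modz_nat.
Qed.

Lemma modn_once m q : (q <= m < 2 * q)%N -> (m %% q = m - q)%N.
Proof. by move=> h; rewrite -{1}(@subnK q m) ?modnDr ?modn_small //; lia. Qed.

Lemma end_fixed T n d k : (k < 2 * n)%N -> (s0_is_D T -> 1 < k < (2 * n).-1)%N ->
  (sn_is_D T -> (1 < n) && ((k < n.-1) || (n.+1 < k)))%N ->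
  end_residues T n d k = [:: if (k <= n)%N then k else (2 * n - k)%N].
Proof.
move=> hk h0 h1; rewrite /end_residues (modn_small hk).
rewrite ifF; last by case: s0_is_D h0 => //= /(_ isT); lia.
rewrite ifF; last first.
  by case: s0_is_D h0 => //= /(_ isT) h; rewrite /descalator_pos modn_small; lia.
rewrite ifF //; case: sn_is_D h1 => //= /(_ isT) /andP[hn h].
rewrite /escalator_pos; case/orP: h => h; first by rewrite modn_small; lia.
by rewrite modn_once; lia.
Qed.

Lemma end_escalator T n d k : sn_is_D T -> (1 < n)%N -> (n.-1 <= k <= n.+1)%N ->
  (s0_is_D T -> 1 < k < (2 * n).-1)%N ->
  end_residues T n d k = nth [::] [:: [:: n.-1]; [:: n]; [:: n.-1; n]] (k.+1 - n).
Proof.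
move=> h1 hn hk h0; rewrite /end_residues h1.
rewrite ifF; last by case: s0_is_D h0 => //= /(_ isT); lia.
rewrite ifF; last first.
  by case: s0_is_D h0 => //= /(_ isT) h; rewrite /descalator_pos modn_small; lia.
rewrite /escalator_pos modn_once; last by lia.
have -> : (k + n + 1 - 2 * n = k.+1 - n)%N by lia.
by rewrite ifT //=; lia.
Qed.

Lemma end_descalator T n d k : s0_is_D T -> (1 < n)%N -> ((2 * n).-1 <= k <= 2 * n)%N ->
  end_residues T n d k = nth [::] [:: [:: 1%N]; [:: 0%N]] (k.+1 - 2 * n).
Proof.
move=> h1 hn hk; rewrite /end_residues h1 /= ifF; last by lia.
rewrite /descalator_pos modn_once; last by lia.
rewrite addn1 ifT; last by lia.
by have [->|->] : (k.+1 - 2 * n = 0 \/ k.+1 - 2 * n = 1)%N by lia.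
Qed.

(** Existence and uniqueness of the peeling residue in one equivalence, tie-break included. *)
Definition residue_ok (n r : nat) (R : seq nat) : Prop :=
  forall r', (r' \in R /\ (n \in R -> n.-1 \in R -> r' = n)) <-> r' = r.

Lemma residue_ok1 n r : (0 < n)%N -> residue_ok n r [:: r].
Proof.
move=> hn r'; rewrite !inE; split=> [[/eqP]//|->]; split=> //.
by move=> /eqP <- /eqP; lia.
Qed.

Lemma residue_ok2 n : (0 < n)%N -> residue_ok n n [:: n.-1; n].
Proof.
move=> hn r'; rewrite !inE !eqxx !orbT /=; split=> [[_ /(_ isT isT)]//|->].
by rewrite eqxx orbT.
Qed.

(** By [first_row] the central row ends on the diagonal [(labels_upto n p).-1], which determines the
    residue except on the first diagonal with $s_0^D$. There the parity of the row index [d]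
    decides: [d] is [norm1 c] if the first entry is nonpositive (residue 1) and one less if it is
    positive (residue 0). *)
Lemma move_residue T c r p c' :
  move (s0_is_D T) (sn_is_D T) c r p c' -> (min_rank T <= size c)%N ->
  (s0_is_D T -> ~~ odd (norm1 c)) ->
  residue_ok (size c) r
    (end_residues T (size c) (above c (s0_is_D T)) (labels_upto (size c) p).-1).
Proof.
move=> hm hn hodd; have n0 : (0 < size c)%N by apply: leq_trans hn; case: T {hm hodd}.
have hd := above_ref (s0_is_D T) n0.
rewrite min_rankE in hn.
have e1 : s0_is_D T -> (3 <= size c)%N by move=> h; move: hn; rewrite h; lia.
have e2 : sn_is_D T -> (3 <= size c)%N by move=> h; move: hn; rewrite h; lia.
have e3 : s0_is_D T -> sn_is_D T -> (4 <= size c)%N by move=> h h'; move: hn; rewrite h h'; lia.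
have hk p' : (p' <= 2 * size c)%N -> labels_upto (size c) p' = p' by exact: labels_small.
have h1 r' : residue_ok (size c) r' [:: r'] by exact: residue_ok1.
case: hm hn hodd n0 hd hk h1 e1 e2 e3 => {c r p c'}.
- move=> s1 a v s2 _ ha hv; set c := _ ++ _; move=> hn hodd n0 hd hk h1 e1 e2 e3.
  have hc : size c = (size s1 + (size s2).+2)%N by rewrite /c size_cat.
  rewrite hk /=; last by lia.
  case: (boolP (s0_is_D T && (size s1 == 0%N))) => [/andP[he /eqP/size0nil hs1]|he].
    rewrite /end_residues hs1 he /=; suff -> : odd (above c true) = false by [].
    rewrite he in hd; move: hd; rewrite /c hs1 /= ltNge ha addn0 => ->.
    by apply/negbTE; move: (hodd he); rewrite /c hs1.
  have he' : s0_is_D T -> (0 < size s1)%N by case: s0_is_D he => //=; rewrite lt0n.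
  case: (boolP (sn_is_D T && (size s2 == 0%N))) => [/andP[hen /eqP hs2]|hen].
    rewrite end_escalator //; try by move: (e2 hen); lia.
      have -> : ((size s1).+2 - size c = 0)%N by lia.
      by have -> : (size s1).+1 = (size c).-1 by lia.
  rewrite end_fixed; first by rewrite ifT //; lia.
  - by lia.
  - by move=> h; move: (he' h); lia.
  - by move=> h; move: (e2 h); rewrite h /= in hen; lia.
- move=> v s /negbTE he hv hn hodd n0 hd hk h1 e1 e2 e3.
  rewrite hk /=; last by lia.
  by rewrite end_fixed //= ?he //; move=> h; move: (e2 h); rewrite /=; lia.
- move=> a v s he ha hv hn hodd n0 hd hk h1 e1 e2 e3.
  rewrite hk /=; last by lia.
  rewrite /end_residues he /=; suff -> : odd (above [:: a, v & s] true) = true by [].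
  by move: hd (hodd he); rewrite he /= ha => <-; rewrite addn1 /= negbK.
- move=> s v /negbTE he _ hv; set c := _ ++ _; move=> hn hodd n0 hd hk h1 e1 e2 e3.
  have hc : size c = (size s).+1 by rewrite /c size_cat addn1.
  rewrite hk /=; last by move: hn; lia.
  rewrite end_fixed ?he //; first by rewrite ifT; [exact: h1|rewrite hc].
  - by move: hn; lia.
  - by move=> h; move: (e1 h); lia.
- move=> s a v he _ ha hv; set c := _ ++ _; move=> hn hodd n0 hd hk h1 e1 e2 e3.
  have hc : size c = (size s).+2 by rewrite /c size_cat addn2.
  rewrite hk /=; last by lia.
  rewrite end_escalator //; try by lia.
    have -> : ((size s).+3 - size c = 1)%N by lia.
    by rewrite /= -hc; exact: h1.
- move=> s v he _ hv; set c := _ ++ _; move=> hn hodd n0 hd hk h1 e1 e2 e3.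
  have hc : size c = (size s).+2 by rewrite /c size_cat addn2.
  have hc3 := e2 he.
  rewrite hk /=; last by lia.
  rewrite end_escalator //; try by lia.
    (* The row ends at $c_3$, which has both residues; the convention of the procedure selects
       [n]. *)
    have -> : ((size s).+4 - size c = 2)%N by lia.
    by rewrite /= -hc; exact: residue_ok2.
- move=> s1 v s2 _ hv hz hen; set c := _ ++ _; move=> hn hodd n0 hd hk h1 e1 e2 e3.
  have hc : size c = (size s1 + (size s2).+2)%N by rewrite /c size_cat.
  rewrite hk /=; last by lia.
  case: (boolP (s0_is_D T && (size s1 == 0%N))) => [/andP[he /eqP hs1]|he].
    rewrite end_descalator //; try by lia.
    have -> : ((size s1 + (size s2).*2).+4 - 2 * size c = 0)%N by lia.
    by rewrite hs1.
  have he' : s0_is_D T -> (0 < size s1)%N by case: s0_is_D he => //=; rewrite lt0n.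
  rewrite end_fixed.
  - rewrite ifF; last by move: hen; case: sn_is_D => /=; lia.
    by have -> : (2 * size c - (size s1 + (size s2).*2).+3 = (size s1).+1)%N by lia.
  - by lia.
  - by move=> h; move: (he' h); lia.
  - by move=> h; move: hen; rewrite h /=; lia.
- move=> a s he ha hz; set c := _ :: _; move=> hn hodd n0 hd hk h1 e1 e2 e3.
  have hc : size c = (size s).+2 by [].
  have -> : ((size s).*2 + 6 = (period (size c)).+1)%N by rewrite hc /period; lia.
  rewrite labels_wrap // end_descalator // /period; try by lia.
  by have -> : ((2 * size c).+1.-1.+1 - 2 * size c = 1)%N by lia.
Qed.

(** * Generators as reflections *)

Definition mirrored (n : nat) (w : int -> int) : Prop :=
  (forall i, w (i + (period n)%:Z) = w i + (period n)%:Z) /\ (forall i, w (- i) = - w i).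

Lemma mirrored_comp n v w : mirrored n v -> mirrored n w -> mirrored n (v \o w).
Proof. by move=> [v1 v2] [w1 w2]; split=> i /=; rewrite ?w1 ?v1 ?w2 ?v2. Qed.

Lemma mirrored_shift n w q i : mirrored n w ->
  w (q * (period n)%:Z + i) = q * (period n)%:Z + w i.
Proof.
move=> [h _]; have hn (k : nat) j : w (k%:Z * (period n)%:Z + j) = k%:Z * (period n)%:Z + w j.
  elim: k j => [|k IH] j; first by rewrite !mul0r !add0r.
  have -> : k.+1%:Z * (period n)%:Z + j = k%:Z * (period n)%:Z + (j + (period n)%:Z) by lia.
  by rewrite IH h; lia.
case: q => [k|k]; first exact: hn.
rewrite NegzE; have := hn k.+1 (- k.+1%:Z * (period n)%:Z + i).
by rewrite addrA -mulrDl subrr mul0r add0r => ->; rewrite mulNr addKr.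
Qed.

Lemma mirrored_mult n w q : mirrored n w -> w (q * (period n)%:Z) = q * (period n)%:Z.
Proof.
move=> h; have := mirrored_shift q 0 h; rewrite addr0 => ->.
have [_ h2] := h; have := h2 0; rewrite oppr0; move: (w 0) => z; lia.
Qed.

Lemma mirror_extE n g q (r : nat) : (r < period n)%N ->
  mirror_ext n g (q * (period n)%:Z + r%:Z) =
  q * (period n)%:Z + (if r == 0%N then 0 else if (r <= n)%N then g r
     else (period n)%:Z - g (period n - r)%N).
Proof.
move=> hr; have hN : (period n)%:Z != 0 by [].
rewrite /mirror_ext modzMDl divzMDl // divz_small ?addr0; last by rewrite lez_nat ltz_nat.
by rewrite modz_small ?lez_nat ?ltz_nat.
Qed.

Lemma mirror_ext_pos n g q (k : nat) : (0 < k <= n)%N ->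
  mirror_ext n g (q * (period n)%:Z + k%:Z) = q * (period n)%:Z + g k.
Proof.
move=> hk; rewrite mirror_extE; last by rewrite /period; lia.
by rewrite ifF; [rewrite ifT //|]; lia.
Qed.

Lemma mirror_ext_mult n g q : mirror_ext n g (q * (period n)%:Z) = q * (period n)%:Z.
Proof. by have := @mirror_extE n g q 0; rewrite !addr0; apply. Qed.

Lemma mirror_ext_neg n g q (k : nat) : (0 < k <= n)%N ->
  mirror_ext n g (q * (period n)%:Z - k%:Z) = q * (period n)%:Z - g k.
Proof.
move=> hk; have -> : q * (period n)%:Z - k%:Z = (q - 1) * (period n)%:Z + (period n - k)%N%:Z.
  by rewrite /period; lia.
rewrite mirror_extE; last by rewrite /period; lia.
rewrite ifF; last by rewrite /period; lia.
rewrite ifF; last by rewrite /period; lia.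
have -> : (period n - (period n - k) = k)%N by rewrite /period; lia.
lia.
Qed.

(** Residues are taken between [-n] and [n], so that the mirror symmetry is a change of sign. *)
Variant centered_spec (n : nat) (x : int) : Prop :=
| CenterMult q of x = q * (period n)%:Z
| CenterPos q k of (0 < k <= n)%N & x = q * (period n)%:Z + k%:Z
| CenterNeg q k of (0 < k <= n)%N & x = q * (period n)%:Z - k%:Z.

Lemma centeredP n x : centered_spec n x.
Proof.
have hN : (period n)%:Z != 0 by [].
set r := `|(x %% (period n)%:Z)%Z|%N; set q := (x %/ (period n)%:Z)%Z.
have hr : r%:Z = (x %% (period n)%:Z)%Z by rewrite /r gez0_abs // modz_ge0.
have hx : x = q * (period n)%:Z + r%:Z by rewrite hr -divz_eq.
have hlt : (r < period n)%N by rewrite -ltz_nat hr ltz_mod.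
have [r0|r0] := posnP r; first by apply: (@CenterMult _ _ q); rewrite hx r0 addr0.
have [hle|hgt] := leqP r n; first by apply: (@CenterPos _ _ q r) => //; rewrite r0.
apply: (@CenterNeg _ _ (q + 1) (period n - r)); first by move: hlt hgt; rewrite /period; lia.
by rewrite hx; lia.
Qed.

Lemma mirrored_ext n g : mirrored n (mirror_ext n g).
Proof.
split=> x.
  have e0 q : q * (period n)%:Z + (period n)%:Z = (q + 1) * (period n)%:Z by rewrite mulrDl mul1r.
  case: (centeredP n x) => [q|q k hk|q k hk] ->.
  - by rewrite e0 !mirror_ext_mult e0.
  - by rewrite addrAC e0 !mirror_ext_pos // addrAC e0.
  - by rewrite addrAC e0 !mirror_ext_neg // addrAC e0.
case: (centeredP n x) => [q|q k hk|q k hk] ->.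
- by rewrite -mulNr !mirror_ext_mult mulNr.
- by rewrite opprD -mulNr mirror_ext_neg // mirror_ext_pos // opprD mulNr.
- by rewrite opprB addrC -mulNr mirror_ext_neg // mirror_ext_pos // opprB mulNr addrC.
Qed.

(** The pair [a < b] that the generator exchanges, up to translates and mirror images. It plays the
    part of a simple root: [w b < w a] signals a right descent of [w]. *)
Definition simple_root (T : quotient_type) (n r : nat) : int * int :=
  if r == 0%N then (-1, if s0_is_D T then 2 else 1)
  else if r == n then (if sn_is_D T then n%:Z - 1 else n%:Z, n%:Z + 1)
  else (r%:Z, r%:Z + 1).

Variant refl_spec (n : nat) (s : int -> int) (a b x : int) : Prop :=
| ReflFix of s x = x
| ReflUp q of (x = q * (period n)%:Z + a \/ x = q * (period n)%:Z - b) & s x = x + (b - a)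
| ReflDown q of (x = q * (period n)%:Z + b \/ x = q * (period n)%:Z - a) & s x = x - (b - a).

Lemma mirrored_gen T n r : mirrored n (gen T n r).
Proof. exact: mirrored_ext. Qed.

Variant window_spec (n : nat) (g : nat -> int) (a b : int) (k : nat) : Prop :=
| WinFix of g k = k%:Z
| WinUp e of (k%:Z = e * (period n)%:Z + a \/ k%:Z = e * (period n)%:Z - b) & g k = k%:Z + (b - a)
| WinDown e of (k%:Z = e * (period n)%:Z + b \/ k%:Z = e * (period n)%:Z - a) & g k = k%:Z - (b - a).

Lemma refl_window n g a b : (forall k, (0 < k <= n)%N -> window_spec n g a b k) ->
  forall x, refl_spec n (mirror_ext n g) a b x.
Proof.
move=> h x; have e1 q e y : q * (period n)%:Z + (e * (period n)%:Z + y) = (q + e) * (period n)%:Z + y.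
  by rewrite mulrDl addrA.
have e2 q e y : q * (period n)%:Z - (e * (period n)%:Z + y) = (q - e) * (period n)%:Z - y.
  by rewrite mulrBl opprD addrA.
case: (centeredP n x) => [q|q k hk|q k hk] ->.
- by apply: ReflFix; rewrite mirror_ext_mult.
- case: (h k hk) => [hg|e hke hg|e hke hg].
  + by apply: ReflFix; rewrite mirror_ext_pos // hg.
  + apply: (@ReflUp _ _ _ _ _ (q + e)); last by rewrite mirror_ext_pos // hg addrA.
    by case: hke => ->; rewrite e1; [left|right].
  + apply: (@ReflDown _ _ _ _ _ (q + e)); last by rewrite mirror_ext_pos // hg addrA.
    by case: hke => ->; rewrite e1; [left|right].
- case: (h k hk) => [hg|e hke hg|e hke hg].
  + by apply: ReflFix; rewrite mirror_ext_neg // hg.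
  + apply: (@ReflDown _ _ _ _ _ (q - e)); last by rewrite mirror_ext_neg // hg; lia.
    by case: hke => ->; rewrite e2 ?opprK; [right|left].
  + apply: (@ReflUp _ _ _ _ _ (q - e)); last by rewrite mirror_ext_neg // hg; lia.
    by case: hke => ->; rewrite e2 ?opprK; [right|left].
Qed.

Lemma mirror_ext_nat n g (k : nat) : (0 < k <= n)%N -> mirror_ext n g k%:Z = g k.
Proof. by move=> hk; have := @mirror_ext_pos n g 0 k hk; rewrite mul0r !add0r. Qed.

Lemma mirror_ext_opp n g (k : nat) : (0 < k <= n)%N -> mirror_ext n g (- k%:Z) = - g k.
Proof. by move=> hk; have := @mirror_ext_neg n g 0 k hk; rewrite mul0r !add0r. Qed.

Lemma mirror_ext_mirror n g (k : nat) : (0 < k <= n)%N ->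
  mirror_ext n g (period n - k)%N%:Z = (period n)%:Z - g k.
Proof.
move=> hk; have := @mirror_ext_neg n g 1 k hk; rewrite mul1r => <-.
by congr mirror_ext; rewrite /period; lia.
Qed.

Lemma gen_root T n r : (min_rank T <= n)%N -> (r <= n)%N ->
  let a := (simple_root T n r).1 in let b := (simple_root T n r).2 in
  [/\ gen T n r a = b, gen T n r b = a & forall x, refl_spec n (gen T n r) a b x].
Proof.
move=> hn hr; have n2 : (2 <= n)%N by apply: leq_trans hn; case: T.
have n3 : sn_is_D T -> (3 <= n)%N by case: T hn => //= h _; lia.
rewrite /gen /simple_root; case: (posnP r) => [r0|r0].
  case: (boolP (s0_is_D T)) => he /=.
    split.
    - by rewrite (@mirror_ext_opp _ _ 1) //; lia.
    - by rewrite (@mirror_ext_nat _ _ 2) //; lia.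
    - apply: refl_window => k hk; rewrite /window_s0D.
      case: (eqVneq k 1%N) => [->|k1]; first by apply: (@WinDown _ _ _ _ _ 0); [right|].
      case: (eqVneq k 2%N) => [->|k2]; first by apply: (@WinDown _ _ _ _ _ 0); [left|].
      by apply: WinFix; rewrite (negbTE k1) (negbTE k2).
  split.
  - by rewrite (@mirror_ext_opp _ _ 1) //; lia.
  - by rewrite (@mirror_ext_nat _ _ 1) //; lia.
  - apply: refl_window => k hk; rewrite /window_s0C.
    case: (eqVneq k 1%N) => [->|k1]; first by apply: (@WinDown _ _ _ _ _ 0); [right|].
    by apply: WinFix; rewrite (negbTE k1).
case: (eqVneq r n) => [rn|rn].
  case: (boolP (sn_is_D T)) => he /=.
    have {}n3 := n3 he; have en : n%:Z - 1 = n.-1%:Z by lia.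
    have en1 : n%:Z + 1 = (period n - n)%N%:Z by rewrite /period; lia.
    have w1 : window_snD n n.-1 = n.+1%:Z by rewrite /window_snD eqxx.
    have w2 : window_snD n n = n.+2%:Z.
      by rewrite /window_snD eqxx ifF //; lia.
    split.
    - by rewrite en mirror_ext_nat ?w1; lia.
    - by rewrite en1 mirror_ext_mirror ?w2 /period; lia.
    - apply: refl_window => k hk.
      case: (eqVneq k n.-1) => [->|k1]; first by apply: (@WinUp _ _ _ _ _ 0); [left; lia|rewrite w1; lia].
      case: (eqVneq k n) => [->|k2]; first by apply: (@WinUp _ _ _ _ _ 1); [right; rewrite /period; lia|rewrite w2; lia].
      by apply: WinFix; rewrite /window_snD (negbTE k1) (negbTE k2).
  have en1 : n%:Z + 1 = (period n - n)%N%:Z by rewrite /period; lia.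
  have w2 : window_snC n n = n.+1%:Z by rewrite /window_snC eqxx.
  split.
  - by rewrite mirror_ext_nat ?w2; lia.
  - by rewrite en1 mirror_ext_mirror ?w2 /period; lia.
  - apply: refl_window => k hk.
    case: (eqVneq k n) => [->|k2]; first by apply: (@WinUp _ _ _ _ _ 0); [left; lia|rewrite w2; lia].
    by apply: WinFix; rewrite /window_snC (negbTE k2).
have e1 : r%:Z + 1 = r.+1%:Z by lia.
have w1 : window_s r r = r.+1%:Z by rewrite /window_s eqxx.
have w2 : window_s r r.+1 = r%:Z by rewrite /window_s eqxx ifF //; lia.
split=> /=.
- by rewrite mirror_ext_nat ?w1; lia.
- by rewrite e1 mirror_ext_nat ?w2; lia.
- apply: refl_window => k hk.
  case: (eqVneq k r) => [->|k1]; first by apply: (@WinUp _ _ _ _ _ 0); [left; lia|rewrite w1; lia].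
  case: (eqVneq k r.+1) => [->|k2]; first by apply: (@WinDown _ _ _ _ _ 0); [left; lia|rewrite w2; lia].
  by apply: WinFix; rewrite /window_s (negbTE k1) (negbTE k2).
Qed.

Lemma gen_root_class T n r : (min_rank T <= n)%N -> (r <= n)%N ->
  let a := (simple_root T n r).1 in let b := (simple_root T n r).2 in let N := (period n)%:Z in
  forall q : int, [/\ gen T n r (q * N + a) = q * N + b, gen T n r (q * N + b) = q * N + a,
    gen T n r (q * N - a) = q * N - b & gen T n r (q * N - b) = q * N - a].
Proof.
move=> hn hr a b N q; have [ga gb _] := gen_root hn hr.
have hm := mirrored_gen T n r; have [_ ho] := hm.
by split; rewrite mirrored_shift // ?ho ?ga ?gb.
Qed.

Lemma gen_involutive T n r : (min_rank T <= n)%N -> (r <= n)%N -> involutive (gen T n r).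
Proof.
move=> hn hr x; have [_ _ hx] := gen_root hn hr.
have hc := gen_root_class hn hr; case: (hx x) => [h|q hq hs|q hq hs]; first by rewrite !h.
  by have [h1 h2 h3 h4] := hc q; case: hq => ->; rewrite ?h1 ?h2 ?h4 ?h3.
by have [h1 h2 h3 h4] := hc q; case: hq => ->; rewrite ?h2 ?h1 ?h3 ?h4.
Qed.

(* The pairs (x, y) such that exchanging x and y, together with their mirror
   images and translates, is a reflection of the affine group of type T. *)
Definition is_root (T : quotient_type) (n : nat) (x y : int) : Prop :=
  let N := (period n)%:Z in
  [/\ forall q : int, x <> q * N, forall q : int, y <> q * N,
      s0_is_D T -> forall q : int, x + y <> (2 * q) * N
    & sn_is_D T -> forall q : int, x + y <> (2 * q + 1) * N].

(** Distinct multiples of [N] are at least [N] apart; in this form the fact is usable by linear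
    arithmetic although [q * N] is not linear. *)
Lemma mul_trichotomy (q q' N : int) : 0 < N ->
  [\/ q = q', q * N + N <= q' * N | q' * N + N <= q * N].
Proof.
move=> hN; case: (ltgtP q q') => h; [apply: Or32|apply: Or33|exact: Or31].
  by rewrite -{2}[N]mul1r -mulrDl ler_wpM2r //; lia.
by rewrite -{2}[N]mul1r -mulrDl ler_wpM2r //; lia.
Qed.

(** A simple reflection makes only its own positive root negative. The exclusions in [is_root]
    matter: $s_0^D$ also reverses pairs such as $(-1, 1)$, and $s_n^D$ pairs such as $(n, n+1)$,
    which it does not exchange. *)
Lemma gen_inversion T n r x y : (min_rank T <= n)%N -> (r <= n)%N ->
  is_root T n x y -> x < y -> gen T n r y < gen T n r x -> gen T n r x = y.
Proof.
move=> hn hr [vx vy v0 v1] hxy hlt; have [_ _ hx] := gen_root hn hr.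
have n2 : (2 <= n)%N by apply: leq_trans hn; case: (T).
have hc := gen_root_class hn hr.
move: (hx x) (hx y) hc hlt; set s := gen T n r; rewrite /simple_root.
case: (posnP r) => [r0|r0].
  case: (boolP (s0_is_D T)) => he /= Hx Hy hc hlt; last first.
    set N := (period n)%:Z in vx vy Hx Hy hc *; have hN : 4 < N by rewrite /N /period; lia.
    case: Hx => [ex|q ex sx|q ex sx]; case: Hy => [ey|q' ey sy|q' ey sy]; try lia.
    - by exfalso; move: (vx q') (vy q'); lia.
    - by exfalso; move: (vx q) (vy q); lia.
    - case: (mul_trichotomy q q' (isT : 0 < N)); lia.
  have n3 : (3 <= n)%N by move: hn he; case: (T) => //= h _; lia.
  set N := (period n)%:Z in vx vy v0 Hx Hy hc *; have hN : 6 < N by rewrite /N /period; lia.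
  have F z (q : int) : [/\ z = q * N - 1 -> s z = q * N + 2, z = q * N + 2 -> s z = q * N - 1,
     z = q * N + 1 -> s z = q * N - 2 & z = q * N - 2 -> s z = q * N + 1].
    by have [h1 h2 h3 h4] := hc q; rewrite !opprK in h3 h4; split=> ->.
  case: Hx => [ex|q ex sx|q ex sx]; case: Hy => [ey|q' ey sy|q' ey sy]; try lia.
  - by exfalso; move: (vx q') (F x q') => ? []; lia.
  - by exfalso; move: (vy q) (F y q) => ? []; lia.
  - by move: (v0 he q); case: (mul_trichotomy q q' (isT : 0 < N)) => [e|e|e]; rewrite ?e; lia.
have hN : (period n)%:Z = 2 * n%:Z + 1 by rewrite /period; lia.
case: (eqVneq r n) => [rn|rn].
  case: (boolP (sn_is_D T)) => he /= Hx Hy hc hlt; last first.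
    by case: Hx => [ex|q ex sx|q ex sx]; case: Hy => [ey|q' ey sy|q' ey sy]; lia.
  set N := (period n)%:Z in vx vy v1 Hx Hy hc hN *.
  have n3 : (3 <= n)%N by move: hn he; case: (T) => //= h _; lia.
  have F z (q : int) : [/\ z = q * N + n%:Z - 1 -> s z = q * N + n%:Z + 1,
     z = q * N + n%:Z + 1 -> s z = q * N + n%:Z - 1,
     z = q * N + n%:Z -> s z = q * N + n%:Z + 2 & z = q * N + n%:Z + 2 -> s z = q * N + n%:Z].
    have [h1 h2 _ _] := hc q; have [_ _ h3 h4] := hc (q + 1).
    split=> ->.
    - by rewrite -addrA h1; lia.
    - by rewrite -addrA h2; lia.
    - have -> : q * N + n%:Z = (q + 1) * N - (n%:Z + 1) by lia.
      by rewrite h4; lia.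
    - have -> : q * N + n%:Z + 2 = (q + 1) * N - (n%:Z - 1) by lia.
      by rewrite h3; lia.
  have Hx' : refl_spec n s (n%:Z - 1) (n%:Z + 1) x := Hx.
  (* The mirrored classes are rewritten around the label [n], using
     [q * N - (n + 1) = (q - 1) * N + n]. *)
  have up z : refl_spec n s (n%:Z - 1) (n%:Z + 1) z ->
    [\/ s z = z, exists2 q : int, s z = z + 2 & z = q * N + n%:Z - 1 \/ z = q * N + n%:Z
      | exists2 q : int, s z = z - 2 & z = q * N + n%:Z + 1 \/ z = q * N + n%:Z + 2].
    case=> [|q ez sz|q ez sz]; first by move=> ?; apply: Or31.
      apply: Or32; rewrite sz; case: ez => ->; [exists q; first lia; left; lia|].
      by exists (q - 1); [lia|right; lia].
    apply: Or33; rewrite sz; case: ez => ->; [exists q; first lia; left; lia|].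
    by exists (q - 1); [lia|right; lia].
  move: (up x Hx) (up y Hy) => {}Hx {}Hy.
  case: Hx => [ex|[q sx ex]|[q sx ex]]; case: Hy => [ey|[q' sy ey]|[q' sy ey]]; try lia.
  - by exfalso; move: (F x q') => []; lia.
  - by exfalso; move: (F y q) => []; lia.
  - by move: (v1 he q); case: (mul_trichotomy q q' (isT : 0 < N)) => [e|e|e]; rewrite ?e; lia.
by move=> /= Hx Hy hc hlt; case: Hx => [ex|q ex sx|q ex sx]; case: Hy => [ey|q' ey sy|q' ey sy]; lia.
Qed.

Lemma refl_moved n s a b x : refl_spec n s a b x -> s x <> x ->
  exists q : int, let N := (period n)%:Z in
    [\/ x = q * N + a, x = q * N + b, x = q * N - a | x = q * N - b].
Proof.
case=> [//|q [] -> _ _|q [] -> _ _]; exists q.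
- exact: Or41.
- exact: Or44.
- exact: Or42.
- exact: Or43.
Qed.

Lemma class_change (N q q' a b x y z : int) :
  [\/ z = q * N + a, z = q * N + b, z = q * N - a | z = q * N - b] ->
  [\/ x = q' * N + a /\ y = q' * N + b, x = q' * N + b /\ y = q' * N + a,
      x = q' * N - a /\ y = q' * N - b | x = q' * N - b /\ y = q' * N - a] ->
  exists p : int, [\/ z = p * N + x, z = p * N + y, z = p * N - x | z = p * N - y].
Proof.
case=> ->; case=> -[-> ->];
  first [exists (q - q');
    first [apply: Or41; lia|apply: Or42; lia|apply: Or43; lia|apply: Or44; lia]
  |exists (q + q');
    first [apply: Or41; lia|apply: Or42; lia|apply: Or43; lia|apply: Or44; lia]].
Qed.

(** The conjugate of the left generator by [u] exchanges [a] and [b], hence agrees with [gen T n k]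
    on their whole class. Elsewhere it is the identity: if [u x] were moved, it would lie in the
    same class as [u a] and [u b], which would put [x] in the class of [a] and [b]. *)
Lemma gen_conj T n r k u : (min_rank T <= n)%N -> (r <= n)%N -> (k <= n)%N ->
  mirrored n u -> injective u ->
  let a := (simple_root T n k).1 in let b := (simple_root T n k).2 in
  gen T n r (u a) = u b -> gen T n r \o u = u \o gen T n k.
Proof.
move=> hn hr hk hu uI a b hab; have [ga gb hx] := gen_root hn hk.
have [_ _ hy] := gen_root hn hr.
rewrite -/a -/b in ga gb hx.
have hg := mirrored_gen T n r; have [_ go] := hg; have [_ uo] := hu.
have hc := gen_root_class hn hk; have hc' := gen_root_class hn hr.
rewrite -/a -/b in hc; set N := (period n)%:Z in hc hc'.
have hba : gen T n r (u b) = u a by rewrite -hab gen_involutive.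
have hcl x (q : int) : [\/ x = q * N + a, x = q * N + b, x = q * N - a | x = q * N - b] ->
    gen T n r (u x) = u (gen T n k x).
  have [c1 c2 c3 c4] := hc q.
  case=> ->.
  - by rewrite c1 !(mirrored_shift q _ hu) (mirrored_shift q _ hg) hab.
  - by rewrite c2 !(mirrored_shift q _ hu) (mirrored_shift q _ hg) hba.
  - by rewrite c3 !(mirrored_shift q _ hu) !uo (mirrored_shift q _ hg) go hab.
  - by rewrite c4 !(mirrored_shift q _ hu) !uo (mirrored_shift q _ hg) go hba.
apply: funext => x /=; case: (eqVneq (gen T n k x) x) => [hfix|/eqP hmv]; last first.
  by have [q hq] := refl_moved (hx x) hmv; apply: hcl hq.
rewrite hfix; apply: contrapT => hmv.
have [q hq] := refl_moved (hy _) hmv.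
have hne : a <> b.
  by rewrite /a /b /simple_root; case: ifP => _ /=; case: ifP => // _ /=; try case: ifP => _ /=; lia.
have hA : gen T n r (u a) <> u a by rewrite hab => /uI e; apply: hne.
have [q' hq'] := refl_moved (hy _) hA.
set a' := (simple_root T n r).1 in hq hq' hc'; set b' := (simple_root T n r).2 in hq hq' hc'.
have {}hq' : [\/ u a = q' * N + a' /\ u b = q' * N + b', u a = q' * N + b' /\ u b = q' * N + a',
    u a = q' * N - a' /\ u b = q' * N - b' | u a = q' * N - b' /\ u b = q' * N - a'].
  have [c1 c2 c3 c4] := hc' q'; rewrite -hab; case: hq' => e; rewrite e.
  - by apply: Or41; rewrite c1.
  - by apply: Or42; rewrite c2.
  - by apply: Or43; rewrite c3.
  - by apply: Or44; rewrite c4.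
have [p hp] := class_change hq hq'.
have {}hp : [\/ x = p * N + a, x = p * N + b, x = p * N - a | x = p * N - b].
  rewrite -!uo -!(mirrored_shift p _ hu) in hp.
  by case: hp => /uI; [exact: Or41|exact: Or42|exact: Or43|exact: Or44].
(* A point of this class that is fixed by [gen T n k] would force [a = b]. *)
apply: hne; have [c1 c2 c3 c4] := hc p.
case: hp hfix => ->; rewrite ?c1 ?c2 ?c3 ?c4.
- by move=> /addrI.
- by move=> /addrI.
- by move=> /addrI /oppr_inj.
- by move=> /addrI /oppr_inj.
Qed.

(** * The exchange property *)

Lemma is_root_image T n u x y : mirrored n u -> injective u ->
  is_root T n x y -> is_root T n (u x) (u y).
Proof.
move=> hu uI [hx hy h0 h1]; have [_ uo] := hu.
have hsum q : u x + u y = q * (period n)%:Z -> x + y = q * (period n)%:Z.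
  move=> e; have {e} : u y = q * (period n)%:Z + u (- x) by rewrite uo -e; lia.
  by rewrite -(mirrored_shift q _ hu) => /uI ->; lia.
split.
- by move=> q; rewrite -(mirrored_mult q hu) => /uI; apply: hx.
- by move=> q; rewrite -(mirrored_mult q hu) => /uI; apply: hy.
- by move=> he q /hsum; apply: h0.
- by move=> he q /hsum; apply: h1.
Qed.

Lemma simple_is_root T n k : (min_rank T <= n)%N -> (0 < k <= n)%N ->
  is_root T n (simple_root T n k).1 (simple_root T n k).2.
Proof.
move=> hn hk; have n2 : (2 <= n)%N by apply: leq_trans hn; case: (T).
have hN : (period n)%:Z = 2 * n%:Z + 1 by rewrite /period; lia.
have N0 : 0 < (period n)%:Z by [].
have n3 : sn_is_D T -> (3 <= n)%N by move: hn; case: (T) => //= h _; lia.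
have t0 q := mul_trichotomy q 0 N0; have t1 q := mul_trichotomy q 1 N0.
have h0 z : 0 < z < (period n)%:Z -> forall q : int, z <> q * (period n)%:Z.
  by move=> hz q; case: (t0 q) => [->|h|h]; case: (t1 q) => [e|h'|h']; lia.
have heven z : z = 2 * n%:Z -> forall q : int, z <> (2 * q) * (period n)%:Z.
  by move=> hz q hq; apply: (h0 n%:Z _ q); lia.
have hodd z (m : int) : z = 2 * m + 1 -> forall q : int, z <> (2 * q) * (period n)%:Z.
  by move=> -> q; lia.
have hodd' z (m : int) : z = 2 * m -> forall q : int, z <> (2 * q + 1) * (period n)%:Z.
  by move=> -> q; clear -hN; lia.
rewrite /simple_root ifF; last by lia.
case: (eqVneq k n) => [kn|kn].
  case: (boolP (sn_is_D T)) => he /=.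
    have {}n3 := n3 he; split => [||_|_].
    - by apply: h0; lia.
    - by apply: h0; lia.
    - by apply: heven; lia.
    - by apply: (hodd' _ n%:Z); lia.
  split => [||_|h].
  - by apply: h0; lia.
  - by apply: h0; lia.
  - by apply: (hodd _ n%:Z); lia.
  - by rewrite h in he.
split => [||_|_] /=.
- by apply: h0; lia.
- by apply: h0; lia.
- by apply: (hodd _ k%:Z); lia.
- move=> q hq; apply: (h0 (k%:Z + (k%:Z + 1)) _ (2 * q + 1)) => //; lia.
Qed.

Lemma simple_lt T n k : (simple_root T n k).1 < (simple_root T n k).2.
Proof. by rewrite /simple_root; case: ifP => _ /=; case: ifP => // _ /=; try case: ifP => _ /=; lia. Qed.

Lemma mirrored_word T n s : mirrored n (word_prod T n s).
Proof. by elim: s => [|i s IH] //=; apply: mirrored_comp IH; exact: mirrored_gen. Qed.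

Lemma bij_word T n s : (min_rank T <= n)%N -> all (fun i => i <= n)%N s -> bijective (word_prod T n s).
Proof.
move=> hn; elim: s => [_|i s IH /= /andP[hi /IH hs]]; first by exists id.
by apply: bij_comp hs; exists (gen T n i); exact: gen_involutive.
Qed.

(** Reading the word from the right, some first letter reverses the images of the simple root. By
    [gen_inversion] it exchanges them, and [gen_conj] turns this letter into [gen T n k] on the
    right, where it cancels; deleting it gives the shorter word. *)
Lemma exchange T n s k : (min_rank T <= n)%N -> (0 < k <= n)%N -> all (fun i => i <= n)%N s ->
  word_prod T n s (simple_root T n k).2 < word_prod T n s (simple_root T n k).1 ->
  exists s', [/\ all (fun i => i <= n)%N s', (size s' < size s)%N
    & word_prod T n s' = word_prod T n s \o gen T n k].
Proof.
move=> hn hk; set a := (simple_root T n k).1; set b := (simple_root T n k).2.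
elim: s => [_|i s IH /= /andP[hi hs] hlt].
  by rewrite /= ltNge ltW // simple_lt.
have uB := bij_word hn hs; have uI := bij_inj uB; have hu := mirrored_word T n s.
have [/(IH hs) [s' [h1 h2 h3]]|hle] := ltP (word_prod T n s b) (word_prod T n s a).
  by exists (i :: s'); split=> //=; rewrite ?hi // h3 compA.
have hab : a <> b by have := simple_lt T n k; rewrite -/a -/b; lia.
have hlt' : word_prod T n s a < word_prod T n s b.
  by rewrite lt_neqAle hle andbT; apply/eqP => /uI.
have hr := is_root_image hu uI (simple_is_root hn hk).
have e := gen_inversion hn hi hr hlt' hlt.
have hkn : (k <= n)%N by case/andP: hk.
exists s; split=> //; rewrite (gen_conj hn hi hkn hu uI e) -compA.
by apply: funext => x /=; rewrite gen_involutive.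
Qed.

(** * Levels of mirrored permutations *)

(* The level of the lowest bead on runner j, 1 <= j <= 2n. *)
Definition level (c : seq int) (j : nat) : int :=
  if (j <= size c)%N then c`_j.-1 else - c`_(2 * size c - j).

Lemma pbead_level c m j : (0 < j < period (size c))%N ->
  pbead c (m * period (size c) + j)%N = (m%:Z < level c j).
Proof. by move=> h; rewrite pbeadE // /level; case: ifP. Qed.

Lemma level_mirror c j : (0 < j < period (size c))%N ->
  level c (period (size c) - j) = - level c j.
Proof.
rewrite /period => h; rewrite /level; case: leqP => h1; case: leqP => h2; try lia.
- by rewrite opprK; congr (c`_ _); lia.
- by congr (- c`_ _); lia.
Qed.

(** Only the runners up to [n] are recorded, since the mirror symmetry gives the others
    ([levels_full]); the window index [k] still ranges over all [2 * n] positions. *)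
Definition has_levels (n : nat) (w : int -> int) (c : seq int) : Prop :=
  size c = n /\ forall j, (0 < j <= n)%N ->
    exists2 k, (0 < k < period n)%N & w k%:Z = c`_j.-1 * (period n)%:Z + j%:Z.

Lemma levels_full n w c j : mirrored n w -> has_levels n w c -> (0 < j < period n)%N ->
  exists2 k, (0 < k < period n)%N & w k%:Z = level c j * (period n)%:Z + j%:Z.
Proof.
move=> hw [hc hl] hj; have [hle|hgt] := leqP j n.
  have [|k hk e] := hl j; first by lia.
  by exists k => //; rewrite e /level hc hle.
have [|k hk e] := hl (period n - j)%N; first by rewrite /period in hj *; lia.
exists (period n - k)%N; first by rewrite /period in hk *; lia.
have [_ wo] := hw; have := mirrored_shift 1 (- k%:Z) hw; rewrite wo e mul1r.
have -> : (period n)%:Z - k%:Z = (period n - k)%N%:Z by lia.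
move=> ->; rewrite /level hc leqNgt hgt /=.
have -> : (2 * n - j = (period n - j).-1)%N by rewrite /period; lia.
by rewrite mulNr; lia.
Qed.

Lemma int_runner n (x : int) : exists q r, (r < period n)%N /\ x = q * (period n)%:Z + r%:Z.
Proof.
have hN : (period n)%:Z != 0 by [].
exists (x %/ (period n)%:Z)%Z, `|(x %% (period n)%:Z)%Z|%N; split.
  by rewrite -ltz_nat gez0_abs ?modz_ge0 // ltz_mod.
by rewrite gez0_abs ?modz_ge0 // -divz_eq.
Qed.

Lemma runner_inj n (q q' : int) r r' : (r < period n)%N -> (r' < period n)%N ->
  q * (period n)%:Z + r%:Z = q' * (period n)%:Z + r'%:Z -> q = q' /\ r = r'.
Proof.
move=> hr hr' e; have N0 : 0 < (period n)%:Z by [].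
by case: (mul_trichotomy q q' N0) => h; [subst q'|lia|lia]; split=> //; lia.
Qed.

Lemma levels_at n w c j : mirrored n w -> injective w -> has_levels n w c -> (0 < j < period n)%N ->
  exists2 k, (0 < k < period n)%N & forall i q,
    (w i = q * (period n)%:Z + j%:Z <-> i = (q - level c j) * (period n)%:Z + k%:Z).
Proof.
move=> hw wI hl hj; have [k hk e] := levels_full hw hl hj.
have he q : w ((q - level c j) * (period n)%:Z + k%:Z) = q * (period n)%:Z + j%:Z.
  by rewrite (mirrored_shift _ _ hw) e; lia.
by exists k => // i q; split=> [ei|->//]; apply: wI; rewrite he.
Qed.

Lemma levels_values n w c k : mirrored n w -> injective w -> has_levels n w c ->
  (0 < k < period n)%N ->
  exists2 j, (0 < j < period n)%N & w k%:Z = level c j * (period n)%:Z + j%:Z.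
Proof.
move=> hw wI hl hk; have [q [j [hj e]]] := int_runner n (w k%:Z).
have j0 : (0 < j)%N.
  rewrite lt0n; apply/eqP => j0; move: e; rewrite j0 addr0 -(mirrored_mult q hw) => /wI e.
  have [] := @runner_inj n 0 q k 0; rewrite ?mul0r ?add0r ?addr0 //; lia.
have hj' : (0 < j < period n)%N by rewrite j0.
have [k' hk' /(_ k%:Z q) [h _]] := levels_at hw wI hl hj'.
have := h e; rewrite -[k%:Z]add0r -(mul0r (period n)%:Z) => e'.
have [||hq _] := runner_inj _ _ e'; [lia|lia|].
by exists j => //; rewrite e; congr (_ * _ + _); lia.
Qed.

Lemma levels_exist n w : mirrored n w -> bijective w -> exists c, has_levels n w c.
Proof.
(* If [g j = q N + r], then [w r = j - q N], so the level on runner [j] is [- q]. *)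
move=> hw [g gw wg]; exists (mkseq (fun i => - (g i.+1%:Z %/ (period n)%:Z)%Z) n).
split=> [|j hj]; first by rewrite size_mkseq.
rewrite nth_mkseq ?prednK; try lia.
have [q [r [hr e]]] := int_runner n (g j%:Z).
exists r; first last.
  have := wg j%:Z; rewrite e (mirrored_shift _ _ hw) divzMDl // divz_small ?addr0; first by lia.
  by rewrite lez_nat ltz_nat.
rewrite hr andbT lt0n; apply/eqP => r0; have := wg j%:Z; rewrite e r0 addr0 (mirrored_mult _ hw) => e'.
have hj' : (j < period n)%N by rewrite /period; lia.
have := @runner_inj n q 0 0 j isT hj'; rewrite mul0r addr0 add0r => /(_ e') [_ j0]; lia.
Qed.

Lemma beadE n w c q j : mirrored n w -> injective w -> has_levels n w c -> (0 < j < period n)%N ->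
  bead n w (q * (period n)%:Z + j%:Z) = (q <= level c j).
Proof.
move=> hw wI hl hj; have N0 : 0 < (period n)%:Z by [].
apply/hasP/idP => [[k]|hq].
  rewrite mem_iota => hk /andP[hle /eqP hmod].
  have hk' : (0 < k < period n)%N by rewrite /period; lia.
  have [j' hj' e] := levels_values hw wI hl hk'; rewrite e in hle hmod.
  have ej : j' = j.
    move: hmod; rewrite !modzMDl !modz_small ?lez_nat ?ltz_nat; lia.
  move: hle; rewrite ej => hle.
  by rewrite lerD2r ler_pM2r in hle.
have [k hk e] := levels_full hw hl hj; exists k; first by rewrite mem_iota /period in hk *; lia.
rewrite e !modzMDl eqxx andbT.
by rewrite lerD2r ler_pM2r.
Qed.

(** The product of the generator and [w] takes the value [x N + i] where [w] takes [x N + gen i].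
    With [gen i = q N + j], this is the lowest bead of runner [j] for [x = level c j - q]. *)
Definition act (T : quotient_type) (n r : nat) (c : seq int) : seq int :=
  mkseq (fun i => let y := gen T n r i.+1%:Z in
    level c `|(y %% (period n)%:Z)%Z|%N - (y %/ (period n)%:Z)%Z) n.

Lemma nth_act T n r c i q j : (i < n)%N -> (0 < j < period n)%N ->
  gen T n r i.+1%:Z = q * (period n)%:Z + j%:Z -> (act T n r c)`_i = level c j - q.
Proof.
move=> hi hj e; rewrite nth_mkseq //= e modzMDl divzMDl // divz_small ?lez_nat ?ltz_nat; last by case/andP: hj.
by rewrite modz_small ?lez_nat ?ltz_nat ?addr0 //; case/andP: hj.
Qed.

Lemma levels_act T n r w c : (min_rank T <= n)%N -> (r <= n)%N -> mirrored n w ->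
  has_levels n w c -> has_levels n (gen T n r \o w) (act T n r c).
Proof.
move=> hn hr hw hl; have hm := mirrored_gen T n r; have gK := gen_involutive hn hr.
split=> [|j hj]; first by rewrite size_mkseq.
have [q [j' [hj' e]]] := int_runner n (gen T n r j%:Z).
have j0 : (0 < j')%N.
  rewrite lt0n; apply/eqP => j0; have := gK j%:Z.
  rewrite e j0 addr0 (mirrored_mult _ hm) => e'.
  have hjn : (j < period n)%N by rewrite /period; lia.
  have := @runner_inj n q 0 0 j isT hjn; rewrite mul0r addr0 add0r => /(_ e') [_ e0]; lia.
have hj2 : (0 < j' < period n)%N by rewrite j0.
have [k hk ek] := levels_full hw hl hj2; exists k => //=.
have hj1 : (j.-1 < n)%N by lia.
rewrite (@nth_act _ _ _ _ _ q j') //; last by rewrite prednK //; case/andP: hj.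
rewrite ek -[j'%:Z](addrK (q * (period n)%:Z)) [j'%:Z + _]addrC -e.
have -> : level c j' * (period n)%:Z + (gen T n r j%:Z - q * (period n)%:Z) =
   (level c j' - q) * (period n)%:Z + gen T n r j%:Z by lia.
by rewrite (mirrored_shift _ _ hm) gK.
Qed.

Lemma runner_pos (N q z : int) : 0 < z < N -> (0 < q * N + z) = (0 <= q).
Proof.
move=> hz; have N0 : 0 < N by lia.
by case: (mul_trichotomy q 0 N0) => h; apply/idP/idP => h'; try lia;
  rewrite -(ler_pM2r N0); lia.
Qed.

(** For [k >= 1] both members of the simple root lie strictly between 0 and [N], so the generator
    permutes each block between consecutive multiples of [N]. Hence multiplication on the right by
    the finite group permutes the window and keeps the levels. *)
Lemma gen_pos T n k y : (min_rank T <= n)%N -> (0 < k <= n)%N ->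
  (0 < gen T n k y) = (0 < y).
Proof.
move=> hn hk; have hkn : (k <= n)%N by case/andP: hk.
have n2 : (2 <= n)%N by apply: leq_trans hn; case: (T).
have [_ _ /(_ y)] := gen_root hn hkn.
have : 0 < (simple_root T n k).1 < (period n)%:Z /\ 0 < (simple_root T n k).2 < (period n)%:Z.
  rewrite /simple_root /period ifF; last by lia.
  by case: ifP => _ /=; try (case: ifP => _ /=); lia.
move: (simple_root T n k) => [a b] /= [ha hb].
have ha' : 0 < (period n)%:Z - a < (period n)%:Z by lia.
have hb' : 0 < (period n)%:Z - b < (period n)%:Z by lia.
have e q z : q * (period n)%:Z - z = (q - 1) * (period n)%:Z + ((period n)%:Z - z) by lia.
case=> [->//|q [] ey ->|q [] ey ->]; rewrite ey.
- have -> : q * (period n)%:Z + a + (b - a) = q * (period n)%:Z + b by lia.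
  by rewrite !runner_pos.
- have -> : q * (period n)%:Z - b + (b - a) = q * (period n)%:Z - a by lia.
  by rewrite !e !runner_pos.
- have -> : q * (period n)%:Z + b - (b - a) = q * (period n)%:Z + a by lia.
  by rewrite !runner_pos.
- have -> : q * (period n)%:Z - a - (b - a) = q * (period n)%:Z - b by lia.
  by rewrite !e !runner_pos.
Qed.

Lemma levels_right T n k w c : (min_rank T <= n)%N -> (0 < k <= n)%N ->
  has_levels n w c -> has_levels n (w \o gen T n k) c.
Proof.
move=> hn hk [hc hl]; split=> // j hj; have [i hi e] := hl j hj.
have hkn : (k <= n)%N by case/andP: hk.
have gK := gen_involutive hn hkn; have [_ _ gx] := gen_root hn hkn.
have N0 : 0 < (period n)%:Z by [].
have [_ go] := mirrored_gen T n k; have gs := mirrored_shift 1 _ (mirrored_gen T n k).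
have h0 : 0 < gen T n k i%:Z by rewrite gen_pos //; lia.
have h1 : gen T n k i%:Z < (period n)%:Z.
  have := gen_pos ((period n)%:Z - i%:Z) hn hk; have := gs (- i%:Z).
  by rewrite go mul1r => ->; lia.
exists `|gen T n k i%:Z|%N; first by lia.
rewrite /= gtz0_abs // gK e //.
Qed.

(** * Explicit action of the generators on levels *)

Lemma act_at T n r c i q j x : (i < n)%N -> (0 < j < period n)%N ->
  gen T n r i.+1%:Z = q * (period n)%:Z + j%:Z -> level c j - q = x -> (act T n r c)`_i = x.
Proof. by move=> hi hj e <-; exact: nth_act. Qed.

Lemma act_fix T n r c i : (i < n)%N -> size c = n -> gen T n r i.+1%:Z = i.+1%:Z ->
  (act T n r c)`_i = c`_i.
Proof.
move=> hi hc e; apply: (@act_at _ _ _ _ _ 0 i.+1) => //.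
- by rewrite /period; lia.
- by rewrite /level hc hi /=; lia.
Qed.

Lemma nth_cat2 (s1 s2 : seq int) i : (s1 ++ s2)`_(size s1 + i) = s2`_i.
Proof. by rewrite nth_cat ltnNge leq_addr /= addKn. Qed.

Lemma act_swap T n (s1 : seq int) (a b : int) (s2 : seq int) : size (s1 ++ a :: b :: s2) = n ->
  act T n (size s1).+1 (s1 ++ a :: b :: s2) = s1 ++ b :: a :: s2.
Proof.
move=> hs; have hs' : (size s1 + (size s2).+2 = n)%N by rewrite -hs size_cat.
set m := size s1 in hs' *.
apply: (@eq_from_nth _ 0); first by rewrite size_mkseq -hs !size_cat.
rewrite size_mkseq => i hi.
have hg k : (0 < k <= n)%N -> gen T n m.+1 k%:Z = window_s m.+1 k.
  move=> hk; rewrite /gen mirror_ext_nat //= ifF //; lia.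
have e0 : (s1 ++ [:: a, b & s2])`_m = a by rewrite -[m]addn0 nth_cat2.
have e1 : (s1 ++ [:: a, b & s2])`_m.+1 = b by rewrite -addn1 nth_cat2.
have e0' : (s1 ++ [:: b, a & s2])`_m = b by rewrite -[m]addn0 nth_cat2.
have e1' : (s1 ++ [:: b, a & s2])`_m.+1 = a by rewrite -addn1 nth_cat2.
case: (eqVneq i m) => [->|im].
  rewrite e0'; apply: (@act_at _ _ _ _ _ 0 m.+2); try (rewrite /period; lia).
    by rewrite hg /window_s ?eqxx; lia.
  by rewrite /level hs ifT /= ?e1; lia.
case: (eqVneq i m.+1) => [->|im'].
  rewrite e1'; apply: (@act_at _ _ _ _ _ 0 m.+1); try (rewrite /period; lia).
    by rewrite hg /window_s ?eqxx; try lia; rewrite ifF; lia.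
  by rewrite /level hs ifT /= ?e0; lia.
rewrite act_fix //; last first.
  by rewrite hg /window_s; try lia; rewrite ifF ?ifF; lia.
rewrite !nth_cat -/m; case: ltnP => // h.
by case: (i - m)%N (subnK h) => [|[|k]] //=; lia.
Qed.

Lemma act_0C T n (a : int) (s : seq int) : ~~ s0_is_D T -> size (a :: s) = n ->
  act T n 0 (a :: s) = (1 - a) :: s.
Proof.
move=> /negbTE he hs; have hs' : (size s).+1 = n by [].
apply: (@eq_from_nth _ 0); first by rewrite size_mkseq -hs.
rewrite size_mkseq => i hi.
have hg k : (0 < k <= n)%N -> gen T n 0 k%:Z = window_s0C k.
  by move=> hk; rewrite /gen mirror_ext_nat //= he.
case: i hi => [|i] hi.
  apply: (@act_at _ _ _ _ _ (-1) (2 * n)); rewrite /period; try lia.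
    by rewrite hg // /window_s0C eqxx; lia.
  rewrite /level hs; case: leqP => h /=; first by lia.
  by rewrite subnn /=; lia.
by rewrite act_fix // hg // /window_s0C ifF.
Qed.

Lemma act_0D T n (a b : int) (s : seq int) : s0_is_D T -> size (a :: b :: s) = n ->
  act T n 0 (a :: b :: s) = (1 - b) :: (1 - a) :: s.
Proof.
move=> he hs; have hs' : (size s).+2 = n by [].
apply: (@eq_from_nth _ 0); first by rewrite size_mkseq -hs.
rewrite size_mkseq => i hi.
have hg k : (0 < k <= n)%N -> gen T n 0 k%:Z = window_s0D k.
  by move=> hk; rewrite /gen mirror_ext_nat //= he.
case: i hi => [|[|i]] hi.
- apply: (@act_at _ _ _ _ _ (-1) (2 * n).-1); rewrite /period; try lia.
    by rewrite hg // /window_s0D eqxx; lia.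
  rewrite /level hs; case: leqP => h /=; first by lia.
  have -> : (2 * n - (2 * n).-1 = 1)%N by lia.
  by rewrite /=; lia.
- apply: (@act_at _ _ _ _ _ (-1) (2 * n)); rewrite /period; try lia.
    by rewrite hg // /window_s0D /=; lia.
  rewrite /level hs; case: leqP => h /=; first by lia.
  by rewrite subnn /=; lia.
by rewrite act_fix // hg.
Qed.

Lemma act_nC T n (s : seq int) (a : int) : ~~ sn_is_D T -> size (s ++ [:: a]) = n ->
  act T n n (s ++ [:: a]) = s ++ [:: - a].
Proof.
move=> /negbTE he hs; have hs' : n = (size s).+1 by rewrite -hs size_cat addn1.
apply: (@eq_from_nth _ 0); first by rewrite size_mkseq -hs !size_cat.
rewrite size_mkseq => i hi.
have hg k : (0 < k <= n)%N -> gen T n n k%:Z = window_snC n k.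
  by move=> hk; rewrite /gen mirror_ext_nat // hs' /= eqxx he.
have e0 : (s ++ [:: a])`_(size s) = a by rewrite nth_cat ltnn subnn.
have e0' : (s ++ [:: - a])`_(size s) = - a by rewrite nth_cat ltnn subnn.
case: (eqVneq i (size s)) => [->|im].
  rewrite e0'; apply: (@act_at _ _ _ _ _ 0 n.+1); rewrite /period; try lia.
    by rewrite hg; [rewrite /window_snC hs' eqxx|]; lia.
  rewrite /level hs ltnn; have -> : (2 * n - n.+1 = size s)%N by lia.
  by rewrite e0; lia.
rewrite act_fix //; last by rewrite hg // /window_snC ifF //; lia.
have h : (i < size s)%N by lia.
by rewrite !nth_cat h.
Qed.

Lemma act_nD T n (s : seq int) (a b : int) : sn_is_D T -> (2 < n)%N -> size (s ++ [:: a; b]) = n ->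
  act T n n (s ++ [:: a; b]) = s ++ [:: - b; - a].
Proof.
move=> he n2 hs; have hs' : n = (size s).+2 by rewrite -hs size_cat addn2.
apply: (@eq_from_nth _ 0); first by rewrite size_mkseq -hs !size_cat.
rewrite size_mkseq => i hi.
have hg k : (0 < k <= n)%N -> gen T n n k%:Z = window_snD n k.
  by move=> hk; rewrite /gen mirror_ext_nat // hs' /= eqxx he.
have e0 : (s ++ [:: a; b])`_(size s) = a by rewrite -[size s]addn0 nth_cat2.
have e1 : (s ++ [:: a; b])`_(size s).+1 = b by rewrite -addn1 nth_cat2.
have e0' : (s ++ [:: - b; - a])`_(size s) = - b by rewrite -[size s]addn0 nth_cat2.
have e1' : (s ++ [:: - b; - a])`_(size s).+1 = - a by rewrite -addn1 nth_cat2.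
case: (eqVneq i (size s)) => [->|im].
  rewrite e0'; apply: (@act_at _ _ _ _ _ 0 n.+1); rewrite /period; try lia.
    by rewrite hg; [rewrite /window_snD hs' eqxx|]; lia.
  rewrite /level hs ltnn; have -> : (2 * n - n.+1 = (size s).+1)%N by lia.
  by rewrite e1; lia.
case: (eqVneq i (size s).+1) => [->|im'].
  rewrite e1'; apply: (@act_at _ _ _ _ _ 0 n.+2); rewrite /period; try lia.
    by rewrite hg; [rewrite /window_snD hs' eqxx ifF|]; lia.
  rewrite /level hs ifF; last by lia.
  have -> : (2 * n - n.+2 = size s)%N by lia.
  by rewrite e0; lia.
rewrite act_fix //; last by rewrite hg // /window_snD ifF ?ifF //; lia.
have h : (i < size s)%N by lia.
by rewrite !nth_cat h.
Qed.

Lemma move_act T n c r p c' : move (s0_is_D T) (sn_is_D T) c r p c' -> (min_rank T <= n)%N ->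
  size c = n -> act T n r c = c' /\ (r <= n)%N.
Proof.
move=> hm hn; have n3 : sn_is_D T -> (2 < n)%N by move: hn; case: (T) => //= h _; lia.
case: hm => {c r p c'}.
- by move=> s1 a v s2 _ _ _ hs; split; [exact: act_swap|rewrite -hs size_cat /=; lia].
- by move=> v s he _ hs; split=> //; exact: act_0C.
- by move=> a v s he _ _ hs; split=> //; exact: act_0D.
- move=> s v he _ _ hs; have hn1 : (size s).+1 = n by rewrite -hs size_cat addn1.
  by rewrite hn1; split=> //; exact: act_nC.
- move=> s a v he _ _ _ hs; have hn1 : (size s).+2 = n by rewrite -hs size_cat addn2.
  by rewrite hn1; split=> //; apply: act_nD => //; exact: n3.
- move=> s v he _ _ hs; have hn1 : (size s).+2 = n by rewrite -hs size_cat addn2.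
  by rewrite hn1; split=> //; rewrite act_nD ?oppr0 //; exact: n3.
- by move=> s1 v s2 _ _ _ _ hs; split; [exact: act_swap|rewrite -hs size_cat /=; lia].
- by move=> a s he _ _ hs; split=> //; rewrite act_0D // subr0.
Qed.

(** * Parity conditions *)

Lemma evenly_many_card (A B : set int) : (A #= B)%card -> evenly_many A <-> evenly_many B.
Proof.
move=> h; split=> -[k hk ho]; exists k => //; first by apply: card_eq_trans hk; rewrite card_eq_sym.
exact: card_eq_trans hk.
Qed.

Lemma card_seq (s : seq int) : uniq s -> ([set` s] #= `I_(size s))%card.
Proof.
move=> hs; have -> : [set` s] = [set` [fset x in s]%fset].
  by apply/seteqP; split=> x /=; rewrite inE.
by apply/card_eq_fsetP; rewrite card_fseq undup_id.
Qed.

Lemma evenly_many_seq (s : seq int) : uniq s -> evenly_many [set` s] <-> ~~ odd (size s).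
Proof.
move=> hs; split=> [[k hk ho]|h]; last by exists (size s) => //; exact: card_seq.
suff -> : size s = k by [].
apply/card_eq_II; apply: card_eq_trans hk; rewrite card_eq_sym; exact: card_seq.
Qed.

Lemma evenly_many_add1 (A : set int) x : finite_set A -> ~ A x ->
  evenly_many (x |` A) <-> ~ evenly_many A.
Proof.
move=> /finite_seqP[s0 ->] hx.
have -> : [set` s0] = [set` undup s0] by apply/seteqP; split=> y /=; rewrite mem_undup.
have hx' : x \notin undup s0 by apply/negP; rewrite mem_undup => /hx.
have -> : x |` [set` undup s0] = [set` x :: undup s0].
  by apply/seteqP; split=> y /=; rewrite inE; [case=> [->|->]; rewrite ?eqxx ?orbT
    |case/orP => [/eqP->|]; [left|right]].
have hu := undup_uniq s0.
rewrite !evenly_many_seq //=; last by rewrite hx'.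
by rewrite negbK; split=> [->|/negP]; rewrite ?negbK.
Qed.

(** For [w i = m N + j], one has [i <= 0] exactly when [m < level c j]. So [w] maps this set
    bijectively onto the [t > 0] with [pbead c t], of which there are [norm1 c]. *)
Lemma evenly_lower n w c : mirrored n w -> injective w -> has_levels n w c ->
  evenly_many [set i | i <= 0 /\ 1 <= w i] <-> ~~ odd (norm1 c).
Proof.
move=> hw wI hl; have [hc _] := hl; set A := [set i | _ /\ _].
pose s := [seq t%:Z | t <- iota 1 (bead_bound c) & pbead c t].
have hs : uniq s by rewrite map_inj_uniq ?filter_uniq ?iota_uniq // => x y [].
have hsz : size s = norm1 c by rewrite size_map size_filter -above0.
have hmem t : (t%:Z \in s) = (0 < t)%N && pbead c t.
  apply/mapP/andP => [[t' ht' [->]]|[t0 ht]].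
    by move: ht'; rewrite mem_filter mem_iota => /and3P[-> -> _].
  exists t => //; rewrite mem_filter ht mem_iota t0 /= add1n ltnS.
  by rewrite leqNgt; apply: contraL ht => /ltnW h; rewrite pbead_bound.
have N0 : 0 < (period n)%:Z by [].
have hE : w @` A = [set` s].
  apply/seteqP; split=> [_ [i [hi hwi] <-]|x] /=.
    have [q [r [hr e]]] := int_runner n (w i).
    have q0 : 0 <= q.
      rewrite leNgt; apply/negP => hq.
      have : q * (period n)%:Z <= (-1) * (period n)%:Z by rewrite ler_pM2r //; lia.
      by lia.
    case: q q0 e => // m _ e.
    have r0 : (0 < r)%N.
      rewrite lt0n; apply/eqP => r0; move: e; rewrite r0 addr0 -(mirrored_mult m hw) => /wI e.
      have : w i = i by rewrite e (mirrored_mult m hw).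
      by lia.
    have hr' : (0 < r < period n)%N by rewrite r0.
    have [k hk /(_ i m) [h _]] := levels_at hw wI hl hr'.
    have ew : w i = (m * period n + r)%N%:Z by rewrite e; lia.
    rewrite ew hmem -{2}hc pbead_level ?hc //; apply/andP; split; first by lia.
    rewrite ltNge; apply/negP => hlt; have ei := h e.
    have : 0 * (period n)%:Z <= (m%:Z - level c r) * (period n)%:Z by rewrite ler_pM2r //; lia.
    by lia.
  move=> hx; have /mapP[t _ ex] := hx; move: hx; rewrite ex hmem => /andP[t0 ht].
  have et := divn_eq t (period n).
  have r0 : (0 < t %% period n < period n)%N.
    rewrite ltn_pmod // andbT lt0n; apply/eqP => r0; move: ht.
    by rewrite et r0 addn0 -hc pbead_mult.
  have [k hk hik] := levels_at hw wI hl r0.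
  set q := (t %/ period n)%N in et; set r := (t %% period n)%N in et r0 hik.
  have [_ h] := hik ((q%:Z - level c r) * (period n)%:Z + k%:Z) q.
  exists ((q%:Z - level c r) * (period n)%:Z + k%:Z); last by rewrite h // et; lia.
  rewrite /A /= h //; split; last by lia.
  move: ht; rewrite et -{1}hc pbead_level ?hc // => hlt.
  have : (q%:Z - level c r) * (period n)%:Z <= (-1) * (period n)%:Z by rewrite ler_pM2r //; lia.
  by lia.
rewrite -hsz -evenly_many_seq // -hE; apply: evenly_many_card; rewrite card_eq_sym.
by apply: inj_card_eq => x y _ _ /wI.
Qed.

Lemma snC_ge n y : (1 < n)%N -> (n.+1%:Z <= gen C_over_C n n y) = (y == n%:Z) || (n.+1%:Z <= y) && (y != n.+1%:Z).
Proof.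
move=> hn; have [ga gb gx] := @gen_root C_over_C n n hn (leqnn n).
rewrite /simple_root eqxx ifF /= in ga gb gx; last by lia.
have N0 : 0 < (period n)%:Z by [].
have hN : (period n)%:Z = 2 * n%:Z + 1 by rewrite /period; lia.
case: (gx y) => [e|q [] ey ->|q [] ey ->].
- have h1 : y <> n%:Z by move=> h; move: e; rewrite h ga; lia.
  have h2 : y <> n%:Z + 1 by move=> h; move: e; rewrite h gb; lia.
  by rewrite e; lia.
- by case: (mul_trichotomy q 0 N0) => h; rewrite ?h in ey *; lia.
- by case: (mul_trichotomy q 1 N0) => h; rewrite ?h in ey *; lia.
- by case: (mul_trichotomy q 0 N0) => h; rewrite ?h in ey *; lia.
- by case: (mul_trichotomy q 1 N0) => h; rewrite ?h in ey *; lia.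
Qed.

Definition upper_set (n : nat) (w : int -> int) : set int :=
  [set i | i <= n%:Z /\ n.+1%:Z <= w i].

Lemma finite_upper n w : mirrored n w -> finite_set (upper_set n w).
Proof.
move=> hw; set M := (\max_(0 <= k < period n) `|w k%:Z|)%N.
apply: (@sub_finite_set _ _ [set` [seq m%:Z - M%:Z | m <- iota 0 (M + n.+1)]]) => // i [hi hwi] /=.
have [q [r [hr e]]] := int_runner n i.
have hM : (`|w r%:Z| <= M)%N.
  by rewrite /M (@leq_bigmax_seq _ _ _ (fun k : nat => `|w k%:Z|%N) r) // mem_index_iota.
have := mirrored_shift q r%:Z hw; rewrite -e => ew.
by apply/mapP; exists `|(i + M%:Z)%R|%N; [rewrite mem_iota; lia|lia].
Qed.

(** Only the values [n] and [n.+1] cross the threshold. Their preimages are [i] and [N - i], exactly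
    one of which is at most [n], so exactly one element enters or leaves the set. *)
Lemma upper_left n w : (1 < n)%N -> mirrored n w -> bijective w ->
  evenly_many (upper_set n (gen C_over_C n n \o w)) <-> ~ evenly_many (upper_set n w).
Proof.
move=> hn hw [g gw wg]; set i := g n%:Z.
have hm : mirrored n (gen C_over_C n n \o w) by apply: mirrored_comp hw; exact: mirrored_gen.
have wi : w i = n%:Z by rewrite /i wg.
have [_ wo] := hw; have hj : w ((period n)%:Z - i) = n.+1%:Z.
  have := mirrored_shift 1 (- i) hw; rewrite wo wi mul1r => ->; rewrite /period; lia.
have wI := can_inj gw.
have iE x : w x = n%:Z -> x = i by rewrite -wi => /wI.
have jE x : w x = n.+1%:Z -> x = (period n)%:Z - i by rewrite -hj => /wI.
have [hle|hgt] := lerP i n%:Z.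
  rewrite -(@evenly_many_add1 _ i); [|exact: finite_upper|by rewrite /upper_set /= wi; lia].
  suff -> : upper_set n (gen C_over_C n n \o w) = i |` upper_set n w by [].
  apply/seteqP; split=> x; rewrite /upper_set /= snC_ge //.
    move=> [h1 /orP[/eqP/iE->|/andP[h2 _]]]; by [left|right].
  case=> [->|[h1 h2]]; first by rewrite wi eqxx.
  split=> //; rewrite h2 orbC; apply/orP; left; apply/eqP => /jE e; move: h1; rewrite e /period; lia.
have e : upper_set n w = ((period n)%:Z - i) |` upper_set n (gen C_over_C n n \o w).
  apply/seteqP; split=> x; rewrite /upper_set /= snC_ge //.
    move=> [h1 h2]; case: (eqVneq (w x) n.+1%:Z) => [/jE|h3]; [by left|right].
    by rewrite h1 h2 orbT.
  case=> [->|[h1 /orP[/eqP/iE e|/andP[h2 _]]]] //; first by rewrite hj /period; lia.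
  by move: h1; rewrite e; lia.
rewrite e evenly_many_add1; [|exact: finite_upper|].
  by split=> [h|/contrapT].
by rewrite /upper_set /= snC_ge // hj; lia.
Qed.

(** Transported along the involution, the set changes only at the positions [n] and [n.+1]; exactly
    one of [w n] and [w n.+1 = N - w n] is beyond the threshold. *)
Lemma upper_right n w : (1 < n)%N -> mirrored n w -> bijective w ->
  evenly_many (upper_set n (w \o gen C_over_C n n)) <-> ~ evenly_many (upper_set n w).
Proof.
move=> hn hw hb; set t := gen C_over_C n n; have tK : involutive t := @gen_involutive C_over_C n n hn (leqnn n).
pose B := [set j | t j <= n%:Z /\ n.+1%:Z <= w j].
have hB : t @` upper_set n (w \o t) = B.
  apply/seteqP; split=> [_ [i [h1 h2] <-]|j [h1 h2]]; first by rewrite /B /= tK.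
  by exists (t j); rewrite ?tK // /upper_set /= tK.
have -> : evenly_many (upper_set n (w \o t)) <-> evenly_many B.
  apply: evenly_many_card; rewrite -hB card_eq_sym; apply: inj_card_eq => x y _ _.
  exact: (can_inj tK).
have ht j : (t j <= n%:Z) = (j == n.+1%:Z) || (j <= n%:Z) && (j != n%:Z).
  have := snC_ge j hn; rewrite -/t; case: (lerP (t j) n%:Z) => h; lia.
have [_ wo] := hw; have hj : w n.+1%:Z = (period n)%:Z - w n%:Z.
  by have := mirrored_shift 1 (- n%:Z) hw; rewrite wo mul1r => <-; congr w; rewrite /period; lia.
have [hle|hgt] := lerP n.+1%:Z (w n%:Z).
  have e : upper_set n w = n%:Z |` B.
    apply/seteqP; split=> x; rewrite /upper_set /B /= ht.
      by move=> [h1 h2]; case: (eqVneq x n%:Z) => [|h3]; [left|right; rewrite h1 h2 orbT].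
    case=> [->|[/orP[/eqP ->|/andP[h1 _]] h2]] //.
    by move: h2; rewrite hj /period; lia.
  have hf : finite_set B by rewrite -hB; apply: finite_image; apply: finite_upper; apply: mirrored_comp => //; exact: mirrored_gen.
  rewrite e evenly_many_add1 //; last by rewrite /B /= ht eqxx; lia.
  by split=> [h|/contrapT].
have e : B = n.+1%:Z |` upper_set n w.
  apply/seteqP; split=> x; rewrite /upper_set /B /= ht.
    by case=> /orP[/eqP|/andP[h1 _] h2]; [left|right].
  case=> [->|[h1 h2]]; first by rewrite eqxx hj /period; split=> //; lia.
  split=> //; rewrite h1; apply/orP; right; apply/eqP => e; move: h2; rewrite e; lia.
rewrite e evenly_many_add1 //; first exact: finite_upper.
by rewrite /upper_set /=; lia.
Qed.

Lemma mirrored_permE n w : mirrored_perm n w <-> bijective w /\ mirrored n w.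
Proof. by split=> [[h1 h2 h3]|[h1 [h2 h3]]]. Qed.

Lemma runner_above (n : nat) (q z : int) : - n%:Z <= z <= n%:Z ->
  (n.+1%:Z <= q * (period n)%:Z + z) = (1 <= q).
Proof.
move=> hz; have N0 : 0 < (period n)%:Z by [].
have hN : (period n)%:Z = 2 * n%:Z + 1 by rewrite /period; lia.
rewrite -[RHS](ler_pM2r N0).
by case: (mul_trichotomy q 0 N0) => h; [rewrite h| |case: (mul_trichotomy q 1 N0) => h'; [rewrite h'| |]]; lia.
Qed.

Lemma gen_upper T n r y : (min_rank T <= n)%N -> (r < n)%N ->
  (n.+1%:Z <= gen T n r y) = (n.+1%:Z <= y).
Proof.
move=> hn hr; have [_ _ /(_ y)] := gen_root hn (ltnW hr).
have n2 : (2 <= n)%N by apply: leq_trans hn; case: (T).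
have : [/\ - n%:Z <= (simple_root T n r).1, (simple_root T n r).1 <= n%:Z,
           - n%:Z <= (simple_root T n r).2 & (simple_root T n r).2 <= n%:Z].
  rewrite /simple_root; case: ifP => h /=; first by case: ifP => _; split; lia.
  by rewrite ifF; [split|]; move=> /=; lia.
move: (simple_root T n r) => [a b] /= [h1 h2 h3 h4].
case=> [->//|q [] ey ->|q [] ey ->]; rewrite ey.
- have -> : q * (period n)%:Z + a + (b - a) = q * (period n)%:Z + b by lia.
  by rewrite !runner_above; lia.
- have -> : q * (period n)%:Z - b + (b - a) = q * (period n)%:Z - a by lia.
  by rewrite !runner_above; lia.
- have -> : q * (period n)%:Z + b - (b - a) = q * (period n)%:Z + a by lia.
  by rewrite !runner_above; lia.
- have -> : q * (period n)%:Z - a - (b - a) = q * (period n)%:Z - b by lia.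
  by rewrite !runner_above; lia.
Qed.

(** As a conjugate of $s_{n-1}$ by $s_n^C$, the generator $s_n^D$ toggles the upper parity twice,
    hence preserves it. *)
Lemma snDE T n : (min_rank T <= n)%N -> sn_is_D T ->
  gen T n n = gen C_over_C n n \o (gen T n n.-1 \o gen C_over_C n n).
Proof.
move=> hn he; have n3 : (3 <= n)%N by move: hn he; case: (T) => //= h _; lia.
have n0 : (n == 0%N) = false by lia.
have n1 : (n.-1 == 0%N) = false by lia.
have nn1 : (n.-1 == n) = false by lia.
set f := _ \o _; have hf : mirrored n f.
  by do 2 (apply: mirrored_comp; first exact: mirrored_gen); exact: mirrored_gen.
have hg := mirrored_gen T n n.
suff h k : (0 < k <= n)%N -> gen T n n k%:Z = f k%:Z.
  have [_ fo] := hf; have [_ go] := hg.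
  apply: funext => x; case: (centeredP n x) => [q|q k hk|q k hk] ->.
  - by rewrite (mirrored_mult q hf) (mirrored_mult q hg).
  - by rewrite (mirrored_shift q _ hf) (mirrored_shift q _ hg) h.
  - by rewrite (mirrored_shift q _ hf) (mirrored_shift q _ hg) fo go h.
move=> hk; have tE j : (0 < j <= n)%N -> gen C_over_C n n j%:Z = window_snC n j.
  by move=> hj; rewrite /gen mirror_ext_nat // n0 eqxx.
have tM j : (0 < j <= n)%N -> gen C_over_C n n (period n - j)%N%:Z = (period n)%:Z - window_snC n j.
  by move=> hj; rewrite /gen mirror_ext_mirror // n0 eqxx.
have sE j : (0 < j <= n)%N -> gen T n n.-1 j%:Z = window_s n.-1 j.
  by move=> hj; rewrite /gen mirror_ext_nat // n1 nn1.
have sM j : (0 < j <= n)%N -> gen T n n.-1 (period n - j)%N%:Z = (period n)%:Z - window_s n.-1 j.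
  by move=> hj; rewrite /gen mirror_ext_mirror // n1 nn1.
have -> : gen T n n k%:Z = window_snD n k by rewrite /gen mirror_ext_nat // n0 eqxx he.
rewrite /f /= tE // /window_snC; case: (eqVneq k n) => [->|kn].
  have -> : n.+1%:Z = (period n - n)%N%:Z by rewrite /period; lia.
  rewrite sM; last by lia.
  have -> : window_s n.-1 n = n.-1%:Z by rewrite /window_s prednK ?eqxx ?ifF; lia.
  have -> : (period n)%:Z - n.-1%:Z = (period n - n.-1)%N%:Z by rewrite /period; lia.
  rewrite tM; last by lia.
  rewrite /window_snD /window_snC eqxx nn1 ifF; last by lia.
  by rewrite /period; lia.
rewrite sE //; case: (eqVneq k n.-1) => [->|kn1].
  have -> : window_s n.-1 n.-1 = n%:Z by rewrite /window_s eqxx prednK //; lia.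
  rewrite tE; last by lia.
  by rewrite /window_snD /window_snC !eqxx.
have -> : window_s n.-1 k = k%:Z by rewrite /window_s prednK ?(negbTE kn) ?(negbTE kn1) //; lia.
by rewrite tE // /window_snD /window_snC (negbTE kn) (negbTE kn1).
Qed.

(** For the lower parity only $s_0^D$ needs the levels: it sends [(a, b)] to [(1 - b, 1 - a)], which
    keeps the parity of [norm1]. For the upper parity only $s_n^D$ is not immediate. *)
Lemma affine_gen T n r w : (min_rank T <= n)%N -> (r <= n)%N ->
  affine_group T n w -> affine_group T n (gen T n r \o w).
Proof.
move=> hn hr [/mirrored_permE [hb hw] h0 h1].
have hgw : mirrored n (gen T n r \o w) by apply: mirrored_comp hw; exact: mirrored_gen.
have hgb : bijective (gen T n r) by exists (gen T n r); exact: gen_involutive.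
have hbb : bijective (gen T n r \o w) by exact: bij_comp.
split=> [|he|he]; first by apply/mirrored_permE.
  have {}h0 := h0 he; case: (posnP r) => [r0|r0].
    have [c hl] := levels_exist hw hb; have hl' := levels_act hn hr hw hl.
    have wI := bij_inj hb; have wI' := bij_inj hbb.
    move: h0; rewrite (evenly_lower hw wI hl) (evenly_lower hgw wI' hl').
    have [hc _] := hl; have n3 : (3 <= n)%N by move: hn he; case: (T) => //= h _; lia.
    case: c hc {hl hl'} => [|a [|b s]] hc; try by move: hc n3 => /= <-.
    rewrite r0 act_0D // !norm1_cons; lia.
  have -> // : [set i | i <= 0 /\ 1 <= (gen T n r \o w) i] = [set i | i <= 0 /\ 1 <= w i].
  by apply/seteqP; split=> i /= [hi]; have := gen_pos (w i) hn (k := r); rewrite r0 hr => /(_ isT); split=> //; lia.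
have {}h1 := h1 he; have n3 : (3 <= n)%N by move: hn he; case: (T) => //= h _; lia.
have key m v : (m < n)%N -> upper_set n (gen T n m \o v) = upper_set n v.
  by move=> hm; apply/seteqP; split=> i; rewrite /upper_set /= gen_upper.
move: hr; rewrite leq_eqVlt => /orP[/eqP->|hr]; last first.
  by rewrite -/(upper_set n (gen T n r \o w)) key.
have n2 : (1 < n)%N by lia.
have hpn : (n.-1 <= n)%N by lia.
have tK : involutive (gen C_over_C n n) := @gen_involutive C_over_C n n n2 (leqnn n).
have tB : bijective (gen C_over_C n n) by exists (gen C_over_C n n).
have sB : bijective (gen T n n.-1) by exists (gen T n n.-1); exact: gen_involutive.
have mt := mirrored_gen C_over_C n n; have ms := mirrored_gen T n n.-1.
rewrite snDE // -/(upper_set n _) -!compA upper_left //; first last.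
- by apply: bij_comp => //; apply: bij_comp.
- by apply: mirrored_comp => //; apply: mirrored_comp.
rewrite key ?upper_left //; last by lia.
Qed.

Lemma affine_id T n : affine_group T n id.
Proof.
have h0 : evenly_many set0.
  have -> : set0 = [set` [::]] :> set int by apply/seteqP; split=> x.
  by apply/evenly_many_seq.
split; first by apply/mirrored_permE; split; [exists id|].
- move=> _; suff -> : [set i : int | i <= 0 /\ 1 <= i] = set0 by [].
  by apply/seteqP; split=> i //= [h1 h2]; lia.
- move=> _; suff -> : [set i : int | i <= n%:Z /\ n.+1%:Z <= i] = set0 by [].
  by apply/seteqP; split=> i //= [h1 h2]; lia.
Qed.

Lemma affine_word T n s : (min_rank T <= n)%N -> all (fun i => i <= n)%N s ->
  affine_group T n (word_prod T n s).
Proof.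
move=> hn; elim: s => [_|i s IH /= /andP[hi /IH hs]]; first exact: affine_id.
exact: affine_gen.
Qed.

(** * Minimal length representatives *)

(** No right descent among the generators of [W]; [min_length_repsE] identifies this with minimal
    length. *)
Definition sorted_rep (T : quotient_type) (n : nat) (w : int -> int) : Prop :=
  affine_group T n w /\
  forall k, (0 < k <= n)%N -> w (simple_root T n k).1 < w (simple_root T n k).2.

Lemma affine_mirrored T n w : affine_group T n w -> mirrored n w /\ bijective w.
Proof. by case=> /mirrored_permE[]. Qed.

Lemma levels_unique n w c c' : mirrored n w -> injective w ->
  has_levels n w c -> has_levels n w c' -> c = c'.
Proof.
move=> hw wI hl hl'; have [hc _] := hl; have [hc' h'] := hl'.
apply: (@eq_from_nth _ 0) => [|i]; rewrite hc ?hc' // => hi.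
have hj : (0 < i.+1 < period n)%N by rewrite /period; lia.
have [k hk hik] := levels_at hw wI hl hj; have [k' hk' e'] := h' i.+1 hi.
have [h _] := hik k'%:Z c'`_i; have := h e'; rewrite -[k'%:Z]add0r -(mul0r (period n)%:Z) => e.
have [||e0 _] := runner_inj _ _ e; [lia|lia|].
have hlv : level c i.+1 = c`_i by rewrite /level hc hi.
by apply/esym/eqP; rewrite -subr_eq0 -hlv -e0.
Qed.

(** By the mirror symmetry the entire window from 1 to [2 * n] increases, and the levels determine
    its set of values. *)
Lemma increasing_unique n w1 w2 c : mirrored n w1 -> injective w1 -> mirrored n w2 -> injective w2 ->
  has_levels n w1 c -> has_levels n w2 c ->
  (forall k, (0 < k <= n)%N -> w1 k%:Z < w1 k.+1%:Z) ->
  (forall k, (0 < k <= n)%N -> w2 k%:Z < w2 k.+1%:Z) -> w1 = w2.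
Proof.
move=> m1 i1 m2 i2 l1 l2 s1 s2.
have hs w : mirrored n w -> (forall k, (0 < k <= n)%N -> w k%:Z < w k.+1%:Z) ->
    sorted <%O [seq w k%:Z | k <- iota 1 (2 * n)].
  move=> hw hlt; apply/(sortedP 0) => i; rewrite size_map size_iota => hi.
  rewrite !(nth_map 0%N) ?size_iota ?nth_iota //; try lia.
  rewrite !add1n; have [hle|hgt] := ltnP i n; first by apply: hlt.
  have [_ wo] := hw; have sh z := mirrored_shift 1 z hw.
  have e k : (k < period n)%N -> w k%:Z = (period n)%:Z - w (period n - k)%N%:Z.
    move=> hk; rewrite -wo -[X in X + _]mul1r -sh mul1r; congr w; lia.
  have h1 : (i.+1 < period n)%N by rewrite /period; lia.
  have h2 : (i.+2 < period n)%N by rewrite /period; lia.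
  rewrite (e _ h1) (e _ h2) ltrD2l ltrN2.
  have := hlt (period n - i.+2)%N; have -> : ((period n - i.+2).+1 = period n - i.+1)%N by rewrite /period; lia.
  by apply; rewrite /period; lia.
have hmem w v : mirrored n w -> injective w -> has_levels n w c -> mirrored n v -> injective v -> has_levels n v c ->
    {subset [seq w k%:Z | k <- iota 1 (2 * n)] <= [seq v k%:Z | k <- iota 1 (2 * n)]}.
  move=> mw iw lw mv iv lv x /mapP[k]; rewrite mem_iota => hk ->.
  have hk' : (0 < k < period n)%N by rewrite /period; lia.
  have [j hj ->] := levels_values mw iw lw hk'.
  have [k' hk2 <-] := levels_full mv lv hj.
  by apply/mapP; exists k' => //; rewrite mem_iota; move: hk2; rewrite /period; lia.
have e : [seq w1 k%:Z | k <- iota 1 (2 * n)] = [seq w2 k%:Z | k <- iota 1 (2 * n)].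
  apply: (@lt_sorted_eq _ int); [exact: hs|exact: hs|].
  by move=> x; apply/idP/idP; apply: hmem.
have ek k : (0 < k <= n)%N -> w1 k%:Z = w2 k%:Z.
  move=> hk; have := congr1 (fun s => nth 0 s k.-1) e.
  rewrite !(nth_map 0%N) ?size_iota ?nth_iota //; try lia.
  by rewrite add1n prednK //; lia.
have [_ o1] := m1; have [_ o2] := m2.
apply: funext => x; case: (centeredP n x) => [q|q k hk|q k hk] ->.
- by rewrite (mirrored_mult q m1) (mirrored_mult q m2).
- by rewrite (mirrored_shift q _ m1) (mirrored_shift q _ m2) ek.
- by rewrite (mirrored_shift q _ m1) (mirrored_shift q _ m2) o1 o2 ek.
Qed.

(** With $s_n^D$ the conditions compare [w (n - 1)] to [w (n + 1)] and leave [w n] and [w (n + 1)]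
    unordered. So the window of [w] or that of [w] times $s_n^C$ increases, with the same levels;
    the upper parity excludes that [w1] and [w2] differ in this respect. *)
Lemma sorted_unique T n w1 w2 c : (min_rank T <= n)%N -> sorted_rep T n w1 -> sorted_rep T n w2 ->
  has_levels n w1 c -> has_levels n w2 c -> w1 = w2.
Proof.
move=> hn [a1 s1] [a2 s2] l1 l2.
have [m1 b1] := affine_mirrored a1; have [m2 b2] := affine_mirrored a2.
have i1 := bij_inj b1; have i2 := bij_inj b2.
have n2 : (1 < n)%N by apply: leq_trans hn; case: (T).
have low (w : int -> int) k : (forall k, (0 < k <= n)%N -> w (simple_root T n k).1 < w (simple_root T n k).2) ->
    (0 < k < n)%N -> w k%:Z < w k.+1%:Z.
  move=> h hk; have := h k; rewrite /simple_root ifF ?ifF /=; try lia.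
  have -> : k%:Z + 1 = k.+1%:Z by lia.
  by apply; lia.
case: (boolP (sn_is_D T)) => he; last first.
  have inc (w : int -> int) : (forall k, (0 < k <= n)%N -> w (simple_root T n k).1 < w (simple_root T n k).2) ->
      forall k, (0 < k <= n)%N -> w k%:Z < w k.+1%:Z.
    move=> h k hk; move: (hk) => /andP[k0]; rewrite leq_eqVlt => /orP[/eqP kn|kn].
      have := h k hk; rewrite /simple_root kn eqxx (negbTE he) ifF /=; last by lia.
      have -> // : n%:Z + 1 = n.+1%:Z by lia.
    by apply: low => //; rewrite k0.
  by apply: (increasing_unique m1 i1 m2 i2 l1 l2); exact: inc.
set t := gen C_over_C n n.
have n3 : (2 < n)%N by move: hn he; case: (T) => //= h _; lia.
have tK : involutive t := @gen_involutive C_over_C n n n2 (leqnn n).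
have tB : bijective t by exists t.
have [tn tn1 tx] := @gen_root C_over_C n n n2 (leqnn n).
rewrite -/t /simple_root eqxx ifF /= in tn tn1 tx; last by lia.
have tk k : (0 < k < n)%N -> t k%:Z = k%:Z.
  move=> hk; rewrite /t /gen mirror_ext_nat; last by lia.
  by rewrite ifF ?eqxx /= /window_snC ?ifF //; lia.
have mt : mirrored n t := mirrored_gen C_over_C n n.
have alt w : mirrored n w -> injective w ->
    (forall k, (0 < k <= n)%N -> w (simple_root T n k).1 < w (simple_root T n k).2) ->
    (forall k, (0 < k <= n)%N -> w k%:Z < w k.+1%:Z) \/
    (forall k, (0 < k <= n)%N -> (w \o t) k%:Z < (w \o t) k.+1%:Z).
  move=> mw iw h; have hD : w (n%:Z - 1) < w (n%:Z + 1).
    by have := h n; rewrite /simple_root he eqxx ifF /=; [apply|]; lia.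
  have hlow : w (n%:Z - 1) < w n%:Z.
    have -> : n%:Z = n.-1.+1%:Z by lia.
    have -> : n.-1.+1%:Z - 1 = n.-1%:Z by lia.
    by apply: low => //; lia.
  case: (ltgtP (w n%:Z) (w (n%:Z + 1))) => [hlt|hgt|/iw]; [left|right|lia].
    move=> k /andP[k0]; rewrite leq_eqVlt => /orP[/eqP->|kn]; first by rewrite (_ : n.+1%:Z = n%:Z + 1) //; lia.
    by apply: low => //; rewrite k0.
  move=> k /andP[k0]; rewrite leq_eqVlt => /orP[/eqP->|kn] /=.
    by rewrite (_ : n.+1%:Z = n%:Z + 1) ?tn ?tn1 //; lia.
  rewrite tk; last by lia.
  case: (eqVneq k.+1 n) => [e|hne].
    by rewrite e tn (_ : k%:Z = n%:Z - 1) //; lia.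
  by rewrite tk; [apply: low => //|]; lia.
have rt w : has_levels n w c -> has_levels n (w \o t) c.
  by apply: (@levels_right C_over_C n n); rewrite ?leqnn ?(ltnW n2) //; lia.
have mwt w : mirrored n w -> mirrored n (w \o t) by move=> h; apply: mirrored_comp h mt.
have iwt (w : int -> int) : injective w -> injective (w \o t) by move=> h; apply: inj_comp h (inv_inj tK).
have noswap v w : affine_group T n v -> affine_group T n w -> v = w \o t -> False.
  move=> [_ _ /(_ he) hv] aw; have [mw bw] := affine_mirrored aw; have [_ _ /(_ he) hw] := aw.
  by move=> e; move: hv; rewrite e -/(upper_set n (w \o t)) upper_right.
case: (alt _ m1 i1 s1) => c1; case: (alt _ m2 i2 s2) => c2.
- exact: (increasing_unique m1 i1 m2 i2 l1 l2).
- have e := increasing_unique m1 i1 (mwt _ m2) (iwt w2 i2) l1 (rt _ l2) c1 c2.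
  by case: (noswap _ _ a1 a2 e).
- have e := increasing_unique m2 i2 (mwt _ m1) (iwt w1 i1) l2 (rt _ l1) c2 c1.
  by case: (noswap _ _ a2 a1 e).
- have e := increasing_unique (mwt _ m1) (iwt w1 i1) (mwt _ m2) (iwt w2 i2) (rt _ l1) (rt _ l2) c1 c2.
  by apply: funext => x; have := congr1 (fun f => f (t x)) e; rewrite /= tK.
Qed.

Lemma move_act_back T n c r p c' : move (s0_is_D T) (sn_is_D T) c r p c' -> (min_rank T <= n)%N ->
  size c = n -> act T n r c' = c.
Proof.
move=> hm hn hc; have hc' := size_move hm; rewrite hc in hc'.
have n3 : sn_is_D T -> (2 < n)%N by move: hn; case: (T) => //= h _; lia.
case: hm hc hc' => {c r p c'}.
- by move=> s1 a v s2 _ _ _ _ hs; exact: act_swap.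
- by move=> v s he _ _ hs; rewrite act_0C // subKr.
- by move=> a v s he _ _ _ hs; rewrite act_0D // !subKr.
- move=> s v he _ _ hs hs'; have hn1 : (size s).+1 = n by rewrite -hs size_cat addn1.
  by rewrite hn1 act_nC // opprK.
- move=> s a v he _ _ _ hs hs'; have hn1 : (size s).+2 = n by rewrite -hs size_cat addn2.
  by rewrite hn1 act_nD ?opprK //; exact: n3.
- move=> s v he _ _ hs hs'; have hn1 : (size s).+2 = n by rewrite -hs size_cat addn2.
  by rewrite hn1 act_nD ?opprK ?oppr0 //; exact: n3.
- by move=> s1 v s2 _ _ _ _ _ hs; exact: act_swap.
- by move=> a s he _ _ _ hs; rewrite act_0D // subrr subKr.
Qed.

Lemma move_neq (e0 en : bool) c r p c' : move e0 en c r p c' -> (2 + e0 + en <= size c)%N -> c <> c'.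
Proof.
move=> hm hs; have [q [l [[h1 h2 h3] h]]] := move_hat hm hs => e; rewrite -e in h.
case: h => [[h _]|[q' [[_ h2' _]]]].
  by have := norm1_peel h1; rewrite h3 -h; lia.
by rewrite -h2' h2; lia.
Qed.

Lemma move_parity (e0 en : bool) c r p c' : move e0 en c r p c' ->
  (e0 -> ~~ odd (norm1 c)) -> (e0 -> ~~ odd (norm1 c')).
Proof.
case=> {c r p c'}.
- move=> s1 a v s2 _ _ _; rewrite !norm1_cat !norm1_cons => h /h; lia.
- by move=> v s /negbTE->.
- by move=> a v s _ ha hv h /h; rewrite !norm1_cons; lia.
- by move=> s v _ _ hv h /h; rewrite !norm1_cat !norm1_cons ?norm1_nil; lia.
- by move=> s a v _ _ ha hv h /h; rewrite !norm1_cat !norm1_cons ?norm1_nil; lia.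
- by move=> s v _ _ hv h /h; rewrite !norm1_cat !norm1_cons ?norm1_nil; lia.
- by move=> s1 v s2 _ _ _ _ h /h; rewrite !norm1_cat !norm1_cons; lia.
- by move=> a s _ ha _ h /h; rewrite !norm1_cons; lia.
Qed.

(* Lexicographic in the number of rows and the length of the last row. *)
Definition peel_rank (e0 en : bool) (n : nat) (c : seq int) : nat :=
  let h := hat e0 en c in
  if norm1 h == 0%N then 0%N else (norm1 h * (2 * n).+1 + part_size e0 en n (top_part h))%N.

Lemma move_rank (e0 en : bool) c r p c' : move e0 en c r p c' -> (2 + e0 + en <= size c)%N ->
  (peel_rank e0 en (size c) c' < peel_rank e0 en (size c) c)%N.
Proof.
move=> hm hs; have [q [l [[h1 h2 h3] h]]] := move_hat hm hs.
have hq := norm1_peel h1; rewrite h3 in hq.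
rewrite /peel_rank (negbTE h1) h2 hq mulSn.
case: h => [[-> _]|[q' [[h1' h2' h3'] hsz]]].
  case: eqVneq => hl; first by lia.
  have := top_bound hl; have <- : size (hat e0 en c') = size c by rewrite size_hat (size_move hm).
  have : size l = size c by rewrite -h3 size_peel // size_hat.
  rewrite size_hat (size_move hm) => -> /andP[_]; rewrite /part_size; lia.
have := norm1_peel h1'; rewrite h3' => e; rewrite (negbTE h1') h2' e mulSn; lia.
Qed.

Lemma peeling_ind (e0 en : bool) n (P : seq int -> Prop) : (2 + e0 + en <= n)%N ->
  (forall c, size c = n -> norm1 c = 0%N -> P c) ->
  (forall c r p c', size c = n -> (e0 -> ~~ odd (norm1 c)) -> move e0 en c r p c' -> P c' -> P c) ->
  forall c, size c = n -> (e0 -> ~~ odd (norm1 c)) -> P c.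
Proof.
move=> hn hb hS c; move: {2}(peel_rank e0 en n c).+1 (ltnSn (peel_rank e0 en n c)) => m.
elim: m c => // m IH c hm hc hp.
have [h0|h0] := eqVneq (norm1 c) 0%N; first exact: hb.
have hs : (2 + e0 + en <= size c)%N by rewrite hc.
have [r [p [c' hmv]]] := move_total hs hp h0.
apply: (hS c r p c') => //; apply: IH.
- by have := move_rank hmv hs; rewrite hc; lia.
- by rewrite (size_move hmv).
- exact: move_parity hmv hp.
Qed.

(** A descent of the product at [k] would make it equal to [w \o gen T n k], by [gen_inversion] and
    [gen_conj]. That element has the levels of [w], whereas the generator is assumed to change
    them. *)
Lemma sorted_gen T n r w c : (min_rank T <= n)%N -> (r <= n)%N -> sorted_rep T n w ->
  has_levels n w c -> act T n r c <> c -> sorted_rep T n (gen T n r \o w).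
Proof.
move=> hn hr [ha hs] hl hne; have [hw hb] := affine_mirrored ha; have hI := bij_inj hb.
split=> [|k hk]; first exact: affine_gen.
rewrite ltNge le_eqVlt /=; apply/negP => hle.
have gK := gen_involutive hn hr; have gI := inv_inj gK.
have {hle} hlt : gen T n r (w (simple_root T n k).2) < gen T n r (w (simple_root T n k).1).
  case/orP: hle => // /eqP /gI /hI e; have := simple_lt T n k; rewrite e ltxx //.
have e := gen_inversion hn hr (is_root_image hw hI (simple_is_root hn hk)) (hs k hk) hlt.
have hkn : (k <= n)%N by case/andP: hk.
have e' := gen_conj hn hr hkn hw hI e.
apply: hne; have h1 := levels_act hn hr hw hl.
have h2 := levels_right hn hk hl; rewrite -e' in h2.
apply: levels_unique h1 h2; first by apply: mirrored_comp hw; exact: mirrored_gen.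
exact: inj_comp gI hI.
Qed.

Lemma levels_id n c : size c = n -> norm1 c = 0%N -> has_levels n id c.
Proof.
move=> hc h0; split=> // j hj; exists j; first by rewrite /period; lia.
have := nth_norm1 c j.-1; rewrite h0 leqn0 absz_eq0 => /eqP ->; lia.
Qed.

Lemma sorted_id T n : (min_rank T <= n)%N -> sorted_rep T n id.
Proof. by move=> hn; split; [exact: affine_id|move=> k _; exact: simple_lt]. Qed.

Lemma move_sorted T n w c r p c' : (min_rank T <= n)%N -> sorted_rep T n w -> has_levels n w c ->
  move (s0_is_D T) (sn_is_D T) c r p c' ->
  sorted_rep T n (gen T n r \o w) /\ has_levels n (gen T n r \o w) c'.
Proof.
move=> hn hw hl hm; have [hc _] := hl; have [ha hr] := move_act hm hn hc.
have hne : c <> c' by apply: (move_neq hm); rewrite -min_rankE hc.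
split; first by apply: sorted_gen hl _ => //; rewrite ha => /esym.
by rewrite -ha; apply: levels_act => //; have [/affine_mirrored[]] := hw.
Qed.

Lemma levels_parity T n w c : affine_group T n w -> has_levels n w c -> s0_is_D T -> ~~ odd (norm1 c).
Proof.
move=> ha hl he; have [hw hb] := affine_mirrored ha; have [_ /(_ he) h _] := ha.
exact/(evenly_lower hw (bij_inj hb) hl).
Qed.

Lemma sorted_exists T n c : (min_rank T <= n)%N -> size c = n -> (s0_is_D T -> ~~ odd (norm1 c)) ->
  exists2 w, sorted_rep T n w & has_levels n w c.
Proof.
move=> hn; move: c; apply: (@peeling_ind _ (sn_is_D T)); first by rewrite -min_rankE.
  by move=> c hc h0; exists id; [exact: sorted_id|exact: levels_id].
move=> c r p c' hc hp hm [w hw hl].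
have [_ hr] := move_act hm hn hc; have e := move_act_back hm hn hc.
have hne : c <> c' by apply: (move_neq hm); rewrite -min_rankE hc.
exists (gen T n r \o w); first by apply: sorted_gen hl _ => //; rewrite e.
by rewrite -e; apply: levels_act => //; have [/affine_mirrored[]] := hw.
Qed.

(** [affine_group] is defined by parity conditions and not by generators. The peeling supplies the
    words: each move is one letter, and it ends at zero levels, where [sorted_unique] gives the
    identity. *)
Lemma sorted_word T n w : (min_rank T <= n)%N -> sorted_rep T n w ->
  exists s, is_word T n s w.
Proof.
move=> hn hw; have [ha _] := hw; have [mw bw] := affine_mirrored ha.
have [c hl] := levels_exist mw bw; have hp := levels_parity ha hl.
have [hc _] := hl; move: c hc hp w hw hl {ha mw bw}.
apply: (@peeling_ind _ (sn_is_D T)); first by rewrite -min_rankE.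
  move=> c hc h0 w hw hl; exists [::]; split=> //.
  exact: (sorted_unique hn (sorted_id hn) hw (levels_id hc h0) hl).
move=> c r p c' hc hp hm IH w hw hl.
have [hw' hl'] := move_sorted hn hw hl hm; have [s [hs e]] := IH _ hw' hl'.
have [_ hr] := move_act hm hn hc.
exists (r :: s); split=> /=; first by rewrite hr hs.
by rewrite e; apply: funext => x /=; rewrite gen_involutive.
Qed.

Lemma levels_finite T n v w c : (min_rank T <= n)%N -> finite_group T n v ->
  has_levels n w c -> has_levels n (w \o v) c.
Proof.
move=> hn [s hs <-]; elim: s w hs => [|k s IH] w //= /andP[hk hs] hl.
by rewrite compA; apply: IH => //; exact: levels_right hl.
Qed.

Lemma word_length T n w : (exists s, is_word T n s w) -> exists l, has_length T n w l.
Proof.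
move=> hw; have hex : exists m, `[< exists2 s, is_word T n s w & size s = m >].
  by case: hw => s hs; exists (size s); apply/asboolP; exists s.
exists (ex_minn hex); case: ex_minnP => m /asboolP h1 h2; split=> // s hs.
by apply: h2; apply/asboolP; exists s.
Qed.

(** A descent contradicts minimality by [exchange]. Conversely, [exchange] shortens any word of a
    coset member until that member is sorted; as levels are constant on the coset, the sorted
    element reached is [w]. *)
Lemma min_length_repsE T n w : (min_rank T <= n)%N ->
  min_length_reps T n w <-> sorted_rep T n w.
Proof.
move=> hn; split=> [[ha [l hlen hmin]]|hw].
  split=> // k hk; rewrite ltNge le_eqVlt; apply/negP => hle.
  have [mw bw] := affine_mirrored ha; have wI := bij_inj bw.
  have [[s [hs es] hsz] _] := hlen.
  have hlt : w (simple_root T n k).2 < w (simple_root T n k).1.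
    case/orP: hle => // /eqP /wI e; have := simple_lt T n k; rewrite e ltxx //.
  rewrite -es in hlt; have [s' [h1 h2 h3]] := exchange hn hk hs hlt.
  have hw' : is_word T n s' (w \o gen T n k) by split=> //; rewrite h3 es.
  have hex : exists s, is_word T n s (w \o gen T n k) by exists s'.
  have [l' hl'] := word_length hex.
  have hco : same_coset T n w (w \o gen T n k).
    by exists (gen T n k) => //; exists [:: k] => //=; rewrite hk.
  have := hmin _ hco _ hl'; have [_ hle'] := hl'.
  by have := hle' s' hw'; lia.
have [ha _] := hw; split=> //; have hex := sorted_word hn hw; have [l hl] := word_length hex.
exists l => // w' [v hv ew'] l' [[s' hs' <-] _] {l'}.
have [_ hle] := hl; have [mw bw] := affine_mirrored ha; have [c hlc] := levels_exist mw bw.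
suff [t ht hts] : exists2 t, is_word T n t w & (size t <= size s')%N.
  by apply: leq_trans (hle _ ht) hts.
have hlc' : has_levels n w' c by rewrite ew'; exact: (levels_finite hn hv hlc).
clear ew' hv; move: {2}(size s').+1 (ltnSn (size s')) => m.
elim: m s' w' hs' hlc' => // m IH s' w' [hs' es'] hlc' hm.
case: (pselect (sorted_rep T n w')) => [hsr|hns].
  by exists s' => //; split=> //; rewrite es'; apply: (sorted_unique hn hsr hw hlc' hlc).
have [k hk hlt] : exists2 k, (0 < k <= n)%N & w' (simple_root T n k).2 < w' (simple_root T n k).1.
  apply: contrapT => hno; apply: hns; split; first by rewrite -es'; exact: affine_word.
  move=> k hk; rewrite ltNge le_eqVlt; apply/negP => /orP[/eqP e|h]; last by apply: hno; exists k.
  have /bij_inj i' : bijective w' by rewrite -es'; exact: bij_word.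
  by have := simple_lt T n k; rewrite (i' _ _ e) ltxx.
rewrite -es' in hlt; have [s2 [h1 h2 h3]] := exchange hn hk hs' hlt.
have [|||t ht hts] := IH s2 (w' \o gen T n k).
- by split=> //; rewrite h3 es'.
- exact: levels_right.
- by apply: leq_trans h2 _.
- by exists t => //; apply: leq_trans hts (ltnW h2).
Qed.

(** * The boundary path *)

Section BoundaryPath.
Variables (T : Type) (B : pred T).

Definition path_step (st : nat * seq nat) (x : T) : nat * seq nat :=
  if B x then (st.1, st.1 :: st.2) else (st.1.+1, st.2).

Definition gaps (L : seq T) : nat := count (predC B) L.

Lemma path_rows L g acc : exists2 R,
  foldl path_step (g, acc) L = ((g + gaps L)%N, R ++ acc) &
  [/\ size R = count B L, all (fun x => g <= x <= g + gaps L)%N R & sorted geq R].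
Proof.
elim/last_ind: L => [|L x [R e [h1 h2 h3]]] /=; first by exists [::]; rewrite /gaps ?addn0.
rewrite -cats1 foldl_cat e /= /path_step /= /gaps !count_cat /= !addn0.
case: (B x) => /=.
  exists ((g + gaps L)%N :: R); first by rewrite /gaps addn0.
  split=> /=; first by rewrite h1 addn1.
    rewrite leq_addr addn0 leqnn /=; exact: h2.
  rewrite path_sortedE => [|x1 x2 x3 h h']; last exact: leq_trans h' h.
  by rewrite h3 andbT; apply: sub_all h2 => z /andP[].
exists R; first by rewrite addn1 addnS.
split=> //; first by rewrite addn0.
by apply: sub_all h2 => z /andP[-> hz] /=; apply: leq_trans hz _; rewrite leq_add2l leq_addr.
Qed.

Lemma nth_filter_pos (s : seq nat) i : sorted geq s -> nth 0%N [seq x <- s | (0 < x)%N] i = nth 0%N s i.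
Proof.
elim: s i => //= x s IH i hp; have hs := path_sorted hp.
have [x0|x0] := posnP x; last by case: i => //= i; exact: IH.
have hz : all (fun z => z == 0%N) s.
  move: hp; rewrite path_sortedE => [|x1 x2 x3 h h']; last exact: leq_trans h' h.
  by move=> /andP[h _]; apply: sub_all h => z /=; rewrite x0 leqn0.
rewrite IH // x0; case: i => [|i] /=.
  by case: s hz {IH hp hs} => //= z s /andP[/eqP].
move/all_pred1P: hz => ->; rewrite !nth_nseq; do 2 case: ifP => //.
Qed.

(** The beads of [L2] give the upper rows, each having at least all gaps of [L1] to its left; the
    beads of [L1] give the rows below. *)
Lemma path_row_bounds L1 L2 i : (0 < i)%N ->
  let la := [seq x <- (foldl path_step (0%N, [::]) (L1 ++ L2)).2 | (0 < x)%N] in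
  ((i <= count B L2)%N -> (gaps L1 <= row_len la i)%N) /\
  ((count B L2 < i)%N -> (row_len la i <= gaps L1)%N).
Proof.
move=> i0 la.
have [R e [_ _ hs]] := path_rows (L1 ++ L2) 0 [::].
have -> : row_len la i = nth 0%N R i.-1.
  rewrite /la e cats0 /row_len -{1}(prednK i0) /=; exact: nth_filter_pos.
have [R1 e1 [h1 h2 _]] := path_rows L1 0 [::].
have [R2 e2 [h3 h4 _]] := path_rows L2 (gaps L1) R1.
move: e; rewrite foldl_cat e1 add0n cats0 e2 cats0 => -[_ <-].
rewrite nth_cat h3; split=> h.
  rewrite ifT; last by rewrite prednK.
  have hi : (i.-1 < size R2)%N by rewrite h3 prednK.
  by have /andP[] := all_nthP 0%N h4 _ hi.
rewrite ifF; last by lia.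
have [hlt|hge] := ltnP (i.-1 - count B L2) (size R1); last by rewrite nth_default.
by have := all_nthP 0%N h2 _ hlt; rewrite add0n.
Qed.
End BoundaryPath.

Definition is_label (n : nat) (x : int) : bool := ~~ ((period n)%:Z %| x)%Z.

Lemma label_runner n q j : (j < period n)%N ->
  is_label n (q * (period n)%:Z + j%:Z) = (0 < j)%N.
Proof.
move=> hj; rewrite /is_label (sameP dvdz_mod0P eqP) modzMDl modz_small ?lt0n //.
Qed.

(* The abacus is symmetric about the label N. *)
Lemma bead_reflect n w c t : mirrored n w -> injective w -> has_levels n w c -> (0 < t)%N ->
  [/\ is_label n ((period n)%:Z + t%:Z) && bead n w ((period n)%:Z + t%:Z) = pbead c t,
      is_label n ((period n)%:Z - t%:Z) && ~~ bead n w ((period n)%:Z - t%:Z) = pbead c t,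
      is_label n ((period n)%:Z + t%:Z) && ~~ bead n w ((period n)%:Z + t%:Z) =
        ~~ (period n %| t)%N && ~~ pbead c t
    & is_label n ((period n)%:Z - t%:Z) && bead n w ((period n)%:Z - t%:Z) =
        ~~ (period n %| t)%N && ~~ pbead c t].
Proof.
move=> hw wI hl t0; have [hc _] := hl.
have N0 : (0 < period n)%N by [].
rewrite (divn_eq t (period n)); set m := (t %/ _)%N; set j := (t %% _)%N.
have hj : (j < period n)%N by rewrite ltn_pmod.
have e1 : (period n)%:Z + (m * period n + j)%N%:Z = (m%:Z + 1) * (period n)%:Z + j%:Z by lia.
have [j0|j0] := posnP j.
  have e2 : (period n)%:Z - (m * period n + j)%N%:Z = (1 - m%:Z) * (period n)%:Z + 0%N%:Z by lia.
  rewrite e1 e2 j0 !label_runner // addn0 -hc pbead_mult hc dvdn_mull //=.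
have hj' : (0 < j < period n)%N by rewrite j0.
have e2 : (period n)%:Z - (m * period n + j)%N%:Z = (- m%:Z) * (period n)%:Z + (period n - j)%N%:Z by lia.
have hj2 : (0 < period n - j < period n)%N by lia.
have hd : (period n %| m * period n + j)%N = false.
  by rewrite dvdn_addr ?dvdn_mull // gtnNdvd.
rewrite e1 e2 !label_runner ?j0 //; try (by case/andP: hj2).
have hp : pbead c (m * period n + j) = (m%:Z < level c j) by rewrite -{1}hc pbead_level ?hc.
have [hj3 _] := andP hj2.
rewrite !(beadE _ hw wI hl) // hd hp hj3 /=.
have -> : level c (period n - j) = - level c j by rewrite -hc level_mirror // hc.
by split; lia.
Qed.

Lemma count_rev_iota (a : pred nat) k :
  count a (iota 0 k) = count (fun t => a (k - t)%N) (iota 1 k).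
Proof.
elim: k => // k IH; rewrite -addn1 iotaD count_cat IH addnC addn1 /= subn1 /= add0n addn0.
congr addn; rewrite -[2%N]/(1 + 1)%N iotaDl count_map; apply: eq_count => t /=.
by congr a; lia.
Qed.

Lemma count_iotaD (a : pred nat) m k :
  count a (iota m k) = count (fun t => a (m + t)%N) (iota 0 k).
Proof. by rewrite -[m in iota m](addn0 m) iotaDl count_map. Qed.

Lemma above_count c y k : (forall t, (y + k < t)%N -> ~~ pbead c t) ->
  count (pbead c) (iota y.+1 k) = above c y.
Proof.
elim: k y => [|k IH] y h /=.
  rewrite (@above_none c y (bead_bound c + y)) ?leq_addl //; last by move=> t ht; apply: h; lia.
  rewrite /above (@eq_in_count _ _ pred0) ?count_pred0 // => t; rewrite mem_iota => ht.
  by rewrite pbead_bound //; lia.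
by rewrite above_step IH // => t ht; apply: h; lia.
Qed.

Lemma count_gaps c y :
  (count (fun t => ~~ (period (size c) %| t) && ~~ pbead c t) (iota 1 y) + above c 0 =
  above c y + labels_upto (size c) y)%N.
Proof.
elim: y => [|y IH]; first by rewrite /labels_upto div0n addn0.
have -> : iota 1 y.+1 = iota 1 y ++ [:: y.+1] by have := iotaD 1 y 1; rewrite addn1 add1n.
rewrite count_cat /= addn0 [in LHS]addnAC IH (above_step c y).
have hS : labels_upto (size c) y.+1 = (labels_upto (size c) y + ~~ (period (size c) %| y.+1))%N.
  have := leq_div y (period (size c)).
  by rewrite /labels_upto divnS //; case: (_ %| _)%N => /=; lia.
rewrite hS; case: (boolP (pbead c y.+1)) => hb; last by rewrite andbT; lia.
suff -> : (period (size c) %| y.+1)%N = false by rewrite /=; lia.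
by apply/negbTE; apply: contraL hb => /dvdnP[m ->]; rewrite pbead_mult.
Qed.

Section CoreShape.
Variables (n : nat) (w : int -> int) (c : seq int).
Hypotheses (hw : mirrored n w) (wI : injective w) (hl : has_levels n w c).

Let M := (\max_(1 <= k < (2 * n).+1) `|w k%:Z|)%N.
Let N := period n.
Let G (x : int) := is_label n x && ~~ bead n w x.
Let Bd (x : int) := is_label n x && bead n w x.
(** With this indexing, the centre of symmetry [N] has index [N + M]. *)
Let X (m : nat) : int := m%:Z - M%:Z.

Lemma max_window k : (0 < k < period n)%N -> (`|w k%:Z| <= M)%N.
Proof.
move=> hk; apply: (@leq_bigmax_seq _ _ _ (fun k : nat => `|w k%:Z|%N)) => //.
by rewrite mem_index_iota; move: hk; rewrite /period; lia.
Qed.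

Lemma pbead_window t : pbead c t -> (N + t <= M)%N.
Proof.
have [hc _] := hl; rewrite (divn_eq t (period n)); set m := (t %/ _)%N; set j := (t %% _)%N.
have hj : (j < period n)%N by rewrite ltn_pmod.
have [j0|j0] := posnP j; first by rewrite j0 addn0 -hc pbead_mult.
have hj' : (0 < j < period n)%N by rewrite j0.
rewrite -{1}hc pbead_level ?hc // => hlt; have [k hk e] := levels_full hw hl hj'.
have := max_window hk; rewrite e.
have : (m%:Z + 1) * (period n)%:Z <= level c j * (period n)%:Z by rewrite ler_pM2r //; lia.
by rewrite /N; lia.
Qed.

Lemma count_split (a : pred int) m0 k :
  count a [seq x <- [seq X m | m <- iota m0 k] | is_label n x] =
  count (fun m => is_label n (X m) && a (X m)) (iota m0 k).
Proof. by rewrite count_filter count_map; apply: eq_count => m /=; rewrite andbC. Qed.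

Lemma gaps_low y : count (fun m => G (X m)) (iota 0 (N + M - y)) = above c (y : nat).
Proof.
rewrite count_rev_iota -(@above_count c y (N + M - y)); last first.
  by move=> t ht; apply/negP => /pbead_window; lia.
rewrite count_iotaD [in RHS]count_iotaD; apply: eq_in_count => t; rewrite mem_iota => ht.
have yt : (0 < y.+1 + t)%N by lia.
have [_ <- _ _] := bead_reflect hw wI hl yt.
have -> : X (N + M - y - (1 + t)) = (period n)%:Z - (y.+1 + t)%N%:Z by rewrite /X /N; lia.
by [].
Qed.

Lemma gaps_high y : count (fun m => G (X m)) (iota 0 (N + M + y.+1)) =
  (above c y + labels_upto n y)%N.
Proof.
have [hc _] := hl.
rewrite iotaD count_cat -[(N + M)%N]subn0 gaps_low subn0 addnC -hc -count_gaps; congr addn.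
rewrite /= add0n; have -> : G (X (N + M)) = false.
  by rewrite /G /X /N PoszD addrK /is_label dvdzz.
rewrite count_iotaD [in RHS]count_iotaD; apply: eq_in_count => t ht.
have t0 : (0 < 1 + t)%N by [].
have [_ _ + _] := bead_reflect hw wI hl t0; rewrite hc => <-.
have -> : X ((N + M).+1 + t) = (period n)%:Z + (1 + t)%N%:Z by rewrite /X /N; lia.
by [].
Qed.

Lemma beads_high y k : (M <= N + y + k)%N ->
  count (fun m => Bd (X m)) (iota (N + M + y.+1) k) = above c y.
Proof.
move=> hk; rewrite -(@above_count c y k); last first.
  by move=> t ht; apply/negP => /pbead_window; lia.
rewrite count_iotaD [in RHS]count_iotaD; apply: eq_in_count => t ht.
have yt : (0 < y.+1 + t)%N by [].
have [<- _ _ _] := bead_reflect hw wI hl yt.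
have -> : X (N + M + y.+1 + t) = (period n)%:Z + (y.+1 + t)%N%:Z by rewrite /X /N; lia.
by [].
Qed.

Lemma beads_low y : (y <= N + M)%N -> (N <= M)%N ->
  count (fun m => Bd (X m)) (iota (N + M - y) (M.+1 + y - N)) = (above c y + labels_upto n y)%N.
Proof.
have [hc _] := hl; move=> hy hNM.
(* The range splits into the [y] integers before [N], the integer [N], which is no label, and the
   rest up to [M]. *)
have -> : (M.+1 + y - N = y + (1 + (M - N)))%N by lia.
rewrite !iotaD !count_cat subnK // -[X in (_ + (_ + X))%N]/(count _ (iota (N + M + 1) (M - N))).
rewrite (@beads_high 0) //; last by lia.
rewrite -hc -count_gaps /= addn0.
have -> : Bd (X (N + M)) = false.
  by rewrite /Bd /X /N PoszD addrK /is_label dvdzz.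
rewrite add0n; congr addn.
rewrite count_iotaD count_rev_iota; apply: eq_in_count => t; rewrite mem_iota => ht.
have t0 : (0 < t)%N by lia.
have [_ _ _ +] := bead_reflect hw wI hl t0; rewrite hc => <-.
have -> : X (N + M - y + (y - t)) = (period n)%:Z - t%:Z by rewrite /X /N; lia.
by [].
Qed.

(** The first two clauses cut the path after [N + y], the third one before [N - y]. For [N + y > M]
    no bead lies above the cut, so [u = 0] and only the second clause has content. *)
Lemma core_shape : shape_of (core n w) c.
Proof.
have [hc _] := hl; split; first by rewrite mem_filter.
move=> y i i0 u v.
pose L m k := [seq x <- [seq X m | m <- iota m k] | is_label n x].
have hcut m0 : (m0 <= (2 * M).+1)%N ->
    ((i <= count (bead n w) (L m0 ((2 * M).+1 - m0)))%N -> (gaps (bead n w) (L 0 m0) <= row_len (core n w) i)%N) /\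
    ((count (bead n w) (L m0 ((2 * M).+1 - m0)) < i)%N -> (row_len (core n w) i <= gaps (bead n w) (L 0 m0))%N).
  move=> h; have := @path_row_bounds _ (bead n w) (L 0%N m0) (L m0 ((2 * M).+1 - m0)%N) i i0.
  by rewrite /L -filter_cat -map_cat -iotaD subnKC.
have hu : (0 < u)%N -> (N + y < M)%N.
  move=> u0; rewrite ltnNge; apply/negP => hM; move: u0; rewrite /u -(@above_count c y 0) //.
  by move=> t ht; apply/negP => /pbead_window; lia.
have hv : v = (above c y + labels_upto n y)%N by rewrite /v hc.
have gL m0 : gaps (bead n w) (L 0%N m0) = count (fun m => G (X m)) (iota 0 m0).
  by rewrite /gaps /L count_split; apply: eq_count.
have bL m0 k : count (bead n w) (L m0 k) = count (fun m => Bd (X m)) (iota m0 k).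
  by rewrite /L count_split; apply: eq_count.
have h12 : ((i <= u)%N -> (v <= row_len (core n w) i)%N) /\ ((u < i)%N -> (row_len (core n w) i <= v)%N).
  have [hle|hgt] := leqP (N + y) M.
    have [|h1 h2] := hcut (N + M + y.+1)%N; first by lia.
    rewrite bL gL gaps_high beads_high -?hv // in h1 h2; lia.
  split=> [hi|_]; first by have := hu (leq_trans i0 hi); lia.
  have [|_ h2] := hcut (2 * M).+1; first by [].
  rewrite subnn bL gL in h2; apply: leq_trans (h2 i0) _; rewrite hv -gaps_high.
  have -> : (N + M + y.+1 = (2 * M).+1 + (N + y - M))%N by lia.
  by rewrite iotaD count_cat leq_addr.
have [h1 h2] := h12; split=> // hi.
have [->//|u0] := posnP u; have hlt := hu u0.
have [|h3 _] := hcut (N + M - y)%N; first by lia.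
have e : ((2 * M).+1 - (N + M - y) = M.+1 + y - N)%N by lia.
rewrite bL gL e gaps_low beads_low -?hv in h3; try lia.
Qed.
End CoreShape.

(** * Bounded partitions *)

Lemma hat_ends e0 en a m b : hat e0 en (a :: rcons m b) =
  (if e0 && (0 < a) then 1 - a else a) :: rcons m (if en then - `|b| else b).
Proof. by rewrite /hat -rcons_cons hatn_rcons. Qed.

Lemma split_ends (c : seq int) : (1 < size c)%N -> exists a m b, c = a :: rcons m b.
Proof. by case: c => // a c; case/lastP: c => // m b _; exists a, m, b. Qed.

Lemma norm1_ends a m b : norm1 (a :: rcons m b) = (`|a| + norm1 m + `|b|)%N.
Proof. by rewrite norm1_cons -cats1 norm1_cat norm1_cons addn0 addnA. Qed.

(** A positive first entry is peeled at once, and the head after any peel is nonpositive, so the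
    part 1 cannot arise later. *)
Lemma parts_head c : (1%N \in parts c) = (0 < head 0 c).
Proof.
elim/parts_ind: c => [c h|c h IH].
  rewrite parts_nil //; move/eqP: h; rewrite norm1_eq0.
  by case: c => //= x c /andP[/eqP-> _]; rewrite ltxx.
rewrite (parts_cons h) inE {}IH; case: (topP h) => s1 v s2 -> h1 hv => [|hz].
  case: s1 h1 => [|x s1] /= ; first by rewrite hv.
  by move=> /andP[hx _]; rewrite [RHS]ltNge hx /=; lia.
rewrite /= (_ : (0 < 1 + v) = false) ?orbF; last by lia.
by case: s1 h1 => [|x s1] /=; [|move=> /andP[hx _]]; lia.
Qed.

(** The labels available to folded vectors: a nonpositive first entry excludes 1 and a nonpositive
    last entry excludes [n]. On them [part_size] is an increasing bijection onto an initial segment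
    of the positive integers. *)
Definition part_ok (e0 en : bool) (n p : nat) : bool := [&& e0 < p, en ==> (p != n) & p <= 2 * n]%N.

Lemma hat_parts (e0 en : bool) c : (1 < size c)%N ->
  all (part_ok e0 en (size c)) (parts (hat e0 en c)).
Proof.
move=> hs; have [a [m [b e]]] := split_ends hs.
have hsz := size_hat e0 en c; have hh : e0 -> head 0 (hat e0 en c) <= 0.
  by rewrite e hat_ends => -> /=; case: (ltP 0 a) => ?; lia.
have hl : en -> last 0 (hat e0 en c) <= 0.
  by rewrite e hat_ends => -> /=; rewrite last_rcons; lia.
set h := hat e0 en c in hsz hh hl *; apply/allP => p hp.
have := allP (parts_bound h) p hp; rewrite hsz => /andP[p0 p2].
rewrite /part_ok p2 andbT; apply/andP; split.
  case: (e0) hh => //= /(_ isT) hh; rewrite ltn_neqAle p0 andbT; apply/eqP => e1.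
  by move: hp; rewrite -e1 parts_head ltNge hh.
apply/implyP => hen; apply/eqP => ep; have [|h1 _ _] := @parts_last h; first by rewrite hsz.
by move: hp; rewrite ep -hsz h1 ltNge hl.
Qed.

Lemma part_size_lt (e0 en : bool) n p q : (1 < n)%N -> part_ok e0 en n p -> part_ok e0 en n q ->
  (part_size e0 en n p < part_size e0 en n q)%N = (p < q)%N.
Proof. by rewrite /part_ok /part_size; case: e0; case: en => /=; lia. Qed.

Lemma part_size_inj (e0 en : bool) n p q : (1 < n)%N -> part_ok e0 en n p -> part_ok e0 en n q ->
  part_size e0 en n p = part_size e0 en n q -> p = q.
Proof. by rewrite /part_ok /part_size; case: e0; case: en => /=; lia. Qed.

Lemma part_size_rel (e0 en : bool) n p q : (1 < n)%N -> part_ok e0 en n p -> part_ok e0 en n q ->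
  part_rel (n - e0 - en) (part_size e0 en n p) (part_size e0 en n q) = part_rel n p q.
Proof. by rewrite /part_ok /part_size /part_rel; case: e0; case: en => /=; lia. Qed.

Lemma part_size_bound (e0 en : bool) n p : (1 < n)%N -> part_ok e0 en n p ->
  (0 < part_size e0 en n p <= 2 * n - e0 - en)%N.
Proof. by rewrite /part_ok /part_size; case: e0; case: en => /=; lia. Qed.

Definition part_of_size (e0 en : bool) (n a : nat) : nat := (a + e0 + (en && (n <= a + e0)))%N.

Lemma part_of_sizeK (e0 en : bool) n a : (1 < n)%N -> (0 < a <= 2 * n - e0 - en)%N ->
  part_ok e0 en n (part_of_size e0 en n a) /\ part_size e0 en n (part_of_size e0 en n a) = a.
Proof. by rewrite /part_ok /part_size /part_of_size; case: e0; case: en => /=; split; lia. Qed.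

Lemma sorted_part_rel m (s : seq nat) : all (fun x => 0 < x)%N s ->
  sorted (part_rel m) (rev s) <->
  sorted geq s /\ forall x, (0 < x <= m)%N -> (count_mem x s <= 1)%N.
Proof.
rewrite rev_sorted; set R := fun x y => _.
have tR : transitive R by move=> y x z; rewrite /R => h1 h2; exact: part_rel_trans h2 h1.
have tg : transitive geq by move=> y x z h1 h2; exact: leq_trans h2 h1.
elim: s => [|x s IH] //= /andP[x0 hs]; rewrite !path_sortedE //.
have {IH} IH := IH hs; split=> [/andP[hx /IH[h1 h2]]|[/andP[hx h1] h2]].
  split=> [|z hz]; first by rewrite h1 andbT; apply: sub_all hx => y; rewrite /R /part_rel; lia.
  case: eqVneq => [e|_]; last exact: h2.
  rewrite (count_memPn _) //; apply/negP => hin; have := allP hx _ hin.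
  by rewrite /R /part_rel -e; lia.
apply/andP; split.
  apply/allP => y hy; have := allP hx y hy; rewrite /= leq_eqVlt /R /part_rel.
  case/orP => [/eqP e|-> //]; rewrite e eqxx ltnn /=; rewrite ltnNge; apply/negP => hm.
  have := h2 x; rewrite x0 hm eqxx => /(_ isT); have : (0 < count_mem x s)%N.
    by rewrite -has_count has_pred1 -e.
  by move=> hc hc'; have := leq_trans (leq_add (leqnn 1) hc) hc'.
apply/IH; split=> // z hz; exact: leq_trans (leq_addl _ _) (h2 z hz).
Qed.

Definition peel_shape (e0 en : bool) (c : seq int) : seq nat :=
  [seq part_size e0 en (size c) p | p <- rev (parts (hat e0 en c))].

Lemma peel_shape_pos (e0 en : bool) c : (1 < size c)%N -> all (fun x => 0 < x)%N (peel_shape e0 en c).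
Proof.
move=> hs; rewrite /peel_shape all_map all_rev; apply: sub_all (hat_parts e0 en hs) => p hp /=.
by have /andP[] := part_size_bound hs hp.
Qed.

Lemma max_partE T n : (1 < n)%N -> max_part T n = (2 * n - s0_is_D T - sn_is_D T)%N.
Proof. by case: T => /=; lia. Qed.

Lemma max_distinct_partE T n : max_distinct_part T n = (n - s0_is_D T - sn_is_D T)%N.
Proof. by case: T => /=; lia. Qed.

Lemma star_sizeE T n : sn_is_D T -> (1 < n)%N -> star_size T n = part_size (s0_is_D T) true n n.+1.
Proof. by case: T => //= _ hn; rewrite /part_size /=; lia. Qed.

(** The closed form of the bounded partition on levels; [rev] puts the last row, which is peeled
    first, at the end. *)
Definition peel_value (T : quotient_type) (c : seq int) : starred_partition :=
  (peel_shape (s0_is_D T) (sn_is_D T) c, sn_is_D T && (0 < last 0 c)).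

Lemma last_hat e0 c : (1 < size c)%N -> last 0 (hat e0 true c) = - `|last 0 c|.
Proof. by move=> /split_ends[a [m [b ->]]]; rewrite hat_ends /= !last_rcons. Qed.

Lemma peel_value_target T n c : (min_rank T <= n)%N -> size c = n ->
  target_partitions T n (peel_value T c).
Proof.
move=> hn hc; have n2 : (1 < n)%N by apply: leq_trans hn; case: (T).
have hs : (1 < size c)%N by rewrite hc.
have hok := hat_parts (s0_is_D T) (sn_is_D T) hs; rewrite hc in hok.
have hpos := peel_shape_pos (s0_is_D T) (sn_is_D T) hs.
have hsort : sorted (part_rel (max_distinct_part T n)) (rev (peel_value T c).1).
  rewrite /peel_value /peel_shape /= -map_rev revK hc max_distinct_partE sorted_map.
  have hm : {in part_ok (s0_is_D T) (sn_is_D T) n &, {mono part_size (s0_is_D T) (sn_is_D T) n : x y / part_rel n x y >-> part_rel (n - s0_is_D T - sn_is_D T) x y}}.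
    by move=> p q hp hq; exact: part_size_rel.
  rewrite -sorted_map (mono_sorted_in hm) //.
  by have := parts_sorted (hat (s0_is_D T) (sn_is_D T) c); rewrite size_hat hc.
have [h1 h2] := (sorted_part_rel _ hpos).1 hsort.
split=> //; first last.
- move=> /= /andP[hen hl]; split=> //; rewrite star_sizeE // /peel_shape hc hen.
  apply: map_f; rewrite mem_rev.
  have [|_ h3 _] := @parts_last (hat (s0_is_D T) true c); first by rewrite size_hat.
  by rewrite size_hat hc last_hat // in h3; apply: h3; rewrite oppr_lt0 normr_gt0 gt_eqF.
- apply/allP => x /mapP[p hp ->]; rewrite max_partE // hc; apply: part_size_bound => //.
  by apply: (allP hok); rewrite mem_rev in hp.
Qed.

(** The parts give back the folded vector. The star restores the sign of the last entry, and the two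
    candidates [a] and [1 - a] for the first one have opposite parities. *)
Lemma peel_value_inj T n c1 c2 : (min_rank T <= n)%N -> size c1 = n -> size c2 = n ->
  (s0_is_D T -> ~~ odd (norm1 c1)) -> (s0_is_D T -> ~~ odd (norm1 c2)) ->
  peel_value T c1 = peel_value T c2 -> c1 = c2.
Proof.
move=> hn hc1 hc2 o1 o2; have n2 : (1 < n)%N by apply: leq_trans hn; case: (T).
have hs1 : (1 < size c1)%N by rewrite hc1.
have hs2 : (1 < size c2)%N by rewrite hc2.
rewrite /peel_value => -[hS hstar].
have hp : parts (hat (s0_is_D T) (sn_is_D T) c1) = parts (hat (s0_is_D T) (sn_is_D T) c2).
  apply: (can_inj (@revK _)); move: hS; rewrite /peel_shape hc1 hc2.
  have hI : {in [pred p | part_ok (s0_is_D T) (sn_is_D T) n p] &, injective (part_size (s0_is_D T) (sn_is_D T) n)}.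
    by move=> p q hp hq; exact: part_size_inj.
  apply: (inj_in_map hI); rewrite inE all_rev.
    by have := hat_parts (s0_is_D T) (sn_is_D T) hs1; rewrite hc1.
  by have := hat_parts (s0_is_D T) (sn_is_D T) hs2; rewrite hc2.
have := parts_inj _ hp; rewrite !size_hat hc1 hc2 => /(_ erefl).
have [a1 [m1 [b1 e1]]] := split_ends hs1; have [a2 [m2 [b2 e2]]] := split_ends hs2.
move: hstar o1 o2; rewrite e1 e2 !hat_ends /= !last_rcons !norm1_ends.
move=> hstar o1 o2 [ha hm]; have := congr1 (last 0) hm; rewrite !last_rcons => hb.
have {hm} hm : m1 = m2 by move/(congr1 rev): hm; rewrite !rev_rcons => -[_ /(can_inj (@revK _))].
have eb : b1 = b2 by case: (sn_is_D T) hb hstar => //= hb hstar; lia.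
rewrite hm eb; congr cons; move: ha o1 o2; rewrite hm eb.
case: (s0_is_D T) => //= + /(_ isT) + /(_ isT).
by case: (ltP 0 a1) => ?; case: (ltP 0 a2) => ?; lia.
Qed.

Lemma peel_value_surj T n b : (min_rank T <= n)%N -> target_partitions T n b ->
  exists c, [/\ size c = n, s0_is_D T -> ~~ odd (norm1 c) & peel_value T c = b].
Proof.
case: b => s star hn [/= hsort hall hcount hstar].
have n2 : (1 < n)%N by apply: leq_trans hn; case: (T).
set e0 := s0_is_D T in hstar *; set en := sn_is_D T in hstar *.
have hall' : all (fun x => 0 < x <= 2 * n - e0 - en)%N s by rewrite -max_partE.
have hpos : all (fun x => 0 < x)%N s by apply: sub_all hall' => x /andP[].
have hs : sorted (part_rel (n - e0 - en)) (rev s).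
  by apply/sorted_part_rel => //; split=> //; rewrite -max_distinct_partE.
pose b := [seq part_of_size e0 en n x | x <- rev s].
have hbs : [seq part_size e0 en n p | p <- b] = rev s.
  rewrite /b -map_comp map_id_in // => x; rewrite mem_rev => hx /=.
  by have [] := part_of_sizeK n2 (allP hall' x hx).
have hok : all (part_ok e0 en n) b.
  rewrite /b all_map all_rev; apply: sub_all hall' => x hx /=.
  by have [] := part_of_sizeK n2 hx.
have hm : {in part_ok e0 en n &, {mono part_size e0 en n : x y / part_rel n x y >-> part_rel (n - e0 - en) x y}}.
  by move=> p q hp hq; exact: part_size_rel.
have hb : sorted (part_rel n) b by rewrite -(mono_sorted_in hm) // hbs.
have n0 : (0 < n)%N by exact: ltnW.
have hb2 : all (fun p => 0 < p <= 2 * n)%N b.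
  by apply: sub_all hok => p; rewrite /part_ok => /and3P[h1 _ ->]; rewrite andbT; exact: leq_ltn_trans (leq0n _) h1.
have [h hh hpb] := parts_surj n0 hb hb2.
have hsh : (1 < size h)%N by rewrite hh.
have [a [m [z e]]] := split_ends hsh.
have ha : e0 -> a <= 0.
  move=> he; rewrite leNgt; apply/negP => ha.
  have : 1%N \in parts h by rewrite parts_head e.
  by rewrite hpb => /(allP hok); rewrite /part_ok he.
have hlast : last 0 h = z by rewrite e /= last_rcons.
have [hz1 hz2 hz3] := parts_last hsh; rewrite hlast hh in hz1 hz2 hz3.
have hz : en -> z <= 0.
  move=> he; rewrite leNgt -hz1 hpb; apply/negP => /(allP hok).
  by rewrite /part_ok he eqxx andbF.
pose z' := if star then - z else z.
have hz' : (if en then - `|z'| else z') = z.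
  rewrite /z'; case: (boolP en) => he.
    by have hz0 := hz he; case: (star); rewrite ?normrN ler0_norm // opprK.
  by case: (star) hstar => // /(_ isT)[]; rewrite (negbTE he).
(* The fold at the first entry is undone exactly when this is needed to make [norm1] even. *)
pose a' := if e0 && odd (norm1 h) then 1 - a else a.
exists (a' :: rcons m z'); split.
- by rewrite -hh e /= !size_rcons.
- move=> he; rewrite /a' he e !norm1_ends /=.
  have -> : `|z'|%N = `|z|%N by rewrite /z'; case: (star); rewrite ?abszN.
  by case: ifP => ho; rewrite ?ho //; move: ho; rewrite !oddD odd_absz_sub; do 3 case: odd.
have hhat : hat e0 en (a' :: rcons m z') = h.
  rewrite hat_ends hz' e; congr cons; rewrite /a'; case: (boolP e0) ha => //= he /(_ isT) ha.
  case: (odd _); last by rewrite ltNge ha.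
  by rewrite subKr ifT // subr_gt0 (le_lt_trans ha).
rewrite /peel_value -/e0 -/en /peel_shape hhat hpb.
have -> : size (a' :: rcons m z') = n by rewrite -hh e /= !size_rcons.
rewrite map_rev hbs revK; congr pair; rewrite /= last_rcons /z'.
case: (star) hstar => [/(_ isT)[he hin]|_]; last by case: (boolP en) hz => // he /(_ isT) hz0 /=; rewrite ltNge hz0.
rewrite -/en in he; rewrite he /=; have := hz he; rewrite le_eqVlt => /orP[/eqP z0|]; last by rewrite oppr_gt0 => ->.
(* A starred part corresponds to the label [n.+1], which is not a part when the last entry vanishes;
   so [- z] is indeed positive. *)
have := hz3 z0; rewrite hpb; case/negP; apply/mapP; exists (star_size T n); first by rewrite mem_rev.
rewrite star_sizeE // /part_of_size /part_size -/e0 he /=; clear -n2; by case: (e0); lia.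
Qed.

(** * The upper diagram *)

Lemma peels_top c p c' : peels_to c p c' -> top_part c = p.
Proof. by case. Qed.

Lemma last_cat_cons (s : seq int) x t : last 0 (s ++ x :: t) = last x t.
Proof. by rewrite last_cat. Qed.

Lemma hat_cat_cons e0 en s1 x y s2 : (0 < size s1)%N ->
  hat e0 en (s1 ++ x :: y :: s2) = hat0 e0 s1 ++ x :: hatn en (y :: s2).
Proof. by case: s1 => // z s1 _; rewrite /hat hatn_cat hatn_cons -hat0_cat. Qed.

(** A part of star size has label [n.+1] in the folded vector. The bead is then on runner [n] if the
    last level is positive, and $s_{n-1}$ moves it, or on runner [n.+1] if it is negative, and
    $s_n^D$ moves it. Once the part is below [n], moves no longer affect the sign of the last
    entry. *)
Lemma move_star (e0 : bool) c r p c' : move e0 true c r p c' -> (3 + e0 <= size c)%N ->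
  let n := size c in let q := top_part (hat e0 true c) in
  (q = n.+1 -> (r == n.-1) = (0 < last 0 c)) /\
  ((q < n)%N -> (0 < last 0 c') = (0 < last 0 c)).
Proof.
case=> {c r p c'}.
- move=> s1 a v [|x t] h1 ha hv hs n q.
    have hn : n = (size s1).+2 by rewrite /n size_cat addn2.
    rewrite !last_cat /= hn eqxx hv; split=> //.
    have hb := hat0_nonpos h1.
    suff -> : q = n.+1 by lia.
    have h0 : (0 < size s1)%N by move: hs; rewrite -/n hn; lia.
    rewrite /q hat_cat_cons // -cat_rcons.
    have -> : hatn true [:: v] = [:: - v] by rewrite /hatn /rev /= gtr0_norm.
    have hv' : - v < 0 by lia.
    have hrn : nonpos (rcons (hat0 e0 s1) a) by rewrite all_rcons ha.
    have [-> _] := top_neg hrn hv' (isT : allzero [::]).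
    by rewrite size_rcons size_hat0 hn addn0.
  split; last by rewrite !last_cat_cons.
  move=> hq; exfalso; have hlt : (size (hat e0 true (s1 ++ [:: a, v, x & t])) < q)%N by rewrite size_hat hq.
  have [] := top_gt (or_intror (leqnn q)) hlt; rewrite -cat_rcons.
  rewrite /hat hatn_cat hatn_cons; case: (s1) => [|y s] /=.
    by rewrite (ltNge 0 a) ha andbF (leNgt v) hv andbF.
  by rewrite all_cat /= (leNgt v) hv !andbF.
- move=> v s /negbTE he hv hs n q; split=> [hq|_].
    exfalso; have hlt : (size (hat e0 true (v :: s)) < q)%N by rewrite size_hat hq.
    have [] := top_gt (or_intror (leqnn q)) hlt; rewrite he.
    by case: (s) hs => [|x t] //= hs; rewrite /hat hatn_cons /= leNgt hv.
  by case: (s) hs => [|x t].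
- move=> a v s he ha hv hs n q; case: s hs @n @q => [|x t] hs n q; first by move: hs; rewrite he.
  split=> // hq; exfalso; have hlt : (size (hat e0 true [:: a, v, x & t]) < q)%N by rewrite size_hat hq.
  have [] := top_gt (or_intror (leqnn q)) hlt; rewrite /hat !hatn_cons /=.
  by rewrite (leNgt v) hv andbF.
- by [].
- move=> s a v he h1 ha hv hs n q.
  have hn : n = (size s).+2 by rewrite /n size_cat addn2.
  have h0 : (0 < size s)%N by move: hs; rewrite -/n hn; lia.
  have hv' : - `|v| < 0 by lia.
  have hrn : nonpos (rcons (hat0 e0 s) a) by rewrite all_rcons ha hat0_nonpos.
  have -> : q = n.+1.
    rewrite /q hat_cat_cons // -cat_rcons.
    have -> : hatn true [:: v] = [:: - `|v|] by [].
    have [-> _] := top_neg hrn hv' (isT : allzero [::]).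
    by rewrite size_rcons size_hat0 hn addn0.
  rewrite !last_cat /= hn; split; [|lia].
  by move=> _; rewrite (ltNge 0 v) (ltW hv) /=; lia.
- move=> s v he h1 hv hs n q.
  have hn : n = (size s).+2 by rewrite /n size_cat addn2.
  have h0 : (0 < size s)%N by move: hs; rewrite -/n hn; lia.
  suff -> : q = n.+2 by lia.
  rewrite /q hat_cat_cons //.
  have -> : hatn true [:: 0] = [:: 0] by [].
  have [-> _] := top_neg (hat0_nonpos h1) hv (isT : allzero [:: 0]).
  by rewrite size_hat0 hn addn2.
- move=> s1 v s2 h1 hv hz; case: s2 hz => [|x t] hz hen hs n q; first by [].
  have hn : n = (size s1 + (size t).+3)%N by rewrite /n size_cat.
  suff -> : q = (size s1 + (size (0 :: x :: t)).*2).+2 by rewrite /= hn; lia.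
  have hz' : allzero (0 :: x :: t) by [].
  rewrite /q hat_nonpos_tail //; last by apply/andP; split; [exact: ltW|exact: (allzero_nonpos hz')].
  case: (s1) h1 => [|y s] h1.
    have [<- _] := @top_neg [::] v _ isT hv hz'.
    by rewrite /= (_ : (0 < v) = false) ?andbF //; lia.
  rewrite hat0_cat; have [-> _] := top_neg (hat0_nonpos h1) hv hz'.
  by rewrite size_hat0.
- move=> a s he ha hz hs n q; case: s hz hs @n @q => [|x t] hz hs n q; first by move: hs; rewrite he.
  have hh : hat e0 true [:: a, 0, x & t] = [:: 1 - a, 0, x & t].
    rewrite /hat !hatn_cons hatn_id ?allzero_nonpos //= he ifT //=; lia.
  have h1 : 1 - a < 0 by lia.
  have [e _] := @top_neg [::] _ (0 :: x :: t) isT h1 hz.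
  suff -> : q = (2 * n)%N by rewrite /n /=; lia.
  by rewrite /q hh e /n /=; lia.
Qed.

Lemma sorted_shape T n w c : sorted_rep T n w -> has_levels n w c -> shape_of (core n w) c.
Proof. by move=> [/affine_mirrored[mw /bij_inj wI] _] hl; exact: core_shape. Qed.

(** A core determines the levels ([shape_inj]), and these determine the sorted representative
    ([sorted_unique]), so the existential witnesses in [acts_to] are unique. *)
Lemma acts_to_unique T n r w mu : (min_rank T <= n)%N ->
  sorted_rep T n w -> sorted_rep T n (gen T n r \o w) ->
  acts_to T n r (core n w) mu <-> mu = core n (gen T n r \o w).
Proof.
move=> hn hw hgw; have [/affine_mirrored[mw bw] _] := hw; have [c hl] := levels_exist mw bw.
have [/affine_mirrored[mg bg] _] := hgw; have [c' hl'] := levels_exist mg bg.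
split=> [[w1 [w1' [/min_length_repsE-/(_ hn) h1 e1 /min_length_repsE-/(_ hn) h1' <- [v hv ev]]]]|->].
  have [/affine_mirrored[m1 b1] _] := h1; have [c1 hl1] := levels_exist m1 b1.
  have ec : c1 = c.
    have [hc _] := hl; have [hc1 _] := hl1.
    apply: (@shape_inj (core n w)); rewrite ?hc ?hc1 //; last exact: (sorted_shape hw hl).
    by rewrite -e1; exact: (sorted_shape h1 hl1).
  rewrite ec in hl1; have ew := sorted_unique hn h1 hw hl1 hl.
  congr (core n _); apply: (sorted_unique hn h1' hgw _ hl').
  by rewrite ev ew; exact: (levels_finite hn hv hl').
exists w, (gen T n r \o w); split=> //; try exact/min_length_repsE.
by exists id => //; exists [::].
Qed.

Lemma above_hat (e0 en : bool) c : (1 < size c)%N -> above c e0 = norm1 (hat e0 en c).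
Proof.
move=> hs; have h0 : (0 < size c)%N by exact: ltnW.
have := above_ref e0 h0; have [a [m [b e]]] := split_ends hs.
rewrite e hat_ends !norm1_ends /= => h; move: h.
have -> : `|if en then - `|b| else b|%N = `|b|%N by case: (en) => //; rewrite abszN; lia.
by case: (e0) => /=; case: (ltP 0 a) => ha /=; lia.
Qed.

(** The row ends on diagonal [k.-1]: on [n] or [n.+1] for $s_n^D$, on 1 or [2 * n] for $s_0^D$. In
    each case exactly one of the last two boxes lies on a diagonal excluded from the record. *)
Lemma move_two_boxes (e0 en : bool) c r p c' : move e0 en c r p c' ->
  (2 + e0 + en <= size c)%N -> let n := size c in let k := labels_upto n p in
  (en && (r == n) -> k = n.+1 \/ k = n.+2) /\ (e0 && (r == 0%N) -> k = 2%N \/ k = (2 * n).+1).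
Proof.
case=> {c r p c'}.
- move=> s1 a v s2 _ _ _; rewrite size_cat /= => hs; split; first by move=> /andP[_]; lia.
  by rewrite andbF.
- by move=> v s /negbTE -> _ hs; split=> //=; rewrite andbF.
- by move=> a v s _ _ _ hs; split; [rewrite andbF|left; rewrite labels_small //=; lia].
- by move=> s v /negbTE -> _ _ hs; split=> //; rewrite andbF.
- move=> s a v he _ _ _; rewrite size_cat addn2 => hs; split; last by rewrite andbF.
  by left; rewrite labels_small; lia.
- move=> s v he _ _; rewrite size_cat addn2 he => hs; split; last by rewrite andbF.
  by right; rewrite labels_small; lia.
- move=> s1 v s2 _ _ _ _; rewrite size_cat /= => hs; split; first by move=> /andP[_]; lia.
  by rewrite andbF.
- move=> a s _ _ _ hs; split; first by rewrite andbF.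
  move=> _; right; have -> : ((size s).*2 + 6 = (period (size (a :: 0%R :: s : seq int))).+1)%N by rewrite /period /=; lia.
  by rewrite labels_wrap.
Qed.

(** The bound [row_len mu d < col] is kept for later: boxes recorded afterwards in row [d] fit
    inside [mu], hence lie strictly to the left of this one. *)
Lemma peel_step_forced T n w c r p c' (la := core n w) (mu := core n (gen T n r \o w))
    (d := above c (s0_is_D T)) :
  (min_rank T <= n)%N -> sorted_rep T n w -> has_levels n w c ->
  move (s0_is_D T) (sn_is_D T) c r p c' ->
  [/\ la <> [::], (0 < d)%N, central_row T la = d,
     forall r', peeling_residue T n la r' <-> r' = r &
     exists col, (row_len mu d < col <= row_len la d)%N /\
       forall x, recorded_box T n r la mu x <-> x = (d, col)].
Proof.
move=> hn hw hl hm; have [hc _] := hl; have [ha _] := hw.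
have hpar := levels_parity ha hl.
have hsz : (2 + s0_is_D T + sn_is_D T <= size c)%N by rewrite hc -min_rankE.
have [hw' hl'] := move_sorted hn hw hl hm.
have hs : shape_of la c := sorted_shape hw hl.
have hs' : shape_of mu c' := sorted_shape hw' hl'.
have hf := move_first hm hsz.
have d0 : (0 < d)%N by have [h1 h2 _] := hf; exact: above_gt0 h1 h2.
have hcr : central_row T la = d by apply: central_rowE => //; rewrite hc; move: hn; rewrite min_rankE; lia.
have hrow := first_row hs hf; rewrite -/d hc in hrow.
have hk : row_len la d = (d + (labels_upto n p).-1)%N.
  have p0 : (0 < p)%N by have [h1 _ _] := hf; exact: leq_ltn_trans h1.
  have n0 : (0 < n)%N by apply: leq_trans hn; case: (T).
  have : (0 < labels_upto n p)%N by rewrite /labels_upto subn_gt0 ltn_Pdiv // /period; lia.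
  by lia.
split=> //.
- move/eqP; rewrite (shape_nil hs) -above0 => /eqP h0.
  by have [h1 h2 _] := hf; have := above_gt0 (leq_ltn_trans (leq0n _) h1) h2; rewrite h0.
- move=> r'; rewrite /peeling_residue /central_box hcr hk residues_end //.
  by have := move_residue hm _ hpar; rewrite hc => /(_ hn); apply.
have hnext := move_next hm hsz; rewrite /= hc -/d in hnext.
have key : (row_len mu d < row_len la d)%N /\
    (two_boxes (s0_is_D T) (sn_is_D T) n r -> row_len la d = (row_len mu d).+2).
  case: hnext => [[p' [hf' hd' hlab]]|[hd' hlab]].
    have hrow' := first_row hs' hf'; rewrite hd' -/d (size_move hm) hc in hrow'.
    by case: (two_boxes _ _ _ _) hlab => hlab; lia.
  have n2 : (2 <= n)%N by apply: leq_trans hn; case: (T).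
  have hc' : size c' = n by rewrite (size_move hm).
  have [_ hsb] := hs'.
  have he0 : (s0_is_D T <= 1)%N by case: (s0_is_D T).
  have hle : (row_len mu d <= d.-1 + s0_is_D T)%N.
    have [_ h _] := hsb (s0_is_D T) d d0; move: h; rewrite hd' /= hc' labels_small; last by lia.
    by apply.
  have hge : (d + s0_is_D T <= row_len la d)%N.
    have [_ hsa] := hs; have [h _ _] := hsa (s0_is_D T) d d0; move: h.
    by rewrite -/d hc labels_small; [apply|lia].
  split; first by lia.
  (* After $s_0^D$ has moved the bead [N + 2], no bead is left at [N + 1], so the cuts at 0 and at 1
     both have [d.-1] rows above them. The second clause at 0 and the third at 1 then give row [d]
     the length [d.-1], against [d.+1] before. *)
  move=> /hlab [he e2 hb]; rewrite he in hd' hle hge.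
  have h01 : above c' 0 = d.-1 by rewrite above_step (negbTE hb) hd'.
  have [_ h _] := hsb 0%N d d0; rewrite h01 hc' labels_small // addn0 in h.
  have [_ _ h'] := hsb 1%N d d0; rewrite hc' labels_small in h'; last by lia.
  have h1' : above c' 1 = d.-1 by rewrite hd'.
  rewrite h1' in h'; rewrite e2 labels_small in hrow; last by lia.
  by move: h h'; clear -hrow d0; lia.
have [hlt htwo] := key.
have box1 : two_boxes (s0_is_D T) (sn_is_D T) n r = false ->
    forall x, recorded_box T n r la mu x <-> x = (d, row_len la d).
  move=> hb x; rewrite /recorded_box /central_box hcr; move: hb; rewrite /two_boxes.
  by case: (_ && _) => //=; case: (_ && _).
case: (boolP (two_boxes (s0_is_D T) (sn_is_D T) n r)) => [hb|/negbTE hb]; last first.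
  by exists (row_len la d); split; [rewrite hlt leqnn|exact: box1].
have [hkn hk0] := move_two_boxes hm hsz; rewrite hc in hkn hk0.
have {htwo} htwo := htwo hb.
(* The removed boxes are the last two of the row; the witness [j] puts the one other than [col] on
   an excluded diagonal. *)
have off ks col : (forall j, j \in ks -> col <> d + j)%N ->
    (exists2 j, j \in ks & (row_len la d).-1 + row_len la d - col = d + j)%N ->
    (row_len mu d < col <= row_len la d)%N ->
    (forall x, removed_off_diagonals d la mu ks x <-> x = (d, col)).
  move=> h1 [j hj ej] hcol [x1 x2]; split=> [[_ /= e1 e2 e3]|[-> ->]]; last by split.
  rewrite e1 in e3 *; congr pair; have := e3 j hj; lia.
have n2 : (2 <= n)%N by apply: leq_trans hn; case: (T).
rewrite /recorded_box hcr; case: (boolP (sn_is_D T && (r == n))) => hnr.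
  case: (hkn hnr) => hk1.
    exists (row_len la d).-1; split; first by lia.
    apply: off; [|exists n; rewrite ?inE //; lia|lia].
    by move=> j; rewrite inE => /eqP ->; lia.
  exists (row_len la d); split; first by lia.
  apply: off; [|exists n; rewrite ?inE //; lia|lia].
  by move=> j; rewrite inE => /eqP ->; lia.
move: hb; rewrite /two_boxes (negbTE hnr) /= => h0r; rewrite h0r.
case: (hk0 h0r) => hk1.
  exists (row_len la d); split; first by lia.
  apply: off; [|exists 0%N; rewrite ?inE //; lia|lia].
  by move=> j; rewrite !inE => /orP[/eqP->|/eqP ->]; lia.
exists (row_len la d).-1; split; first by lia.
apply: off; [|exists (2 * n)%N; rewrite ?inE ?eqxx ?orbT //; lia|lia].
by move=> j; rewrite !inE => /orP[/eqP->|/eqP ->]; lia.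
Qed.

(** * The recorded boxes followed along the moves *)

Lemma peels_parts c q l : peels_to c q l -> parts c = q :: parts l.
Proof. by case=> h <- <-; rewrite (parts_cons h). Qed.

Lemma peel_shape_move (e0 en : bool) c r p c' : move e0 en c r p c' -> (2 + e0 + en <= size c)%N ->
  let q := top_part (hat e0 en c) in
  exists S0, peel_shape e0 en c = rcons S0 (part_size e0 en (size c) q) /\
    ((peel_shape e0 en c' = S0 /\ part_size e0 en (size c) q = 1%N) \/
     exists x, peel_shape e0 en c' = rcons S0 x /\ part_size e0 en (size c) q = x.+1).
Proof.
move=> hm hs q; have [q1 [l [h1 h]]] := move_hat hm hs.
have eq1 : q = q1 by exact: peels_top h1.
exists [seq part_size e0 en (size c) p | p <- rev (parts l)]; rewrite /peel_shape (size_move hm).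
rewrite (peels_parts h1) rev_cons map_rcons -eq1; split=> //; rewrite eq1.
case: h => [[-> ->]|[q' [h2 ->]]]; [by left|right].
by exists (part_size e0 en (size c) q'); rewrite (peels_parts h2) rev_cons map_rcons.
Qed.

Lemma size_peel_shape (e0 en : bool) c : (1 < size c)%N -> size (peel_shape e0 en c) = above c e0.
Proof. by move=> hs; rewrite size_map size_rev size_parts -above_hat. Qed.

Lemma row_len_rcons S x i :
  row_len (rcons S x) i = if i == (size S).+1 then x else row_len S i.
Proof.
rewrite /row_len -rcons_cons nth_rcons /=; case: ltngtP => // h.
by rewrite nth_default // ltnW.
Qed.

Definition rows_of (S : seq nat) (x : nat) : seq nat := [seq i <- iota 1 (size S) | row_len S i == x].

Lemma rows_of_rcons S y x :
  rows_of (rcons S y) x = if y == x then rcons (rows_of S x) (size S).+1 else rows_of S x.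
Proof.
rewrite /rows_of size_rcons -[X in iota 1 X]addn1 iotaD cats1 filter_rcons row_len_rcons add1n eqxx.
have -> : [seq i <- iota 1 (size S) | row_len (rcons S y) i == x] = [seq i <- iota 1 (size S) | row_len S i == x].
  apply: eq_in_filter => i; rewrite mem_iota row_len_rcons => /andP[_ hi].
  by rewrite ifF //; apply/negbTE; move: hi; clear; lia.
by [].
Qed.

Lemma rows_of_bound S x i : i \in rows_of S x -> (i <= size S)%N.
Proof. by rewrite mem_filter mem_iota add1n ltnS => /and3P[]. Qed.

Lemma rows_of_nil S x : x \notin S -> rows_of S x = [::].
Proof.
move=> hx; apply/eqP; rewrite -[_ == _]negbK -has_filter; apply/hasPn => i.
rewrite mem_iota => /andP[i0 hi]; apply: contra hx => /eqP <-.
by case: i i0 hi => // i _ hi; rewrite /row_len /= mem_nth.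
Qed.

Lemma diagram_row_cons (b : cell * nat) U i :
  diagram_row (b :: U) i =
    (((b.1.1 == i) && (b.1 \notin [seq x.1 | x <- U])) + diagram_row U i)%N.
Proof.
rewrite /diagram_row /=; case: eqP => //= e.
have -> : (b.1 \in [seq x.1 | x <- U & x.1.1 == i]) = (b.1 \in [seq x.1 | x <- U]).
  apply/mapP/mapP => -[x hx eb]; exists x => //; last by rewrite mem_filter -eb e eqxx.
  by move: hx; rewrite mem_filter => /andP[].
by case: ifP.
Qed.

Lemma rightmost_residue_other (b : cell * nat) U i r : b.1.1 <> i ->
  rightmost_residue (b :: U) i r = rightmost_residue U i r.
Proof. by rewrite /rightmost_residue /= => /eqP/negbTE->. Qed.

Lemma rightmost_residue_head d col r' (U : seq (cell * nat)) r :
  (forall b, b \in U -> b.1.1 = d -> (b.1.2 < col)%N) ->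
  rightmost_residue ((d, col, r') :: U) d r = (r' == r).
Proof.
move=> h; rewrite /rightmost_residue /= eqxx leqnn /= [X in _ || X](_ : _ = false) ?orbF.
  rewrite [X in _ && X](_ : _ = true) ?andbT //.
  by apply/allP => b hb; apply/implyP => /eqP e; exact: ltnW (h b hb e).
apply/negbTE/hasPn => b hb; case: eqP => //= e; rewrite leqNgt (h b hb e) /= andbF //.
Qed.

(** Invariant tying the boxes still to be recorded to the levels. The first clause keeps them inside
    the current last row, which makes the box recorded one step earlier new and rightmost in its
    row. *)
Definition peels_as T n (c : seq int) (la : seq nat) (U : seq (cell * nat)) : Prop :=
  let S := peel_shape (s0_is_D T) (sn_is_D T) c in
  [/\ forall b, b \in U -> (0 < b.1.1 <= size S)%N /\
        (b.1.1 = size S -> (b.1.2 <= row_len la (size S))%N),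
     forall i, diagram_row U i = row_len S i
   & sn_is_D T -> rows_of S (star_size T n) != [::] ->
       rightmost_residue U (last 0%N (rows_of S (star_size T n))) n.-1 = (0 < last 0 c)].

Lemma peels_as_step T n c r p c' la mu U col : (min_rank T <= n)%N -> size c = n ->
  let d := above c (s0_is_D T) in
  move (s0_is_D T) (sn_is_D T) c r p c' -> (row_len mu d < col <= row_len la d)%N ->
  peels_as T n c' mu U -> peels_as T n c la ((d, col, r) :: U).
Proof.
move=> hn hc d hm hcol [ha hb hstar].
have n2 : (1 < n)%N by apply: leq_trans hn; case: (T).
have hs : (1 < size c)%N by rewrite hc.
have hsz : (2 + s0_is_D T + sn_is_D T <= size c)%N by rewrite hc -min_rankE.
have hdS := size_peel_shape (s0_is_D T) (sn_is_D T) hs; rewrite -/d in hdS.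
have [S0 [eS hS]] := peel_shape_move hm hsz; rewrite hc in eS hS.
set q := top_part _ in eS hS.
have hd : d = (size S0).+1 by rewrite -hdS eS size_rcons.
have hU b : b \in U -> (b.1.1 <= d)%N /\ (b.1.1 = d -> b.1.2 < col)%N.
  move=> hbU; have [h1 h2] := ha b hbU; case: hS => [[e _]|[x [e _]]]; rewrite e in h1 h2.
    by move: h1; rewrite hd; clear; lia.
  rewrite size_rcons -hd in h1 h2; split; first by case/andP: h1.
  by move=> /h2 h; have /andP[h3 _] := hcol; exact: leq_ltn_trans h h3.
have hnew : (d, col) \notin [seq x.1 | x <- U].
  by apply/mapP => -[b hbU eb]; have [_] := hU b hbU; rewrite -eb ltnn => /(_ erefl).
split.
- move=> b; rewrite hdS inE => /orP[/eqP->|hbU] /=.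
    by split=> [|_]; [rewrite leqnn hd|case/andP: hcol].
  have [h1 h2] := hU b hbU; have [/andP[h3 _] _] := ha b hbU; split; first by rewrite h3.
  by move=> /h2 h; have /andP[_ h4] := hcol; exact: leq_trans (ltnW h) h4.
- move=> i; rewrite diagram_row_cons hnew andbT /= hb eS row_len_rcons -hd eq_sym.
  case: hS => [[-> e]|[x [-> e]]]; rewrite ?row_len_rcons -?hd; case: eqVneq => // ->; rewrite e //.
  by rewrite /row_len hd /= nth_default.
move=> hen; rewrite eS; set z := part_size _ _ _ _ in eS hS *.
have hok : part_ok (s0_is_D T) (sn_is_D T) n q.
  have := hat_parts (s0_is_D T) (sn_is_D T) hs; rewrite hc.
  have [q1 [l [h1 _]]] := move_hat hm hsz; rewrite (peels_parts h1) /= => /andP[+ _].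
  by rewrite -(peels_top h1).
have hok1 : part_ok (s0_is_D T) (sn_is_D T) n n.+1 by rewrite /part_ok; case: (s0_is_D T); move: n2; clear; lia.
have hms : (3 + s0_is_D T <= size c)%N by move: hsz; rewrite hen addn1.
move: (hm); rewrite hen => hm1; have := move_star hm1 hms; rewrite hc.
have -> : top_part (hat (s0_is_D T) true c) = q by rewrite /q hen.
move=> [hs1 hs2]; rewrite rows_of_rcons -hd.
have hstE : star_size T n = part_size (s0_is_D T) (sn_is_D T) n n.+1 by rewrite star_sizeE // hen.
(* If [z] is the star size, row [d] is the last row of that size and [move_star] reads off its
   residue. If [z] is larger, no row has the star size, since the rows above are at least as long.
   If it is smaller, the row in question lies above and the move preserves the sign. *)
case: (ltngtP z (star_size T n)) => [hz|hz|hz]; last first.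
- rewrite last_rcons rightmost_residue_head; last by move=> b /hU[].
  by move=> _; apply: hs1; apply: part_size_inj hok hok1 _ => //; rewrite -hstE.
- rewrite rows_of_nil //; apply/negP => hin.
  have [hsort _ _ _] := peel_value_target hn hc; move: hsort; rewrite /= eS => hsort.
  have tg : transitive geq by move=> y x t h1 h2; exact: leq_trans h2 h1.
  move: hsort; rewrite -cats1 sorted_pairwise // pairwise_cat /= allrel1r => /andP[/allP/(_ _ hin)].
  by rewrite /geq /= leqNgt hz.
move=> hne; have hlt : (q < n)%N.
  have : (q < n.+1)%N by rewrite -(part_size_lt n2 hok hok1) -hstE.
  by move: hok; rewrite /part_ok hen /= => /and3P[_ h _]; move: h; clear; lia.
rewrite rightmost_residue_other; last first.
  move=> /= e; have : last 0%N (rows_of S0 (star_size T n)) \in rows_of S0 (star_size T n).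
    by case: (rows_of _ _) hne => //= x s _; exact: mem_last.
  by move/rows_of_bound; rewrite -e hd ltnn.
have eR : rows_of (peel_shape (s0_is_D T) (sn_is_D T) c') (star_size T n) = rows_of S0 (star_size T n).
  case: hS => [[-> _]|[x [-> e]]] //; rewrite rows_of_rcons ifF //.
  by apply/negbTE; rewrite neq_ltn (leq_trans _ hz) // e.
by have := hstar hen; rewrite eR => /(_ hne) ->; exact: hs2.
Qed.

Lemma peels_as_nil T n c : (min_rank T <= n)%N -> size c = n -> norm1 c = 0%N -> peels_as T n c [::] [::].
Proof.
move=> hn hc h0; have n2 : (1 < n)%N by apply: leq_trans hn; case: (T).
have hs : (1 < size c)%N by rewrite hc.
have : peel_shape (s0_is_D T) (sn_is_D T) c = [::].
  by apply: size0nil; rewrite size_peel_shape //; have := above_ref (s0_is_D T) (ltnW hs); rewrite h0; clear; lia.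
rewrite /peels_as => ->; split=> //= i.
by rewrite /row_len /diagram_row /=; case: i => // i; rewrite nth_default.
Qed.

Lemma peels_as_value T n c la U : (min_rank T <= n)%N -> size c = n -> peels_as T n c la U ->
  (diagram_shape U, diagram_star T n U) = peel_value T c.
Proof.
move=> hn hc [ha hb hst]; have n2 : (1 < n)%N by apply: leq_trans hn; case: (T).
have hs : (1 < size c)%N by rewrite hc.
have [_ _ _] := peel_value_target hn hc; rewrite /peel_value /=.
have hpos := peel_shape_pos (s0_is_D T) (sn_is_D T) hs.
set S := peel_shape _ _ c in ha hb hst hpos * => hin.
have hH : diagram_height U = size S.
  apply/eqP; rewrite eqn_leq; apply/andP; split.
    by apply/bigmax_leqP_seq => b hbU _; have [/andP[]] := ha b hbU.
  case: (posnP (size S)) => [-> //|h0].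
  have : (0 < diagram_row U (size S))%N.
    rewrite hb /row_len -(prednK h0) /=; apply: (allP hpos); apply: mem_nth.
    by rewrite prednK.
  rewrite /diagram_row; case e : [seq b <- U | b.1.1 == size S] => [|b t] // _.
  have : b \in [seq b <- U | b.1.1 == size S] by rewrite e mem_head.
  rewrite mem_filter => /andP[/eqP eb hbU]; rewrite -eb.
  by rewrite /diagram_height; apply: (@leq_bigmax_seq _ U xpredT (fun b : cell * nat => b.1.1) b hbU).
congr pair; rewrite ?/diagram_shape ?/diagram_star hH.
  have -> : [seq diagram_row U i | i <- iota 1 (size S)] = S.
    rewrite -[in RHS](mkseq_nth 0%N S) /mkseq (iotaDl 1 0) -map_comp.
    by apply: eq_map => i /=; rewrite hb.
  by apply/all_filterP.
have -> : [seq i <- iota 1 (size S) | diagram_row U i == star_size T n] = rows_of S (star_size T n).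
  by apply: eq_filter => i; rewrite hb.
case: (boolP (sn_is_D T)) hst hin => //= hen /(_ isT) hst hin.
case: eqP hst => [e _ /=|_ /(_ isT) -> //].
symmetry; apply/negbTE/negP => /hin[_ /(nthP 0%N)[i hi ei]].
have : i.+1 \in rows_of S (star_size T n) by rewrite mem_filter mem_iota /row_len /= ei eqxx add1n ltnS.
by rewrite e.
Qed.

Lemma central_peeling_sorted T n w c : (min_rank T <= n)%N -> sorted_rep T n w -> has_levels n w c ->
  (exists U, central_peeling T n (core n w) U) /\
  forall U, central_peeling T n (core n w) U -> peels_as T n c (core n w) U.
Proof.
move=> hn hw hl; have [ha _] := hw; have hpar := levels_parity ha hl; have [hc _] := hl.
move: c hc hpar w hw hl {ha}; apply: (@peeling_ind _ (sn_is_D T)); first by rewrite -min_rankE.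
  move=> c hc h0 w hw hl; have e : core n w = [::].
    by apply/eqP; rewrite (shape_nil (sorted_shape hw hl)) h0.
  rewrite e; split=> [|U]; first by exists [::]; exact: peel_nil.
  move eL : [::] => L hU; case: hU eL => [_|la mu r b U' hne _ _ _ _ _ /esym //].
  exact: peels_as_nil.
move=> c r p c' hc hp hm IH w hw hl.
have [hw' hl'] := move_sorted hn hw hl hm; have [[U' hU'] IH'] := IH _ hw' hl'.
have [hne hd hcr hres [col [hcol hrec]]] := peel_step_forced hn hw hl hm.
split=> [|U].
  exists ((above c (s0_is_D T), col, r) :: U'); apply: peel_step hU' => //.
  - by rewrite hcr.
  - exact/hres.
  - exact/acts_to_unique.
  - exact/hrec.
move eL : (core n w) => L hU; case: hU eL hne hcr hres hcol hrec => [-> //|la mu r1 b U1 _ _ h1 h2 h3 h4 eL].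
subst la; move=> _ hcr hres hcol hrec; move/hres: h1 => e1; subst r1.
move/(acts_to_unique _ hn hw hw'): h2 => e2; subst mu.
move/hrec: h3 => ->; exact: (peels_as_step hn hc hm hcol (IH' _ h4)).
Qed.

Lemma bounded_partitionE T n w c b : (min_rank T <= n)%N -> sorted_rep T n w -> has_levels n w c ->
  bounded_partition T n w b <-> b = peel_value T c.
Proof.
move=> hn hw hl; have [[U hU] h] := central_peeling_sorted hn hw hl; have [hc _] := hl.
split=> [[U1 hU1 ->]|->]; first exact: peels_as_value (h _ hU1).
by exists U => //; rewrite (peels_as_value hn hc (h _ hU)).
Qed.

(* The first conjunct says that the procedure defines a function f = B on the
   set of minimal length coset representatives. *)
Theorem theorem7p5 (T : quotient_type) (n : nat) (hn : (min_rank T <= n)%N) :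
  exists2 f : (int -> int) -> starred_partition,
    forall w, min_length_reps T n w ->
      forall b, bounded_partition T n w b <-> b = f w
    & set_bij (min_length_reps T n) (target_partitions T n) f.
Proof.
have hlev w : min_length_reps T n w -> exists c, [/\ sorted_rep T n w, has_levels n w c, size c = n &
    s0_is_D T -> ~~ odd (norm1 c)].
  move=> /(min_length_repsE _ hn) hw; have [ha _] := hw; have [mw bw] := affine_mirrored ha.
  by have [c hl] := levels_exist mw bw; exists c; split=> //; [case: hl|exact: levels_parity hl].
have [f hf] : exists f, forall w, min_length_reps T n w -> forall b, bounded_partition T n w b <-> b = f w.
  have /choice[f hf] : forall w, exists x, min_length_reps T n w -> forall b, bounded_partition T n w b <-> b = x.
    (* Outside the set of representatives the value of [f] is arbitrary. *)
    move=> w; have [h|h] := pselect (min_length_reps T n w); last by exists ([::], false).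
    have [c [hw hl _ _]] := hlev w h; exists (peel_value T c) => _ b.
    exact: bounded_partitionE.
  by exists f.
have fE w c : sorted_rep T n w -> has_levels n w c -> f w = peel_value T c.
  move=> hw hl; apply/(bounded_partitionE _ hn hw hl); apply/hf => //.
  exact/min_length_repsE.
exists f => //; split.
- move=> w /hlev[c [hw hl hc _]]; rewrite (fE w c) //; exact: peel_value_target.
- move=> w1 w2 /set_mem/hlev[c1 [hw1 hl1 hc1 o1]] /set_mem/hlev[c2 [hw2 hl2 hc2 o2]].
  rewrite (fE w1 c1) // (fE w2 c2) // => /(peel_value_inj hn hc1 hc2 o1 o2) e.
  by rewrite e in hl1; exact: (sorted_unique hn hw1 hw2 hl1 hl2).
move=> b /(peel_value_surj hn)[c [hc ho hv]]; have [w hw hl] := sorted_exists hn hc ho.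
by exists w; [exact/min_length_repsE|rewrite (fE w c)].
Qed.
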